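(* Let $p:A\to M$ be a Riemannian Lie algebroid with anchor $\#$, let $L$ be a leaf of its characteristic foliation, and let $g_L$ be the Sasaki metric on $A_L$. The divergence of the geodesic vector field $X_E$ (restricted to $A_L$) with respect to $g_L$ is given, for every $a\in A_L$, by $$\mathrm{div}(X_E)(a)=\mathrm{Tr}\,(\mathrm{ad}_{a^v})+\langle a^h,N\rangle ,$$ where $\mathrm{ad}_{a^v}:\mathcal G_{p(a)}\to\mathcal G_{p(a)}$, $b\mapsto[a^v,b]$, and $N=\sum_i T_{b_i}b_i$, with $(b_1,\ldots,b_s)$ any orthonormal basis of $\mathcal G_{p(a)}$.
   Context: Everything is smooth. A Lie algebroid over a manifold $M$ is a vector bundle $p:A\to M$ with a Lie bracket $[\,,]$ on $\Gamma(A)$ and a bundle map $\#:A\to TM$ (anchor) such that $\#:\Gamma(A)\to\mathfrak X(M)$ is a Lie algebra homomorphism and $[a,fb]=f[a,b]+\#(a)(f)b$. The image of $\#$ is an integrable generalized distribution, whose leaves form the characteristic foliation. For $x\in M$, $\mathcal G_x=\mathrm{Ker}(\#_x)\subset A_x$ with its induced Lie bracket. For a leaf $L$, $p_L:A_L\to L$ is the restriction of $A$ to $L$ (a transitive Lie algebroid over $L$) and $\mathcal G_L=\bigcup_{x\in L}\mathcal G_x$. A Riemannian Lie algebroid is a Lie algebroid with a smooth fiberwise scalar product $\langle\,,\rangle$ on $A$. Its Levi-Civita $A$-connection $\mathcal D:\Gamma(A)\times\Gamma(A)\to\Gamma(A)$ is defined by $2\langle\mathcal D_ab,c\rangle=\#(a).\langle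 b,c\rangle+\#(b).\langle a,c\rangle-\#(c).\langle a,b\rangle+\langle[c,a],b\rangle+\langle[c,b],a\rangle+\langle[a,b],c\rangle$; it restricts to $A_L$. An $A$-path is a smooth path $\alpha:[t_0,t_1]\to A$ with $\#(\alpha(t))=\frac{d}{dt}p(\alpha(t))$; $p\circ\alpha$ is its base path. An $\alpha$-section is a smooth $\beta:[t_0,t_1]\to A$ with $p\circ\beta=p\circ\alpha$. Its derivative $\mathcal D^\alpha\beta$ along $\alpha$ is given, in a local frame $(a_i)$ with $\alpha=\sum\alpha^ia_i$, $\beta=\sum\beta^ja_j$, by $\mathcal D^\alpha\beta=\sum_j\frac{d\beta^j}{dt}a_j+\sum_{i,j}\alpha^i\beta^j\mathcal D_{a_i}a_j$. A geodesic is an $A$-path $\alpha$ with $\mathcal D^\alpha\alpha=0$. The geodesics are the integral curves of a vector field $X_E$ on $A$, the geodesic vector field; it is tangent to every $A_L$. ($X_E$ is also the Hamiltonian vector field of $E(a)=\frac12\langle a,a\rangle$ for the Poisson structure on $A$ obtained from that of $A^*$ via the metric.) $A_L=\mathcal G_L\oplus\mathcal G_L^\perp$ (orthogonal decomposition), and $a=a^v+a^h$ denotes the corresponding decomposition into vertical ($\mathcal G_L$) and horizontal ($\mathcal G_L^\perp$) parts. The induced Riemannian metric $\langle\,,\rangle_L$ on $L$ is the one making $\#:\mathcal G_x^\perp\to T_xL$ isometric for all $x\in L$. The tensor $T$ is $T_ab=(\mathcal D_{a^v}b^v)^h+(\mathcal D_{a^v}b^h)^v$ for sections $a,b$ of $A_L$.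 Sasaki metric: define $K:TA_L\to A_L$ as follows. For $a\in A_L$ and $Z\in T_aA_L$, choose $\beta:[0,1]\to A_L$ with $\beta(0)=a$, $\dot\beta(0)=Z$, let $\alpha:[0,1]\to\mathcal G_L^\perp$ be the unique horizontal $A$-path with base path $p\circ\beta$, and put $K(Z)=(\mathcal D^\alpha\beta)(0)$ (this is well defined). The Sasaki metric on the manifold $A_L$ is the Riemannian metric given by $g_L(Z,Z)=\langle dp(Z),dp(Z)\rangle_L+\langle K(Z),K(Z)\rangle$. *)

(* Defs.v *)
From mathcomp Require Import all_boot all_order all_algebra.
From mathcomp Require Import all_classical all_reals all_analysis.

Set Implicit Arguments.
Unset Strict Implicit.
Unset Printing Implicit Defensive.

Import Order.TTheory GRing.Theory Num.Theory numFieldNormedType.Exports.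
Local Open Scope classical_set_scope.
Local Open Scope ring_scope.

(** * Smooth maps between (open subsets of) finite-dimensional spaces *)

(* On a finite-dimensional V, f is C^k on the open set U iff all its iterated
   directional derivatives of order at most k exist and are continuous on U. *)
Fixpoint Ck (R : realType) (k : nat) (V W : normedModType R)
    (U : set V) (f : V -> W) : Prop :=
  (forall x, U x -> {for x, continuous f}) /\
  match k with
  | 0%N => True
  | k'.+1 => forall v : V,
      (forall x, U x -> derivable f x v) /\ Ck k' U (fun x => 'D_v f x)
  end.

Definition smooth_near (R : realType) (V W : normedModType R)
    (f : V -> W) (x : V) : Prop :=
  exists U : set V, [/\ open U, U x & forall k, Ck k U f].

(** * Manifolds *)

(* An atlas on a bare set M, modelled on V.  The topology of M is the one
   induced by the charts (see [mopen]).  The map [ccoord i] is meaningful on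
   [cdom i] only, and [cinv i] on the image of [cdom i] only. *)
Record atlas (R : realType) (V : normedModType R) (M : Type) := Atlas {
  cidx : Type;
  cdom : cidx -> set M;
  ccoord : cidx -> M -> V;
  cinv : cidx -> V -> M }.

Definition flat_atlas (R : realType) (V : normedModType R) : atlas V V :=
  @Atlas R V V unit (fun=> setT) (fun=> id) (fun=> id).

Definition real_line (R : realType) : atlas (R^o : normedModType R) R :=
  flat_atlas (R^o : normedModType R).

Definition smooth_map_at (R : realType) (V W : normedModType R) (M N : Type)
    (MA : atlas V M) (NA : atlas W N) (F : M -> N) (x : M) : Prop :=
  forall (i : cidx MA) (j : cidx NA), cdom i x -> cdom j (F x) ->
    (\forall z \near ccoord i x, cdom j (F (cinv i z))) /\
    smooth_near (fun z => ccoord j (F (cinv i z))) (ccoord i x).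

Definition smooth_fun_at (R : realType) (V : normedModType R) (M : Type)
    (MA : atlas V M) (f : M -> R) (x : M) : Prop :=
  smooth_map_at MA (real_line R) f x.

Definition mopen (R : realType) (V : normedModType R) (M : Type)
    (MA : atlas V M) (O : set M) : Prop :=
  forall i : cidx MA, open (ccoord i @` (O `&` cdom i)).

Definition mconnected (R : realType) (V : normedModType R) (M : Type)
    (MA : atlas V M) : Prop :=
  [set: M] !=set0 /\
  forall O : set M, mopen MA O -> mopen MA (~` O) -> O = set0 \/ O = setT.

(* Second countability is expressed by the existence of a countable cover by
   chart domains, which is equivalent to it for a locally Euclidean space. *)
Record is_manifold (R : realType) (V : normedModType R) (M : Type)
    (MA : atlas V M) : Prop := IsManifold {
  mfd_cover : forall x, exists i : cidx MA, cdom i x;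
  mfd_coordK : forall (i : cidx MA) x, cdom i x -> cinv i (ccoord i x) = x;
  mfd_dom_open : forall i : cidx MA, mopen MA (cdom i);
  mfd_transition : forall (i j : cidx MA) x, cdom i x -> cdom j x ->
    smooth_near (fun z => ccoord j (cinv i z)) (ccoord i x);
  mfd_hausdorff : forall x y, x <> y -> exists O O' : set M,
    [/\ mopen MA O, mopen MA O', O x, O' y & O `&` O' = set0];
  mfd_countable : exists c : nat -> option (cidx MA),
    forall x, exists k i, c k = Some i /\ cdom i x }.

Record manifold (R : realType) (n : nat) := Manifold {
  points :> Type;
  matlas : atlas 'rV[R]_n points;
  mfdP : is_manifold matlas }.

(** * Tangent vectors and vector fields *)

(* A tangent vector at x is the directional derivative along a smooth curve
   through x, acting on the real functions that are smooth around x.  The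
   values of a [tvec] on other functions are junk, so tangent vectors at x
   are compared by [teq x]. *)
Definition tvec (R : realType) (M : Type) := (M -> R) -> R.

Definition teq (R : realType) (V : normedModType R) (M : Type)
    (MA : atlas V M) (x : M) (Y Z : tvec R M) : Prop :=
  forall f, smooth_fun_at MA f x -> Y f = Z f.

Definition velocity (R : realType) (M : Type) (c : R -> M) (t : R)
  : tvec R M := fun f => derive1 (f \o c) t.

Definition is_tangent (R : realType) (V : normedModType R) (M : Type)
    (MA : atlas V M) (x : M) (Z : tvec R M) : Prop :=
  exists c : R -> M,
    [/\ smooth_map_at (real_line R) MA c 0, c 0 = x &
        teq MA x Z (velocity c 0)].

Definition push (R : realType) (M N : Type) (F : M -> N) (Z : tvec R M)
  : tvec R N := fun f => Z (f \o F).

Definition smooth_vfield (R : realType) (V : normedModType R) (M : Type)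
    (MA : atlas V M) (X : M -> tvec R M) : Prop :=
  (forall x, is_tangent MA x (X x)) /\
  forall f x, smooth_fun_at MA f x -> smooth_fun_at MA (fun y => X y f) x.

Definition integral_curve (R : realType) (V : normedModType R) (M : Type)
    (MA : atlas V M) (X : M -> tvec R M) (c : R -> M) (t0 t1 : R) : Prop :=
  forall t, t0 <= t <= t1 ->
    smooth_map_at (real_line R) MA c t /\
    teq MA (c t) (velocity c t) (X (c t)).

Section Divergence.
Variables (R : realType) (n : nat) (M : Type) (MA : atlas 'rV[R]_n M).

Definition partial_vec (i : cidx MA) (k : 'I_n) (x : M) : tvec R M :=
  fun f => 'D_(delta_mx 0 k) (fun z => f (cinv i z)) (ccoord i x).

Variable g : M -> tvec R M -> tvec R M -> R.

Definition riem_density (i : cidx MA) (z : 'rV[R]_n) : R :=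
  let x := cinv i z in
  Num.sqrt (\det (\matrix_(k, l) g x (partial_vec i k x) (partial_vec i l x))).

(* The divergence is the function with L_X mu = div(X) mu for the Riemannian
   density mu = sqrt (det g) |dx|; in the chart i it reads
   (1 / sqrt (det g)) sum_k d_k (sqrt (det g) X^k), with X^k = X(x^k), and the
   value does not depend on the chart. *)
Definition divergence (X : M -> tvec R M) (i : cidx MA) (x : M) : R :=
  (riem_density i (ccoord i x))^-1 *
  \sum_(k < n) 'D_(delta_mx 0 k)
    (fun z => riem_density i z * X (cinv i z) (fun y => ccoord i y 0 k))
    (ccoord i x).

End Divergence.

(** * Vector bundles *)

(* Local trivialisations of a family of vector spaces; on [tdom k], the map
   [tcoord k x] is a linear isomorphism with inverse [tfib k x]. *)
Record trivs (R : realType) (M : Type) (A : M -> lmodType R) (r : nat) :=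
  Trivs {
  tidx : Type;
  tdom : tidx -> set M;
  tcoord : tidx -> forall x, A x -> 'rV[R]_r;
  tfib : tidx -> forall x, 'rV[R]_r -> A x }.

Definition totspace (R : realType) (M : Type) (A : M -> lmodType R) : Type :=
  {x : M & A x}.

Definition bproj (R : realType) (M : Type) (A : M -> lmodType R)
  : totspace A -> M := @projT1 M (fun x => A x).

Definition fib_elt (R : realType) (M : Type) (A : M -> lmodType R)
  (a : totspace A) : A (bproj a) := projT2 a.

Definition elt (R : realType) (M : Type) (A : M -> lmodType R)
  (x : M) (u : A x) : totspace A := existT (fun x => A x) x u.

Definition total_atlas (R : realType) (n r : nat) (M : Type)
    (MA : atlas 'rV[R]_n M) (A : M -> lmodType R) (tA : trivs A r)
  : atlas 'rV[R]_(n + r) (totspace A) :=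
  @Atlas R _ (totspace A) (cidx MA * tidx tA)%type
    (fun ij => [set a | cdom ij.1 (bproj a) /\ tdom ij.2 (bproj a)])
    (fun ij a => row_mx (ccoord ij.1 (bproj a)) (tcoord ij.2 (fib_elt a)))
    (fun ij z => let x := cinv ij.1 (lsubmx z) in
                 elt (tfib ij.2 x (rsubmx z))).

Definition smooth_section (R : realType) (n r : nat) (M : Type)
    (MA : atlas 'rV[R]_n M) (A : M -> lmodType R) (tA : trivs A r)
    (s : forall x, A x) : Prop :=
  forall x, smooth_map_at MA (total_atlas MA tA) (fun y => elt (s y)) x.

Definition pull_trivs (R : realType) (M L : Type) (A : M -> lmodType R)
    (r : nat) (tA : trivs A r) (iota : L -> M)
  : trivs (fun y => A (iota y)) r :=
  @Trivs R L (fun y => A (iota y)) r (tidx tA)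
    (fun k => iota @^-1` (tdom k))
    (fun k y => @tcoord _ _ _ _ tA k (iota y))
    (fun k y => @tfib _ _ _ _ tA k (iota y)).

Record is_bundle (R : realType) (n r : nat) (M : Type)
    (MA : atlas 'rV[R]_n M) (A : M -> lmodType R) (tA : trivs A r) : Prop :=
  IsBundle {
  bdl_cover : forall x, exists k : tidx tA, tdom k x;
  bdl_open : forall k : tidx tA, mopen MA (tdom k);
  bdl_lin : forall (k : tidx tA) x, tdom k x ->
    forall (c : R) (u v : A x),
      tcoord k (c *: u + v) = c *: tcoord k u + tcoord k v;
  bdl_coordK : forall (k : tidx tA) x, tdom k x ->
    forall u : A x, tfib k x (tcoord k u) = u;
  bdl_fibK : forall (k : tidx tA) x, tdom k x ->
    forall w, tcoord k (tfib k x w) = w;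
  bdl_transition : forall (k k' : tidx tA) x, tdom k x -> tdom k' x ->
    forall w, smooth_map_at MA (flat_atlas 'rV[R]_r)
      (fun y => tcoord k' (tfib k y w)) x }.

Record vbundle (R : realType) (n : nat) (M : manifold R n) (r : nat) :=
  VBundle {
  fibre :> M -> lmodType R;
  btrivs : trivs fibre r;
  bundleP : is_bundle (matlas M) btrivs }.

(** * Linear algebra *)

Definition is_basis (R : realType) (V : lmodType R) (G : set V) (s : nat)
    (b : 'I_s -> V) : Prop :=
  [/\ forall i, G (b i),
      forall v, G v -> exists p : 'I_s -> R, v = \sum_i p i *: b i &
      forall p : 'I_s -> R, \sum_i p i *: b i = 0 -> forall i, p i = 0].

Definition trace_on (R : realType) (V : lmodType R) (G : set V) (f : V -> V)
  : R :=
  xget 0 [set tau : R | exists (s : nat) (b : 'I_s -> V) (m : 'M[R]_s),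
    [/\ is_basis G b, forall j, f (b j) = \sum_i m i j *: b i &
        tau = \tr m]].

(** * Riemannian Lie algebroids *)

Section Algebroid.
Variables (R : realType) (n r : nat) (M : manifold R n) (A : vbundle M r).

Notation sect := (forall x : M, A x).
Notation smooth_sect := (smooth_section (matlas M) (btrivs A)).
Notation totA := (total_atlas (matlas M) (btrivs A)).

(* The bracket is only meaningful on smooth sections. *)
Record lie_algebroid := LieAlgebroid {
  anchor : forall x : M, A x -> tvec R M;
  bracket : sect -> sect -> sect;
  anchor_tangent : forall x (u : A x), is_tangent (matlas M) x (anchor u);
  anchor_linear : forall x (k : R) (u v : A x),
    teq (matlas M) x (anchor (k *: u + v))
      (fun f => k * anchor u f + anchor v f);
  anchor_smooth : forall a : sect, smooth_sect a ->
    smooth_vfield (matlas M) (fun x => anchor (a x));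
  bracket_smooth : forall a b : sect, smooth_sect a -> smooth_sect b ->
    smooth_sect (bracket a b);
  bracket_linear : forall (k : R) (a b c : sect),
    smooth_sect a -> smooth_sect b -> smooth_sect c ->
    forall x, bracket (fun y => k *: a y + b y) c x =
              k *: bracket a c x + bracket b c x;
  bracket_anti : forall a b : sect, smooth_sect a -> smooth_sect b ->
    forall x, bracket a b x = - bracket b a x;
  bracket_jacobi : forall a b c : sect,
    smooth_sect a -> smooth_sect b -> smooth_sect c ->
    forall x, bracket a (bracket b c) x + bracket b (bracket c a) x +
              bracket c (bracket a b) x = 0;
  anchor_bracket : forall a b : sect, smooth_sect a -> smooth_sect b ->
    forall x, teq (matlas M) x (anchor (bracket a b x))
      (fun f => anchor (a x) (fun y => anchor (b y) f) -
                anchor (b x) (fun y => anchor (a y) f));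
  bracket_leibniz : forall (f : M -> R) (a b : sect),
    (forall x, smooth_fun_at (matlas M) f x) ->
    smooth_sect a -> smooth_sect b ->
    forall x, bracket a (fun y => f y *: b y) x =
              f x *: bracket a b x + anchor (a x) f *: b x }.

Record riem_metric := RiemMetric {
  sp :> forall x : M, A x -> A x -> R;
  sp_sym : forall x (u v : A x), sp u v = sp v u;
  sp_linear : forall x (k : R) (u v w : A x),
    sp (k *: u + v) w = k * sp u w + sp v w;
  sp_pos : forall x (u : A x), u != 0 -> 0 < sp u u;
  sp_smooth : forall a b : sect, smooth_sect a -> smooth_sect b ->
    forall x, smooth_fun_at (matlas M) (fun y => sp (a y) (b y)) x }.

Variables (LA : lie_algebroid) (g : riem_metric).

Definition is_levi_civita (D : sect -> sect -> sect) : Prop :=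
  (forall a b, smooth_sect a -> smooth_sect b -> smooth_sect (D a b)) /\
  forall a b c : sect, smooth_sect a -> smooth_sect b -> smooth_sect c ->
  forall x : M,
    2 * g x (D a b x) (c x) =
      anchor LA (a x) (fun y => g y (b y) (c y))
    + anchor LA (b x) (fun y => g y (a y) (c y))
    - anchor LA (c x) (fun y => g y (a y) (b y))
    + g x (bracket LA c a x) (b x) + g x (bracket LA c b x) (a x)
    + g x (bracket LA a b x) (c x).

Definition isotropy (x : M) : set (A x) :=
  [set u | teq (matlas M) x (anchor LA u) (fun=> 0)].

Definition isotropy_bracket (x : M) (u v : A x) : A x :=
  xget 0 [set w | exists a b : sect,
    [/\ smooth_sect a, smooth_sect b, a x = u, b x = v &
        w = bracket LA a b x]].

Definition horizontal (x : M) (u : A x) : Prop :=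
  forall w, isotropy w -> g x u w = 0.

Definition vpart (x : M) (u : A x) : A x :=
  xget 0 [set v | isotropy v /\ horizontal (u - v)].

Definition hpart (x : M) (u : A x) : A x := u - vpart u.

(* Local frames around x.  Any frame defined near x coincides, on a smaller
   neighbourhood, with global smooth sections, so that D can be applied. *)
Definition local_frame (e : 'I_r -> sect) (x : M) : Prop :=
  (forall i, smooth_sect (e i)) /\
  exists O : set M, [/\ mopen (matlas M) O, O x &
    forall y, O y -> is_basis [set: A y] (fun i => e i y)].

(* Paths t |-> alpha(t) in A are given by their base path c together with
   alpha(t) in the fibre at c(t).  A smooth path on [t0, t1] is extended to
   the real line, and smooth around each point of [t0, t1]. *)
Definition curve_in (N : Type) (B : N -> lmodType R) (c : R -> N)
  (alpha : forall t, B (c t)) : R -> totspace B := fun t => elt (alpha t).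

Definition is_apath (c : R -> M) (alpha : forall t, A (c t)) (t0 t1 : R)
  : Prop :=
  forall t, t0 <= t <= t1 ->
    smooth_map_at (real_line R) totA (curve_in alpha) t /\
    teq (matlas M) (c t) (anchor LA (alpha t)) (velocity c t).

Variable D : sect -> sect -> sect.

(* [dalong alpha beta t v] : v is the derivative at t of beta along alpha. *)
Definition dalong (c : R -> M) (alpha beta : forall t, A (c t)) (t : R)
    (v : A (c t)) : Prop :=
  exists (e : 'I_r -> sect) (p : 'I_r -> R) (q : 'I_r -> R -> R),
    [/\ local_frame e (c t),
        alpha t = \sum_i p i *: e i (c t),
        \forall s \near t, beta s = \sum_j q j s *: e j (c s) &
        v = \sum_j derive1 (q j) t *: e j (c t) +
            \sum_i \sum_j (p i * q j t) *: D (e i) (e j) (c t)].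

Definition is_geodesic (c : R -> M) (alpha : forall t, A (c t)) (t0 t1 : R)
  : Prop :=
  is_apath alpha t0 t1 /\
  forall t, t0 <= t <= t1 -> @dalong c alpha alpha t 0.

Definition is_geodesic_field (X : totspace A -> tvec R (totspace A)) : Prop :=
  smooth_vfield totA X /\
  forall (c : R -> M) (alpha : forall t, A (c t)) (t0 t1 : R), t0 < t1 ->
    is_geodesic alpha t0 t1 <-> integral_curve totA X (curve_in alpha) t0 t1.

(** * Leaves *)

(* Injectively immersed submanifold whose tangent spaces are the images of
   the anchor. *)
Record integral_manifold (l : nat) (L : manifold R l) (iota : L -> M)
  : Prop := IntegralManifold {
  im_smooth : forall y, smooth_map_at (matlas L) (matlas M) iota y;
  im_inj : injective iota;
  im_immersion : forall y (Z : tvec R L), is_tangent (matlas L) y Z ->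
    teq (matlas M) (iota y) (push iota Z) (fun=> 0) ->
    teq (matlas L) y Z (fun=> 0);
  im_sub : forall y (Z : tvec R L), is_tangent (matlas L) y Z ->
    exists u : A (iota y), teq (matlas M) (iota y) (push iota Z) (anchor LA u);
  im_sup : forall y (u : A (iota y)), exists Z : tvec R L,
    is_tangent (matlas L) y Z /\
    teq (matlas M) (iota y) (push iota Z) (anchor LA u) }.

(* The leaves are the maximal connected integral manifolds. *)
Record is_leaf (l : nat) (L : manifold R l) (iota : L -> M) : Prop :=
  IsLeaf {
  leaf_integral : integral_manifold iota;
  leaf_connected : mconnected (matlas L);
  leaf_max : forall (l' : nat) (L' : manifold R l') (iota' : L' -> M),
    integral_manifold iota' -> mconnected (matlas L') ->
    range iota' `&` range iota !=set0 -> range iota' `<=` range iota }.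

Section Leaf.
Variables (l : nat) (L : manifold R l) (iota : L -> M).

Definition restr_fib : L -> lmodType R := fun y => A (iota y).

Definition restr_trivs : trivs restr_fib r := pull_trivs (btrivs A) iota.

Definition restr_atlas : atlas 'rV[R]_(l + r) (totspace restr_fib) :=
  total_atlas (matlas L) restr_trivs.

Definition restr_incl (a : totspace restr_fib) : totspace A :=
  @elt R M A _ (fib_elt a).

(* XL is the restriction to A_L of the vector field X on A. *)
Definition restricts_to (X : totspace A -> tvec R (totspace A))
    (XL : totspace restr_fib -> tvec R (totspace restr_fib)) : Prop :=
  smooth_vfield restr_atlas XL /\
  forall a, teq totA (restr_incl a) (push restr_incl (XL a))
              (X (restr_incl a)).

Definition leaf_metric (y : L) (Y Z : tvec R L) : R :=
  xget 0 [set rho : R | exists u w : A (iota y),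
    [/\ horizontal u, horizontal w,
        teq (matlas M) (iota y) (push iota Y) (anchor LA u),
        teq (matlas M) (iota y) (push iota Z) (anchor LA w) &
        rho = g _ u w]].

(* The map K : T A_L -> A_L; it maps tangent vectors at a into the fibre
   through a. *)
Definition sasaki_K (a : totspace restr_fib) (Z : tvec R (totspace restr_fib))
  : restr_fib (bproj a) :=
  xget 0 [set k | exists (c : R -> L) (beta alpha : forall t, restr_fib (c t))
      (k0 : restr_fib (c 0)),
    [/\ forall t, 0 <= t <= 1 ->
          smooth_map_at (real_line R) restr_atlas (curve_in beta) t,
        curve_in beta 0 = a /\ teq restr_atlas a Z (velocity (curve_in beta) 0),
        @is_apath (iota \o c) alpha 0 1 /\
          (forall t, 0 <= t <= 1 -> horizontal (alpha t)),
        @dalong (iota \o c) alpha beta 0 k0 &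
        elt k0 = elt k]].

(* The bilinear form polarising
   g_L(Z, Z) = <dp Z, dp Z>_L + <K Z, K Z>. *)
Definition sasaki (a : totspace restr_fib)
    (Y Z : tvec R (totspace restr_fib)) : R :=
  leaf_metric (bproj a) (push (@bproj _ _ _) Y) (push (@bproj _ _ _) Z) +
  g _ (sasaki_K a Y) (sasaki_K a Z).

(* [drestr u b v] : v = (D_u b)(y), for u in A_L over y and b a section of
   A_L, where D is restricted to A_L; the first term of the frame formula is
   the derivative of the coefficients of b by #(u), seen in T_y L. *)
Definition drestr (y : L) (u : restr_fib y) (b : forall z, restr_fib z)
    (v : restr_fib y) : Prop :=
  exists (e : 'I_r -> sect) (p : 'I_r -> R) (q : 'I_r -> L -> R)
      (Z : tvec R L),
    [/\ local_frame e (iota y),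
        u = \sum_i p i *: e i (iota y),
        (forall j, smooth_fun_at (matlas L) (q j) y) /\
          (exists O : set L, [/\ mopen (matlas L) O, O y & forall z, O z ->
             b z = \sum_j q j z *: e j (iota z)]),
        is_tangent (matlas L) y Z /\
          teq (matlas M) (iota y) (push iota Z) (anchor LA u) &
        v = \sum_j Z (q j) *: e j (iota y) +
            \sum_i \sum_j (p i * q j y) *: D (e i) (e j) (iota y)].

(* The value at y of T_a b depends on a(y) = u and b(y) = w only. *)
Definition tensorT (y : L) (u w : restr_fib y) : restr_fib y :=
  xget 0 [set v | exists (b : forall z, restr_fib z) (v1 v2 : restr_fib y),
    [/\ smooth_section (matlas L) restr_trivs b, b y = w,
        drestr (vpart u) (fun z => vpart (b z)) v1,
        drestr (vpart u) (fun z => hpart (b z)) v2 &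
        v = hpart v1 + vpart v2]].

End Leaf.
End Algebroid.

Arguments isotropy {R n r M A} LA x.

(* Main.v *)
Require Import Defs.
From mathcomp Require Import all_boot all_order all_algebra.
From mathcomp Require Import all_classical all_reals all_analysis.
From mathcomp Require Import ring lra.
Set Implicit Arguments.
Unset Strict Implicit.
Unset Printing Implicit Defensive.
Import Order.TTheory GRing.Theory Num.Theory numFieldNormedType.Exports.
Local Open Scope classical_set_scope.
Local Open Scope ring_scope.

(* Idea.  Fix a chart x of the leaf and linear fibre coordinates w on A_L, and
   let P be the matrix of the anchor and G the Gram matrix of the frame.  A
   fibre-direction partial derivative has K = the frame vector, whatever the
   connection, so the Sasaki volume density is sqrt (det G / det (P^T G^-1 P)),
   and the coordinates of X_E are w P along the leaf and, along the fibre, a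
   quadratic form in w given by the Koszul formula.  Jacobi's formula for the
   density and the fact that the anchor respects brackets turn the divergence
   into - sum_j q_a(b_j, b_j), where (b_j) is an orthonormal basis of the
   isotropy algebra and q_a(b, b) is half the Lie derivative of the metric
   along a, evaluated on the vertical vector b.  This expression is additive in
   a: the part a^v contributes <[a^v, b_j], b_j>, hence the trace, and by the
   Koszul formula the part a^h contributes <a^h, T_{b_j} b_j>.
   That X_E has the stated coordinates uses the existence of an integral curve
   through each point (Picard iteration), since X_E is characterised by its
   integral curves only. *)

(** * Differential calculus on finite-dimensional spaces *)

(** The definitions dictate much of the shape. A [tvec] is unconstrained off the functions smooth at
    its point, and the bracket and [D] are constrained on global smooth sections only; so local data
    are extended by cut-off functions, whose smoothness away from the chart rests on the Hausdorff
    axiom and on the compactness of a coordinate box. Smoothness is phrased with directional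
    derivatives, so the chain rule and linearity in the direction have to be derived. [sasaki_K],
    [tensorT], [vpart], [leaf_metric] and the trace are selected by [xget]: each demands a witness,
    and as much independence of the witness as the formula uses. For K this is its value on fibre
    directions: the projection to the leaf kills them, so the other values of K fill an off-diagonal
    block and leave the determinant unchanged. For T it is the product of T_b b with a horizontal
    vector, b being vertical. The half Lie derivative is a good intermediate quantity because, on a
    vertical vector, it depends on the values of its arguments at the point alone. *)

Section DirectionalDerivatives.
Variable R : realType.
Implicit Types V W : normedModType R.

Lemma open_near (T : topologicalType) (U : set T) x :
  open U -> U x -> \forall y \near x, U y.
Proof. by move=> oU Ux; apply: open_nbhs_nbhs. Qed.

Lemma near0_lt (d : R) : 0 < d -> \forall h \near (0 : R), `|h| < d.
Proof.
move=> d0; apply/nbhs_normP; exists d => // h.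
by rewrite /= sub0r normrN.
Qed.

Lemma is_derive_line V W (f : V -> W) (p v : V) (s : R) :
  derivable f (s *: v + p) v ->
  is_derive s 1 (fun s : R => f (s *: v + p)) ('D_v f (s *: v + p)).
Proof.
have E : (fun h : R => h^-1 *: (((fun s => f (s *: v + p)) \o shift s) (h *: (1 : R)) - f (s *: v + p)))
    = (fun h : R => h^-1 *: ((f \o shift (s *: v + p)) (h *: v) - f (s *: v + p))).
  by apply/funext => h /=; rewrite [h *: 1]mulr1 scalerDl addrA.
move=> df; split; first by rewrite /derivable E.
by rewrite /derive E.
Qed.

(** A directional derivative only sees the restriction to a line, so functions on different spaces
    can be compared. This turns partial derivatives on the total space into derivatives on the leaf
    or on a fibre. *)
Lemma derive_line V V' W (f : V -> W) (g : V' -> W) x v y u :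
  (\forall t \near (0 : R), f (t *: v + x) = g (t *: u + y)) ->
  'D_v f x = 'D_u g y.
Proof.
move=> fg; rewrite /derive; congr (lim _).
have fg0 : f x = g y by have := nbhs_singleton fg; rewrite !scale0r !add0r.
have E : \forall h \near 0^', h^-1 *: ((f \o shift x) (h *: v) - f x) =
    h^-1 *: ((g \o shift y) (h *: u) - g y).
  by apply: nbhs_dnbhs; apply: filterS fg => h /= ->; rewrite fg0.
apply/seteqP; split; apply: near_eq_cvg => //.
by apply: filterS E => h ->.
Qed.

Lemma MVT_line V (f : V -> R) (p v : V) (c : R) :
  (forall s : R, `|s| <= `|c| -> derivable f (s *: v + p) v) ->
  exists2 s : R, `|s| <= `|c| & f (c *: v + p) - f p = c * 'D_v f (s *: v + p).
Proof.
move=> df; pose phi (s : R) := f (s *: v + p).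
have dphi (s : R) : `|s| <= `|c| -> is_derive s 1 phi ('D_v f (s *: v + p)).
  by move=> sc; apply: is_derive_line; apply: df.
have cphi a b : (forall s : R, s \in `[a, b] -> `|s| <= `|c|) ->
    {within `[a, b], continuous phi}.
  move=> ab; apply: derivable_within_continuous => s /ab sc.
  by have [] := dphi s sc.
have phi0 : phi 0 = f p by rewrite /phi scale0r add0r.
have [c0|c0] := leP 0 c.
  have sub (s : R) : s \in `[0, c] -> `|s| <= `|c|.
    by rewrite in_itv /= => /andP[s0 sc]; rewrite !ger0_norm.
  have [] := @MVT_segment R phi (fun s => 'D_v f (s *: v + p)) 0 c c0 _ (cphi _ _ sub).
    by move=> s sc; apply/dphi/sub; apply: subset_itv_oo_cc.
  move=> s /sub sc; rewrite phi0 subr0 mulrC => E; exists s => //.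
have sub (s : R) : s \in `[c, 0] -> `|s| <= `|c|.
  by rewrite in_itv /= => /andP[s0 sc]; rewrite !ler0_norm ?lerN2 // ltW.
have [] := @MVT_segment R phi (fun s => 'D_v f (s *: v + p)) c 0 (ltW c0) _ (cphi _ _ sub).
  by move=> s sc; apply/dphi/sub; apply: subset_itv_oo_cc.
move=> s /sub sc; rewrite phi0 sub0r => E; exists s => //.
by rewrite -opprB E mulrN mulrC opprK.
Qed.

End DirectionalDerivatives.

(** * Algebra of functions of class C^k *)

Section CkAlgebra.
Variable R : realType.
Implicit Types V W : normedModType R.

Lemma CkW k V W (U : set V) (f : V -> W) : Ck k.+1 U f -> Ck k U f.
Proof.
elim: k f => [|k IH] f [fc H]; split=> //.
by move=> v; have [dv Cv] := H v; split=> //; exact: IH.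
Qed.

Lemma Ck_sub k V W (U U' : set V) (f : V -> W) :
  U' `<=` U -> Ck k U f -> Ck k U' f.
Proof.
move=> s; elim: k f => [|k IH] f [fc H]; split=> //; try by move=> x /s /fc.
by move=> v; have [dv Cv] := H v; split; [move=> x /s /dv | exact: IH].
Qed.

Lemma Ck_congr k V W (U : set V) (f g : V -> W) :
  open U -> (forall x, U x -> f x = g x) -> Ck k U f -> Ck k U g.
Proof.
move=> oU; elim: k f g => [|k IH] f g fg [fc H].
- split=> // x Ux; have fcx := fc x Ux; rewrite /prop_for /continuous_at in fcx *.
  rewrite -(fg x Ux); apply: cvg_trans fcx; apply: near_eq_cvg.
  by have := open_near oU Ux; apply: filterS => y /fg.
- have nfg x : U x -> {near x, f =1 g}.
    by move=> Ux; have := open_near oU Ux; apply: filterS => y /fg.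
  split=> [x Ux|v].
    have fcx := fc x Ux; rewrite /prop_for /continuous_at in fcx *.
    rewrite -(fg x Ux); apply: cvg_trans fcx; exact/near_eq_cvg/nfg.
  have [dv Cv] := H v; split=> [x Ux|].
    by apply: near_eq_derivable (nfg x Ux) (dv x Ux).
  apply: IH Cv => x Ux; exact/near_eq_derive/nfg.
Qed.

Lemma Ck_cst k V W (U : set V) (w : W) : Ck k U (fun _ : V => w).
Proof.
elim: k w => [|k IH] w; split=> //; try by move=> x _; exact: cvg_cst.
move=> v; split; first by move=> x _; apply: derivable_cst.
by under eq_fun do rewrite derive_cst; exact: IH.
Qed.

Lemma CkD k V W (U : set V) (f g : V -> W) : open U ->
  Ck k U f -> Ck k U g -> Ck k U (fun x => f x + g x).
Proof.
move=> oU; elim: k f g => [|k IH] f g [fc fd] [gc gd]; split=> //;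
  try by move=> x Ux; apply: continuousD; [exact: fc | exact: gc].
move=> v; have [fdv fk] := fd v; have [gdv gk] := gd v; split=> [x Ux|].
  by apply: derivableD; [exact: fdv | exact: gdv].
apply: Ck_congr (IH _ _ fk gk) => // x Ux.
by rewrite [RHS]deriveD //; [exact: fdv | exact: gdv].
Qed.

Lemma CkM k V (U : set V) (f g : V -> R) : open U ->
  Ck k U f -> Ck k U g -> Ck k U (fun x => f x * g x).
Proof.
move=> oU; elim: k f g => [|k IH] f g Cf Cg; have [fc fd] := Cf; have [gc gd] := Cg;
  split=> //; try by move=> x Ux; apply: continuousM; [exact: fc | exact: gc].
move=> v; have [fdv fk] := fd v; have [gdv gk] := gd v; split=> [x Ux|].
  by apply: derivableM; [exact: fdv | exact: gdv].
apply: (@Ck_congr _ _ _ _ (fun x => f x * 'D_v g x + g x * 'D_v f x)) => //.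
  move=> x Ux; rewrite [RHS]deriveM //; [exact: fdv | exact: gdv].
by apply: CkD => //; apply: IH => //; exact: CkW.
Qed.

Lemma CkV k V (U : set V) (f : V -> R) : open U -> (forall x, U x -> f x != 0) ->
  Ck k U f -> Ck k U (fun x => (f x)^-1).
Proof.
move=> oU f0; elim: k f f0 => [|k IH] f f0 Cf; have [fc fd] := Cf;
  split=> //; try by move=> x Ux; apply: continuousV; [exact: f0 | exact: fc].
move=> v; have [fdv fk] := fd v; split=> [x Ux|].
  by apply: derivableV; [exact: f0 | exact: fdv].
apply: (@Ck_congr _ _ _ _ (fun x => (-1) * ('D_v f x * ((f x)^-1 * (f x)^-1)))) => //.
  move=> x Ux; rewrite [RHS]deriveV //; [|exact: f0|exact: fdv].
  by rewrite /GRing.scale /= expr2 invfM mulN1r mulNr [in RHS]mulrC.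
apply: CkM => //; first exact: Ck_cst.
apply: CkM => //; apply: CkM => //; apply: IH => //; exact: CkW.
Qed.

Lemma Ck_linear_comp k V W W' (U : set V) (L : W -> W') (g : V -> W) :
  open U -> linear L -> continuous L -> Ck k U g -> Ck k U (L \o g).
Proof.
move=> oU lL cL; elim: k g => [|k IH] g [gc gd]; split=> //;
  try by move=> x Ux; apply: continuous_comp; [exact: gc | exact: cL].
have L0 : L 0 = 0.
  have := lL 1 0 0; rewrite !scale1r addr0 => E.
  by apply: (@addrI _ (L 0)); rewrite -E addr0.
have LZ a u : L (a *: u) = a *: L u by have := lL a u 0; rewrite !addr0 L0 addr0.
have LB u w : L (u - w) = L u - L w.
  by have := lL (-1) w u; rewrite !scaleN1r ![- _ + _]addrC.
move=> v; have [gdv gk] := gd v.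
have dL x : U x -> is_derive x v (L \o g) (L ('D_v g x)).
  move=> Ux.
  have H : (fun h : R => h^-1 *: (((L \o g) \o shift x) (h *: v) - (L \o g) x)) @ 0^' --> L ('D_v g x).
    under eq_fun do rewrite /= -LB -LZ.
    apply: (@cvg_comp _ _ _ _ L); first exact: (gdv x Ux).
    exact: cL.
  by split; [apply/cvg_ex; eexists; exact: H | exact/cvg_lim].
split=> [x Ux|]; first by have [] := dL x Ux.
apply: Ck_congr (IH _ gk) => // x Ux.
by have [_ ->] := dL x Ux.
Qed.

End CkAlgebra.

(** * First-order expansion and the chain rule in finite dimension *)

Section FiniteCoordinates.
Variable R : realType.
Implicit Types V W : normedModType R.

(* A finite spanning family with a linear choice of coefficients bounded by the
   norm; it exists both on row vectors and on R itself. *)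
Definition spanning V (m : nat) (e : nat -> V) (c : nat -> V -> R) : Prop :=
  [/\ forall k a u v, c k (a *: u + v) = a * c k u + c k v,
      forall k v, `|c k v| <= `|v| &
      forall v, v = \sum_(k < m) c k v *: e k].

Definition fdim V : Prop := exists m e c, @spanning V m e c.

Lemma fdim_real : fdim (R : normedModType R).
Proof.
exists 1%N, (fun=> 1), (fun=> id); split=> // v.
by rewrite big_ord1 [_ *: _]mulr1.
Qed.

Lemma mx_entry_le m n (v : 'M[R]_(m, n)) i j : `|v i j| <= `|v|.
Proof.
rewrite [leRHS]/Num.Def.normr/= mx_normrE.
exact: (le_bigmax _ (fun ij : 'I_m * 'I_n => `|v ij.1 ij.2|) (i, j)).
Qed.

Definition rV_coef n (k : nat) (v : 'rV[R]_n) : R :=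
  if insub k is Some i then v 0 i else 0.

Lemma rV_coefE n (v : 'rV[R]_n) (i : 'I_n) : rV_coef i v = v 0 i.
Proof. by rewrite /rV_coef valK. Qed.

Lemma spanning_rV n :
  spanning n (fun k => \row_j ((j == k :> nat)%:R : R)) (@rV_coef n).
Proof.
split=> [k a u v|k v|v].
- by rewrite /rV_coef; case: insubP => [i _ _|_]; rewrite ?mxE // mulr0 addr0.
- by rewrite /rV_coef; case: insubP => [i _ _|_]; rewrite ?mx_entry_le // normr0.
- apply/rowP => j; rewrite summxE (bigD1 j) //= !mxE eqxx mulr1 rV_coefE.
  rewrite big1 ?addr0 // => i ij; rewrite !mxE.
  by rewrite (_ : (j == i :> nat) = false) ?mulr0 // eq_sym; apply/negbTE.
Qed.

Lemma fdim_rV n : fdim ('rV[R]_n : normedModType R).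
Proof. by do 3 eexists; exact: spanning_rV. Qed.

Lemma delta_rowE n (i : 'I_n) :
  \row_j ((j == i :> nat)%:R : R) = delta_mx 0 i.
Proof. by apply/rowP => j; rewrite !mxE eqxx. Qed.

Section Expansion.
Variables (V : normedModType R) (m : nat) (e : nat -> V) (c : nat -> V -> R).
Hypothesis sp : spanning m e c.

Lemma spanning_ballW (x : V) (U : set V) : open U -> U x ->
  exists2 d : R, 0 < d & forall y, `|y - x| < d -> U y.
Proof.
move=> oU Ux; have /nbhs_normP[d /= d0 dU] := open_near oU Ux.
by exists d => // y yx; apply: dU; rewrite /= distrC.
Qed.

(** Continuous partial derivatives give a total derivative: the increment is a broken line along the
    [e k], each piece is treated by the mean value theorem, and the induction on the number of
    pieces spends half of [eps] on the last one. *)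
Lemma C1_expand (U : set V) (f : V -> R) x : open U -> U x -> Ck 1 U f ->
  forall eps, 0 < eps -> \forall h \near 0,
  `|f (h + x) - f x - \sum_(k < m) c k h * 'D_(e k) f x| <= eps * `|h|.
Proof.
have [clin cbnd csum] := sp.
move=> oU Ux [fc fd].
suff H j : (j <= m)%N -> forall eps, 0 < eps -> \forall h \near 0,
    `|f (\sum_(k < j) c k h *: e k + x) - f x -
      \sum_(k < j) c k h * 'D_(e k) f x| <= eps * `|h|.
  move=> eps eps0; apply: filterS (H m (leqnn _) eps eps0) => h.
  by rewrite -csum.
elim: j => [|j IH] jm eps eps0.
  apply: nearW => h; rewrite !big_ord0 add0r subrr subr0 normr0.
  by rewrite mulr_ge0 // ltW.
have [d1 d10 d1U] := spanning_ballW oU Ux.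
have [dje [djc _]] := fd (e j).
have /cvgrPdist_le /(_ (eps / 2)) := djc x Ux.
rewrite divr_gt0 // => /(_ isT) /nbhs_normP[d2 /= d20 d2e].
(* The broken line up to its piece [j] stays within [|h| * B] of [x], since the coefficients of [h]
   are bounded by its norm. *)
have B0 : 0 < \sum_(k < j.+1) `|e k| + 1 by rewrite ltr_pwDr // sumr_ge0.
set B := \sum_(k < j.+1) `|e k| + 1 in B0.
have near0 (d : R) : 0 < d -> \forall h \near (0 : V), `|h| * B < d.
  move=> d0; apply/nbhs_normP; exists (d / B); first by rewrite /= divr_gt0.
  by move=> h /=; rewrite sub0r normrN ltr_pdivlMr.
have eps2 : 0 < eps / 2 by rewrite divr_gt0.
near=> h.
have h1 : `|h| * B < d1 by near: h; exact: near0.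
have h2 : `|h| * B < d2 by near: h; exact: near0.
have IHh : `|f (\sum_(k < j) c k h *: e k + x) - f x -
      \sum_(k < j) c k h * 'D_(e k) f x| <= eps / 2 * `|h|.
  by near: h; apply: IH => //; exact: ltnW.
have dist (s : R) : `|s| <= `|c j h| ->
    `|s *: e j + (\sum_(k < j) c k h *: e k + x) - x| <= `|h| * B.
  move=> sc; rewrite addrA addrK addrC.
  rewrite (le_trans (ler_normD _ _)) // mulrDr mulr1.
  rewrite big_ord_recr /= mulrDr -addrA.
  apply: lerD.
    rewrite (le_trans (ler_norm_sum _ _ _)) // mulr_sumr ler_sum // => k _.
    by rewrite normrZ ler_wpM2r.
  rewrite ler_wpDr // normrZ ler_wpM2r // (le_trans sc) //.
have [] := @MVT_line R V f (\sum_(k < j) c k h *: e k + x) (e j) (c j h).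
  by move=> s /dist sh; apply: dje; apply: d1U; apply: le_lt_trans h1.
move=> s sc E.
rewrite !big_ord_recr /= [\sum_(k < j) _ *: _ + _]addrC -[(_ *: _ + _) + x]addrA.
set S := \sum_(k < j) c k h *: e k + x in E IHh dist *.
rewrite (_ : _ - _ = (f S - f x - \sum_(k < j) c k h * 'D_(e k) f x) +
   c j h * ('D_(e j) f (s *: e j + S) - 'D_(e j) f x)); last first.
  by rewrite mulrBr -E; ring.
rewrite [eps]splitr mulrDl (le_trans (ler_normD _ _)) // lerD //.
rewrite normrM mulrC ler_pM // -[leLHS]normrN opprB.
by apply: d2e; rewrite /= distrC; apply: le_lt_trans h2; exact: dist.
Unshelve. all: by end_near. Qed.

End Expansion.

(** The inner function has a derivative in the single direction [v] only: its difference quotients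
    [q] converge, and the expansion of [f] is applied to the increments t q(t). *)
Lemma is_derive_comp V W m e c (U : set W) (f : W -> R) (g : V -> W) x v :
  spanning m e c -> open U -> U (g x) -> Ck 1 U f -> derivable g x v ->
  is_derive x v (fun y => f (g y))
    (\sum_(k < m) c k ('D_v g x) * 'D_(e k) f (g x)).
Proof.
move=> sp oU Ux Cf dg; have [clin cbnd csum] := sp.
pose lin h := \sum_(k < m) c k h * 'D_(e k) f (g x).
pose q (t : R) := t^-1 *: (g (t *: v + x) - g x).
have qc : q @ 0^' --> 'D_v g x by exact: dg.
have cK k : continuous (c k).
  move=> y; apply/cvgrPdist_le => eps eps0; near=> z.
  have -> : c k y - c k z = c k (y - z).
    by have := clin k (-1) z y; rewrite scaleN1r mulN1r ![- _ + _]addrC.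
  apply: le_trans (cbnd _ _) _; near: z.
  exact: (cvgrPdist_le _ _).1 _ eps eps0.
have linc : lin (q t) @[t --> 0^'] --> lin ('D_v g x).
  apply: (@cvg_big _ _ +%R) => [|k _].
  - exact: add_continuous.
  - by apply: cvgMl; apply: cvg_comp qc _; exact: cK.
have linZ t h : lin (t *: h) = t * lin h.
  rewrite /lin mulr_sumr; apply: eq_bigr => k _.
  have := clin k t h 0; have := clin k 1 0 0.
  rewrite scale1r mul1r !addr0 => /esym/eqP; rewrite -subr_eq0 addrK => /eqP ->.
  by rewrite !addr0 mulrA => ->.
have H : t^-1 *: (f (g (t *: v + x)) - f (g x)) @[t --> 0^'] --> lin ('D_v g x).
  (* The linear part already has the right limit, so it remains to show that the remainder
     vanishes. *)
  suff H0 : t^-1 *: (f (g (t *: v + x)) - f (g x)) - lin (q t) @[t --> 0^'] --> (0 : R).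
    have -> : (fun t : R => t^-1 *: (f (g (t *: v + x)) - f (g x))) =
      (fun t => t^-1 *: (f (g (t *: v + x)) - f (g x)) - lin (q t)) \+ (fun t => lin (q t)).
      by apply/funext => t /=; rewrite subrK.
    rewrite -[X in _ --> X]add0r; exact: cvgD H0 linc.
  apply/cvgrPdist_le => eps eps0.
  (* A bound for the difference quotients near 0; the added 1 makes it strict and keeps [K] positive
     when the derivative vanishes. *)
  pose K := `|'D_v g x| + 1.
  have K0 : 0 < K by rewrite ltr_wpDl.
  have gnear : g (t *: v + x) - g x @[t --> (0 : R)^'] --> (0 : W).
    have : (fun t : R => t *: q t) @ 0^' --> (0 : R) *: 'D_v g x.
      apply: cvgZ qc; exact: cvg_within.
    rewrite scale0r; apply: cvg_trans; apply: near_eq_cvg.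
    near=> t; rewrite /q scalerA divff ?scale1r //.
    by near: t; exact: nbhs_dnbhs_neq.
  have := C1_expand sp oU Ux Cf (divr_gt0 eps0 K0).
  move/gnear => H1.
  near=> t.
  have t0 : t != 0 by near: t; exact: nbhs_dnbhs_neq.
  have qK : `|q t| <= K.
    near: t; apply: cvgr_norm_le qc _ _; by rewrite ltrDl.
  rewrite sub0r normrN.
  have -> : t^-1 *: (f (g (t *: v + x)) - f (g x)) - lin (q t) =
     t^-1 * (f (g (t *: v + x)) - f (g x) - lin (g (t *: v + x) - g x)).
    by rewrite mulrBr -linZ.
  rewrite normrM normfV ler_pdivrMl ?normr_gt0 //.
  have : `|f (g (t *: v + x) - g x + g x) - f (g x) -
     lin (g (t *: v + x) - g x)| <= eps / K * `|g (t *: v + x) - g x|.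
    by near: t; exact: H1.
  rewrite subrK => /le_trans; apply.
  have -> : g (t *: v + x) - g x = t *: q t by rewrite /q scalerA divff ?scale1r.
  rewrite normrZ mulrCA ler_wpM2l // mulrAC ler_pdivrMr // ler_wpM2l // ltW //.
split; [by apply/cvg_ex; eexists; exact: H | exact/cvg_lim].
Unshelve. all: by end_near. Qed.

End FiniteCoordinates.

(** * Composition, and functions with values in matrices *)

Section CkComposition.
Variable R : realType.
Implicit Types V W : normedModType R.

Lemma Ck_sum k V W (U : set V) (I : Type) (r : seq I) (P : pred I)
    (f : I -> V -> W) : open U -> (forall i, P i -> Ck k U (f i)) ->
  Ck k U (fun x => \sum_(i <- r | P i) f i x).
Proof.
move=> oU Cf; elim: r => [|i r IH].
  by under eq_fun do rewrite big_nil; exact: Ck_cst.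
have [Pi|/negbTE Pi] := boolP (P i); under eq_fun do rewrite big_cons Pi //.
  by apply: CkD => //; exact: Cf.
exact: IH.
Qed.

Lemma spanning_cont V m e c : @spanning R V m e c -> forall k, continuous (c k).
Proof.
move=> [clin cbnd _] k y; apply/cvgrPdist_le => eps eps0; near=> z.
have -> : c k y - c k z = c k (y - z).
  by have := clin k (-1) z y; rewrite scaleN1r mulN1r ![- _ + _]addrC.
apply: le_trans (cbnd _ _) _; near: z.
exact: (cvgrPdist_le _ _).1 _ eps eps0.
Unshelve. all: by end_near. Qed.

(** By the chain rule a derivative of the composite is a sum of products of a derivative of [g] with
    a derivative of [f] composed with [g]; the latter falls under the induction hypothesis. *)
Lemma Ck_comp k V W (U : set V) (U' : set W) (f : W -> R) (g : V -> W) :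
  fdim W -> open U -> open U' -> (forall x, U x -> U' (g x)) ->
  Ck k U' f -> Ck k U g -> Ck k U (fun x => f (g x)).
Proof.
move=> [m [e [c sp]]] oU oU' UU'; elim: k f g UU' => [|k IH] f g UU' Cf Cg;
  have [fc fd] := Cf; have [gc gd] := Cg; split=> //;
  try by move=> x Ux; apply: continuous_comp; [exact: gc | apply/fc/UU'].
have C1 j : Ck j.+1 U' f -> Ck 1 U' f by elim: j => // j + /CkW; apply.
have dc x v : U x -> is_derive x v (fun y => f (g y))
    (\sum_(k < m) c k ('D_v g x) * 'D_(e k) f (g x)).
  move=> Ux; apply: (is_derive_comp sp oU' (UU' x Ux) (C1 _ Cf)).
  exact: (gd v).1 x Ux.
move=> v; split=> [x Ux|]; first by have [] := dc x v Ux.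
apply: (@Ck_congr _ _ _ _ _ (fun x => \sum_(k < m) c k ('D_v g x) * 'D_(e k) f (g x))) => //.
  by move=> x Ux; have [_ ->] := dc x v Ux.
apply: Ck_sum => // i _; apply: CkM => //.
  apply: (@Ck_linear_comp _ _ _ _ _ _ (c i)) => //.
  - by move=> a u w; have [-> _ _] := sp.
  - exact: (spanning_cont sp).
  - by have [] := gd v.
apply: (IH ('D_(e i) f)) => //; first by have [] := fd (e i).
exact: CkW.
Qed.

Lemma Ck_entry k V p q (U : set V) (f : V -> 'M[R]_(p, q)) i j :
  open U -> Ck k U f -> Ck k U (fun x => f x i j).
Proof.
move=> oU; apply: (@Ck_linear_comp _ _ _ _ _ _ (fun M : 'M[R]_(p, q) => M i j)) => //.
  by move=> a u v; rewrite !mxE.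
exact: coord_continuous.
Qed.

Lemma cvg_mxP (T : Type) (F : set_system T) (FF : Filter F) p q
    (f : T -> 'M[R]_(p, q)) (l : 'M[R]_(p, q)) :
  (forall i j, f t i j @[t --> F] --> l i j) -> f @ F --> l.
Proof.
move=> H; apply/cvgrPdist_le => eps eps0; near=> t.
rewrite [leLHS]/Num.Def.normr /= mx_normrE (bigmax_le _ (ltW eps0)) //= => ij _.
rewrite !mxE; move: ij; near: t; apply: filter_forall => ij.
exact: (cvgrPdist_le _ _).1 (H _ _) eps eps0.
Unshelve. all: by end_near. Qed.

Lemma Ck_mx k V p q (U : set V) (f : V -> 'M[R]_(p, q)) : open U ->
  (forall i j, Ck k U (fun x => f x i j)) -> Ck k U f.
Proof.
move=> oU; elim: k f => [|k IH] f H; split=> //;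
  try by move=> x Ux; apply: cvg_mxP => i j; have [+ _] := H i j; apply.
have dv x v : U x -> derivable f x v.
  by move=> Ux; apply/derivable_mxP => i j; have [_ /(_ v) [+ _]] := H i j; apply.
move=> v; split=> [x Ux|]; first exact: dv.
apply: IH => i j; have [_ /(_ v) [_]] := H i j; apply: Ck_congr => // x Ux.
by rewrite derive_mx ?mxE //; exact: dv.
Qed.

Lemma Ck_id k V (U : set V) : open U -> Ck k U (fun x : V => x).
Proof.
move=> oU; case: k => [|k]; split=> //; try by move=> x _; exact: cvg_id.
move=> v; split=> [x _|]; first exact: derivable_id.
by under eq_fun do rewrite derive_id; exact: Ck_cst.
Qed.

End CkComposition.

(** * Germs of smooth functions *)

Section SmoothNear.
Variable R : realType.
Implicit Types V W : normedModType R.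

Lemma sn_congr V W (f g : V -> W) x :
  (\forall y \near x, f y = g y) -> smooth_near f x -> smooth_near g x.
Proof.
move=> fg [U [oU Ux Cf]].
exists (U `&` interior [set y | f y = g y]); split.
- by apply: openI => //; exact: open_interior.
- by split=> //; exact: fg.
- move=> k; apply: (@Ck_congr _ _ _ _ _ f).
  + by apply: openI => //; exact: open_interior.
  + by move=> y [_ /interior_subset].
  + by apply: Ck_sub (Cf k) => y [].
Qed.

Lemma sn_near V W (f : V -> W) x :
  smooth_near f x -> \forall y \near x, smooth_near f y.
Proof.
by move=> [U [oU Ux Cf]]; apply: filterS (open_near oU Ux) => y Uy; exists U.
Qed.

Lemma sn_cont V W (f : V -> W) x : smooth_near f x -> {for x, continuous f}.
Proof. by move=> [U [oU Ux /(_ 0%N) [+ _]]]; apply. Qed.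

Lemma sn_derivable V W (f : V -> W) x v : smooth_near f x -> derivable f x v.
Proof. by move=> [U [oU Ux /(_ 1%N) [_ /(_ v) [+ _]]]]; apply. Qed.
Arguments sn_derivable [V W f x] v _.

Lemma sn_derive V W (f : V -> W) x v : smooth_near f x -> smooth_near ('D_v f) x.
Proof.
move=> [U [oU Ux Cf]]; exists U; split=> // k.
by have [_ /(_ v) []] := Cf k.+1.
Qed.

Lemma sn_Ck k V W (U : set V) (f : V -> W) :
  (forall x, U x -> smooth_near f x) -> Ck k U f.
Proof.
elim: k f => [|k IH] f sf; split=> //; try by move=> x /sf; exact: sn_cont.
move=> v; split=> [x /sf sfx|]; first exact: sn_derivable.
by apply: IH => x /sf; exact: sn_derive.
Qed.

Lemma sn_inter V W (I : finType) (f : I -> V -> W) x :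
  (forall i, smooth_near (f i) x) ->
  exists U : set V, [/\ open U, U x & forall i k, Ck k U (f i)].
Proof.
move=> H; have /choice[U HU] := H.
exists (interior [set y | forall i, U i y]); split.
- exact: open_interior.
- rewrite /interior /=; apply: filter_forall => i.
  by have [oU Ux _] := HU i; exact: open_near.
- move=> i k; have [_ _ Cf] := HU i.
  by apply: Ck_sub (Cf k) => y /interior_subset; apply.
Qed.

Lemma sn_cst V W (w : W) x : smooth_near (fun _ : V => w) x.
Proof. by exists setT; split=> //; [exact: openT | move=> k; exact: Ck_cst]. Qed.

Lemma sn_id V (x : V) : smooth_near (fun x : V => x) x.
Proof. by exists setT; split=> //; [exact: openT | move=> k; exact/Ck_id/openT]. Qed.

Lemma sn_inter2 V W W' (f : V -> W) (g : V -> W') x :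
  smooth_near f x -> smooth_near g x ->
  exists U, [/\ open U, U x, forall k, Ck k U f & forall k, Ck k U g].
Proof.
move=> [U [oU Ux Cf]] [U' [oU' Ux' Cg]]; exists (U `&` U'); split=> //.
- exact: openI.
- by move=> k; apply: Ck_sub (Cf k) => y [].
- by move=> k; apply: Ck_sub (Cg k) => y [].
Qed.

Lemma snD V W (f g : V -> W) x :
  smooth_near f x -> smooth_near g x -> smooth_near (fun y => f y + g y) x.
Proof.
move=> sf sg; have [U [oU Ux Cf Cg]] := sn_inter2 sf sg.
by exists U; split=> // k; exact: CkD.
Qed.

Lemma snM V (f g : V -> R) x :
  smooth_near f x -> smooth_near g x -> smooth_near (fun y => f y * g y) x.
Proof.
move=> sf sg; have [U [oU Ux Cf Cg]] := sn_inter2 sf sg.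
by exists U; split=> // k; exact: CkM.
Qed.

Lemma snV V (f : V -> R) x :
  f x != 0 -> smooth_near f x -> smooth_near (fun y => (f y)^-1) x.
Proof.
move=> f0 sf; have [U [oU Ux Cf]] := sf.
have nf : \forall y \near x, f y != 0.
  exact: cvgr_neq0 (sn_cont sf) f0.
exists (U `&` interior [set y | f y != 0]); split.
- by apply: openI => //; exact: open_interior.
- by split.
- move=> k; apply: CkV.
  + by apply: openI => //; exact: open_interior.
  + by move=> y [_ /interior_subset].
  + by apply: Ck_sub (Cf k) => y [].
Qed.

Lemma sn_sum V W (I : Type) (r : seq I) (P : pred I) (f : I -> V -> W) x :
  (forall i, P i -> smooth_near (f i) x) ->
  smooth_near (fun y => \sum_(i <- r | P i) f i y) x.
Proof.
move=> sf; elim: r => [|i r IH].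
  by under eq_fun do rewrite big_nil; exact: sn_cst.
have [Pi|/negbTE Pi] := boolP (P i); under eq_fun do rewrite big_cons Pi //.
  by apply: snD => //; exact: sf.
exact: IH.
Qed.

Lemma sn_prod V (I : Type) (r : seq I) (P : pred I) (f : I -> V -> R) x :
  (forall i, P i -> smooth_near (f i) x) ->
  smooth_near (fun y => \prod_(i <- r | P i) f i y) x.
Proof.
move=> sf; elim: r => [|i r IH].
  by under eq_fun do rewrite big_nil; exact: sn_cst.
have [Pi|/negbTE Pi] := boolP (P i); under eq_fun do rewrite big_cons Pi //.
  by apply: snM => //; exact: sf.
exact: IH.
Qed.

Lemma sn_entry V p q (f : V -> 'M[R]_(p, q)) x i j :
  smooth_near f x -> smooth_near (fun y => f y i j) x.
Proof. by move=> [U [oU Ux Cf]]; exists U; split=> // k; exact: Ck_entry. Qed.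

Lemma sn_mx V p q (f : V -> 'M[R]_(p, q)) x :
  (forall i j, smooth_near (fun y => f y i j) x) -> smooth_near f x.
Proof.
move=> H; have [] := @sn_inter V _ _ (fun ij y => f y ij.1 ij.2) x.
  by move=> ij; exact: H.
move=> U [oU Ux Cf]; exists U; split=> // k; apply: Ck_mx => // i j.
exact: (Cf (i, j)).
Qed.

Lemma sn_comp V W (f : W -> R) (g : V -> W) x : fdim W ->
  smooth_near f (g x) -> smooth_near g x -> smooth_near (fun y => f (g y)) x.
Proof.
move=> fW [U [oU Ux Cf]] sg; have [U' [oU' Ux' Cg]] := sg.
exists (U' `&` interior [set y | U (g y)]); split.
- by apply: openI => //; exact: open_interior.
- split=> //; exact: (sn_cont sg) (open_near oU Ux).
- move=> k; apply: (@Ck_comp _ _ _ _ _ U) => //.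
  + by apply: openI => //; exact: open_interior.
  + by move=> y [_ /interior_subset].
  + by apply: Ck_sub (Cg k) => y [].
Qed.

Lemma sn_mulmx V p q s (f : V -> 'M[R]_(p, q)) (g : V -> 'M[R]_(q, s)) x :
  smooth_near f x -> smooth_near g x -> smooth_near (fun y => f y *m g y) x.
Proof.
move=> sf sg; apply: sn_mx => i j; under eq_fun do rewrite mxE.
by apply: sn_sum => k _; apply: snM; exact: sn_entry.
Qed.

Lemma sn_det V p (f : V -> 'M[R]_p) x :
  smooth_near f x -> smooth_near (fun y => \det (f y)) x.
Proof.
move=> sf; rewrite /determinant; apply: sn_sum => s _.
apply: snM; first exact: sn_cst.
by apply: sn_prod => i _; exact: sn_entry.
Qed.

(** Cramer's formula, valid on the neighbourhood where the determinant does not vanish. *)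
Lemma sn_invmx V p (f : V -> 'M[R]_p) x : f x \in unitmx ->
  smooth_near f x -> smooth_near (fun y => invmx (f y)) x.
Proof.
move=> fx sf; have dx : \det (f x) != 0 by rewrite -unitfE -unitmxE.
have nu : \forall y \near x, f y \in unitmx.
  have := cvgr_neq0 _ (sn_cont (sn_det sf)) dx.
  move=> /(_ _); apply: filterS => y dy; by rewrite unitmxE unitfE.
apply: (sn_congr (f := fun y => \matrix_(i, j) ((\det (f y))^-1 * (\adj (f y)) i j))).
  by apply: filterS nu => y; rewrite /invmx => ->; apply/matrixP => i j; rewrite !mxE.
apply: sn_mx => i j; under eq_fun do rewrite !mxE.
apply: snM; first by apply: snV => //; exact: sn_det.
apply: snM; first exact: sn_cst.
apply: sn_det; apply: sn_mx => k l; under eq_fun do rewrite !mxE.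
exact: sn_entry.
Qed.

(** The sum in [is_derive_comp] is recognised as a directional derivative by applying that lemma a
    second time, to the straight line through [g x] with velocity ['D_v g x]. *)
Lemma sn_derive_comp V W (f : W -> R) (g : V -> W) x v : fdim W ->
  smooth_near f (g x) -> smooth_near g x ->
  'D_v (fun y => f (g y)) x = 'D_('D_v g x) f (g x).
Proof.
move=> [m [e [c sp]]] [U [oU Ux Cf]] sg.
have [_ ->] := is_derive_comp sp oU Ux (Cf 1%N) (sn_derivable v sg).
have E : (0 : R) *: 'D_v g x + g x = g x by rewrite scale0r add0r.
have dl : is_derive (0 : R) 1 (fun t : R => t *: 'D_v g x + g x) ('D_v g x).
  have := @is_derive_line R W W id (g x) ('D_v g x) 0.
  by rewrite derive_id; apply; exact: derivable_id.
have [dl1 dl2] := dl.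
have := @is_derive_comp R R W m e c U f (fun t : R => t *: 'D_v g x + g x) 0 1 sp oU.
rewrite E dl2 => /(_ Ux (Cf 1%N) dl1) [_ <-].
apply: derive_line; near=> t => /=.
by rewrite addr0 [t *: 1]mulr1.
Unshelve. all: by end_near. Qed.

(** The chain rule with the identity as inner function expresses ['D_w f x] through the coefficients
    of [w], which are linear in [w]. *)
Lemma sn_derive_lin V (f : V -> R) x a u v : fdim V -> smooth_near f x ->
  'D_(a *: u + v) f x = a * 'D_u f x + 'D_v f x.
Proof.
move=> [m [e [c sp]]] [U [oU Ux Cf]].
have D w : 'D_w f x = \sum_(k < m) c k w * 'D_(e k) f x.
  have := @is_derive_comp R V V m e c U f id x w sp oU Ux (Cf 1%N) (@derivable_id _ _ _ _).
  by rewrite derive_id => -[_ <-].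
rewrite !D mulr_sumr -big_split /=; apply: eq_bigr => k _.
by have [-> _ _] := sp; rewrite mulrDl mulrA.
Qed.

Lemma sn_derive_rV n (f : 'rV[R]_n -> R) x v : smooth_near f x ->
  'D_v f x = \sum_i v 0 i * 'D_(delta_mx 0 i) f x.
Proof.
move=> [U [oU Ux Cf]].
have := @is_derive_comp R _ _ _ _ _ U f id x v (@spanning_rV R n) oU Ux (Cf 1%N)
  (@derivable_id _ _ _ _).
rewrite derive_id => -[_ ->]; apply: eq_bigr => i _.
by rewrite rV_coefE delta_rowE.
Qed.

Lemma sn_derive_mx V p q (f : V -> 'M[R]_(p, q)) x v i j : smooth_near f x ->
  ('D_v f x) i j = 'D_v (fun y => f y i j) x.
Proof. by move=> sf; rewrite derive_mx ?mxE //; exact: sn_derivable. Qed.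

End SmoothNear.

(** * Symmetry of second derivatives *)

Section Schwarz.
Variables (R : realType) (V : normedModType R) (f : V -> R) (x u v : V).
Hypothesis sf : smooth_near f x.

(** The mean value theorem is used twice: along [a] for the increment of [f] by [h *: b], then along
    [b] for ['D_a f]. *)
Lemma mixed_difference (a b : V) : \forall h \near (0 : R),
  exists s t : R, [/\ `|s| <= `|h|, `|t| <= `|h| &
    f (h *: a + (h *: b + x)) - f (h *: b + x) - (f (h *: a + x) - f x) =
    h * (h * 'D_b ('D_a f) (t *: b + (s *: a + x)))].
Proof.
have [U [oU Ux Cf]] := sf.
have [d d0 dU] := spanning_ballW oU Ux.
pose K := `|a| + `|b| + 1.
have K0 : 0 < K by rewrite ltr_wpDl // addr_ge0.
near=> h.
have hK : `|h| * K < d.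
  rewrite -ltr_pdivlMr //; near: h; apply: near0_lt; exact: divr_gt0.
have UU (s t : R) : `|s| <= `|h| -> `|t| <= `|h| -> U (t *: b + (s *: a + x)).
  move=> sh th; apply: dU; apply: le_lt_trans hK.
  rewrite addrA addrK (le_trans (ler_normD _ _)) // !normrZ !mulrDr mulr1.
  by rewrite addrC ler_wpDr // lerD // ler_wpM2r.
have [_ Ca] := Cf 2%N; have [da Cda] := Ca a.
have [_ /(_ b) [dab _]] := Cda.
have h0 : `|0 : R| <= `|h| by rewrite normr0.
pose g y := f (h *: b + y) - f y.
have sft y w : U (h *: b + y) -> is_derive y w (fun y => f (h *: b + y)) ('D_w f (h *: b + y)).
  move=> Uy; have E : (fun k : R => k^-1 *: (((fun y => f (h *: b + y)) \o shift y) (k *: w) - f (h *: b + y)))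
    = (fun k : R => k^-1 *: ((f \o shift (h *: b + y)) (k *: w) - f (h *: b + y))).
    by apply/funext => k /=; rewrite addrCA.
  have := Ca w => -[dw _]; split; first by rewrite /derivable E; exact: dw.
  by rewrite /derive E.
have dg (s : R) : `|s| <= `|h| -> is_derive (s *: a + x) a g
    ('D_a f (h *: b + (s *: a + x)) - 'D_a f (s *: a + x)).
  move=> sh; apply: is_deriveB; first by apply: sft; apply: UU.
  apply: derivableP; apply: da; have := UU s 0 sh h0.
  by rewrite scale0r add0r.
have [] := @MVT_line R V g x a h; first by move=> s /dg [].
move=> s sh; have [_ ->] := dg s sh.
rewrite {1 2}/g => E.
have [] := @MVT_line R V ('D_a f) (s *: a + x) b h.
  by move=> t th; apply: dab; exact: UU.
move=> t th E2; exists s, t; split=> //.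
by rewrite -E2 -E (addrCA (h *: a)); ring.
Unshelve. all: by end_near. Qed.

(** The second difference is symmetric in [u] and [v], so the two mixed derivatives agree at two
    points that tend to [x] with [h]; continuity of both concludes. *)
Lemma sn_schwarz : 'D_u ('D_v f) x = 'D_v ('D_u f) x.
Proof.
have lim0 (a b : V) : forall eps, 0 < eps -> \forall d \near (0 : R)^',
    forall s t : R, `|s| <= `|d| -> `|t| <= `|d| ->
    `|'D_b ('D_a f) x - 'D_b ('D_a f) (t *: b + (s *: a + x))| <= eps.
  move=> eps eps0.
  have := sn_cont (sn_derive b (sn_derive a sf)).
  move/cvgrPdist_le => /(_ _ eps0) /nbhs_normP [r /= r0 rP].
  pose K := `|a| + `|b| + 1.
  have K0 : 0 < K by rewrite ltr_wpDl // addr_ge0.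
  apply: nbhs_dnbhs; near=> d => s t sd td; apply: rP => /=.
  have dK : `|d| * K < r.
    rewrite -ltr_pdivlMr //; near: d; apply: near0_lt; exact: divr_gt0.
  apply: le_lt_trans dK; rewrite distrC addrA addrK.
  rewrite (le_trans (ler_normD _ _)) // !normrZ !mulrDr mulr1.
  by rewrite addrC ler_wpDr // lerD // ler_wpM2r.
apply/eqP; rewrite -subr_eq0 -normr_le0; apply/ler_addgt0Pl => eps eps0.
rewrite addr0.
have eps2 : 0 < eps / 2 by rewrite divr_gt0.
have : \forall h \near (0 : R)^', `|'D_u ('D_v f) x - 'D_v ('D_u f) x| <= eps.
  have M (a b : V) : \forall h \near (0 : R)^', exists s t : R,
    [/\ `|s| <= `|h|, `|t| <= `|h| &
    f (h *: a + (h *: b + x)) - f (h *: b + x) - (f (h *: a + x) - f x) =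
    h * (h * 'D_b ('D_a f) (t *: b + (s *: a + x)))].
    by apply: nbhs_dnbhs; exact: (mixed_difference a b).
  have := filterI (filterI (M u v) (M v u)) (filterI (lim0 u v _ eps2) (lim0 v u _ eps2)).
  move=> /(_ _ _ _); apply: filter_app; near=> h.
  have h0 : h != 0 by near: h; exact: nbhs_dnbhs_neq.
  move=> [[[s [t [sh th E1]]] [s' [t' [sh' th' E2]]]] [L1 L2]].
  have E : 'D_v ('D_u f) (t *: v + (s *: u + x)) = 'D_u ('D_v f) (t' *: u + (s' *: v + x)).
    rewrite (addrCA (h *: v)) in E2.
    have E3 : f (h *: u + (h *: v + x)) - f (h *: v + x) - (f (h *: u + x) - f x) =
      f (h *: u + (h *: v + x)) - f (h *: u + x) - (f (h *: v + x) - f x).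
      by move: (f _) (f (h *: v + x)) (f (h *: u + x)) (f x) => p q q' p'; ring.
    by rewrite E1 E2 in E3; move: E3 => /(mulfI h0)/(mulfI h0).
  have H1 := L1 s t sh th.
  have H2 := L2 s' t' sh' th'.
  rewrite [eps]splitr; apply: le_trans (lerD H2 H1).
  rewrite -E; apply: le_trans (ler_normB _ _).
  by rewrite opprB addrA subrK.
by move/filter_ex => [].
Unshelve. all: by end_near. Qed.

End Schwarz.

(** * Smooth cut-off functions *)

Section Bump.
Variable R : realType.

Lemma is_derive_scale1 (W : normedModType R) (f : R -> W) (x v : R) l :
  is_derive x 1 f l -> is_derive x v f (v *: l).
Proof.
move=> [df fl]; have dif : differentiable f x by apply/derivable1_diffP.
split; first exact: diff_derivable.
rewrite deriveE // -{1}[v]mulr1 -[v * 1]/(v *: (1 : R)) linearZ /=.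
by rewrite -deriveE // fl.
Qed.

(* The functions p(1/x) exp(-1/x), extended by 0 to x <= 0, are stable under
   differentiation, hence smooth. *)
Definition flat_fun (p : {poly R}) (x : R) : R :=
  if 0 < x then p.[x^-1] * expR (- x^-1) else 0.

Lemma horner_bound (p : {poly R}) (t : R) : 1 <= t ->
  `|p.[t]| <= (\sum_(i < size p) `|p`_i|) * t ^+ (size p).
Proof.
move=> t1; rewrite horner_coef (le_trans (ler_norm_sum _ _ _)) // mulr_suml.
apply: ler_sum => i _; rewrite normrM ler_wpM2l // ger0_norm ?exprn_ge0 //.
  by rewrite ler_weXn2l // ltnW.
exact: le_trans t1.
Qed.

(** A quadratic bound gives derivative 0 at the origin. It comes from exp t >= t^(n+2)/(n+2)! with t
    = 1/x and n the size of [p]: n powers absorb the polynomial and two are left over. *)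
Lemma flat_fun_bound (p : {poly R}) : exists2 C : R, 0 < C &
  forall x, `|x| <= 1 -> `|flat_fun p x| <= C * `|x| ^+ 2.
Proof.
pose A := \sum_(i < size p) `|p`_i| : R.
have A0 : 0 <= A by exact: sumr_ge0.
pose F := ((size p).+2)`!%:R : R.
have F0 : 0 < F by rewrite ltr0n fact_gt0.
exists (A * F + 1); first by rewrite ltr_wpDl // mulr_ge0 // ltW.
move=> x x1; rewrite /flat_fun; case: ifP => x0; last first.
  by rewrite normr0 mulr_ge0 // ?exprn_ge0 // addr_ge0 // mulr_ge0 // ltW.
rewrite gtr0_norm // in x1 *.
have t1 : 1 <= x^-1 by rewrite invf_ge1.
rewrite expRN normrM (ger0_norm (_ : 0 <= (expR _)^-1)) ?invr_ge0 ?expR_ge0 //.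
rewrite ler_pdivrMr ?expR_gt0 //.
apply: le_trans (horner_bound p t1) _; rewrite -/A.
have E := expR_ge1Dxn (size p).+1 (le_trans ler01 t1).
have E2 : x^-1 ^+ (size p).+2 <= F * expR x^-1.
  rewrite mulrC -ler_pdivrMr //; apply: le_trans E.
  by rewrite lerDr.
have E3 : x^-1 ^+ (size p) <= F * expR x^-1 * x ^+ 2.
  rewrite -ler_pdivrMr ?exprn_gt0 //; apply: le_trans E2.
  by rewrite -exprVn -exprD addn2.
apply: le_trans (ler_wpM2l A0 E3) _.
rewrite mulrDl mul1r mulrDl.
rewrite (_ : A * (F * expR x^-1 * x ^+ 2) = A * F * x ^+ 2 * expR x^-1); last by ring.
by rewrite lerDl mulr_ge0 ?exprn_ge0 ?expR_ge0 // ltW.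
Qed.

(** With t = 1/x one has dt/dx = - t^2, so p(t) exp(-t) has derivative t^2 (p - p')(t) exp(-t). At 0
    the quadratic bound applies. *)
Lemma is_derive_flat_fun (p : {poly R}) (x : R) :
  is_derive x 1 (flat_fun p) (flat_fun ('X^2 * (p - p^`())) x).
Proof.
have [x0|x0|x0] := ltgtP 0 x.
- have nf : \forall y \near x, p.[y^-1] * expR (- y^-1) = flat_fun p y.
    near=> y; rewrite /flat_fun ifT //; near: y; exact: lt_nbhsr.
  apply: near_eq_is_derive nf _.
  have dV : is_derive x 1 (fun y : R => y^-1) (- x ^- 2).
    have := @is_deriveV R id x 1 1 (lt0r_neq0 x0) (is_derive_id _ _).
    by rewrite [_ *: 1]mulr1.
  have d1 := is_derive1_comp (is_derive_poly p x^-1) dV.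
  have dN : is_derive x 1 (fun y : R => - y^-1) (x ^- 2).
    by have := is_deriveN dV; rewrite opprK.
  have d2 := @is_derive1_comp R expR (fun y => - y^-1) x _ _ (is_derive_expR (- x^-1)) dN.
  refine (is_derive_eq (is_deriveM d1 d2) _).
  rewrite /flat_fun x0 !hornerE /GRing.scale /= exprVn.
  by ring.
- have nf : \forall y \near x, 0 = flat_fun p y.
    near=> y; rewrite /flat_fun ifF //; apply/negbTE; rewrite -leNgt ltW //.
    near: y; exact: (open_near (@open_lt R 0) x0).
  rewrite /flat_fun (lt_gtF x0).
  apply: near_eq_is_derive nf _; exact: is_derive_cst.
- rewrite -{}x0; have [C C0 HC] := flat_fun_bound p.
  have f0 q : flat_fun q 0 = 0 by rewrite /flat_fun ltxx.
  rewrite f0.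
  have H : h^-1 *: ((flat_fun p \o shift 0) (h *: 1) - flat_fun p 0) @[h --> (0:R)^'] --> (0 : R).
    apply/cvgrPdist_le => eps eps0.
    have e0 : 0 < Num.min 1 (eps / C) by rewrite lt_min ltr01 divr_gt0.
    move: (nbhs_dnbhs (near0_lt e0)); apply: filter_app; near=> h.
    have h0 : h != 0 by near: h; exact: nbhs_dnbhs_neq.
    rewrite lt_min => /andP[/ltW h1 hC].
    rewrite sub0r normrN f0 subr0 /= addr0 [h *: 1]mulr1 normrM normfV.
    rewrite ler_pdivrMl ?normr_gt0 //; apply: le_trans (HC h h1) _.
    rewrite expr2 mulrA mulrC ler_wpM2l // mulrC -ler_pdivlMr //.
    exact: ltW.
  by split; [apply/cvg_ex; eexists; exact: H | exact/cvg_lim].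
Unshelve. all: by end_near. Qed.

Lemma Ck_flat_fun k (p : {poly R}) : Ck k setT (flat_fun p).
Proof.
have cf q : forall x, [set: R] x -> {for x, continuous (flat_fun q)}.
  move=> x _; apply: differentiable_continuous; apply/derivable1_diffP.
  by have [] := is_derive_flat_fun q x.
elim: k p => [|k IH] p; split=> //; try by move=> x _; exact: cf.
move=> v.
have dv x := is_derive_scale1 v (is_derive_flat_fun p x).
split=> [x _|]; first by have [] := dv x.
have -> : 'D_v (flat_fun p) = fun x => v * flat_fun ('X^2 * (p - p^`())) x.
  by apply/funext => x; have [_ ->] := dv x.
by apply: CkM; [exact: openT | exact: Ck_cst | exact: IH].
Qed.

Lemma sn_flat_fun (p : {poly R}) (x : R) : smooth_near (flat_fun p) x.
Proof. by exists setT; split=> //; [exact: openT | move=> k; exact: Ck_flat_fun]. Qed.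

Definition smooth_step (x : R) : R :=
  flat_fun 1 x / (flat_fun 1 x + flat_fun 1 (1 - x)).

Lemma flat_fun1_gt0 (x : R) : 0 < x -> 0 < flat_fun 1 x.
Proof. by move=> x0; rewrite /flat_fun x0 hornerC mul1r expR_gt0. Qed.

Lemma flat_fun1_ge0 (x : R) : 0 <= flat_fun 1 x.
Proof. by rewrite /flat_fun; case: ifP => // _; rewrite hornerC mul1r expR_ge0. Qed.

Lemma flat_fun_le0 p (x : R) : x <= 0 -> flat_fun p x = 0.
Proof. by move=> x0; rewrite /flat_fun ltNge x0. Qed.

Lemma smooth_step_le0 (x : R) : x <= 0 -> smooth_step x = 0.
Proof. by move=> x0; rewrite /smooth_step flat_fun_le0 // mul0r. Qed.

Lemma smooth_step_ge1 (x : R) : 1 <= x -> smooth_step x = 1.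
Proof.
move=> x1; rewrite /smooth_step (@flat_fun_le0 _ (1 - x)) ?subr_le0 // addr0.
by rewrite divff // gt_eqF // flat_fun1_gt0 // (lt_le_trans ltr01).
Qed.

Lemma sn_smooth_step (x : R) : smooth_near smooth_step x.
Proof.
have s1 : smooth_near (fun x : R => flat_fun 1 (1 - x)) x.
  apply: sn_comp; [exact: fdim_real | exact: sn_flat_fun |].
  apply: snD; first exact: sn_cst.
  rewrite (_ : -%R = (fun x : R => (-1) * x)); last first.
    by apply/funext => y; rewrite mulN1r.
  by apply: snM; [exact: sn_cst | exact: sn_id].
apply: snM; first exact: sn_flat_fun.
apply: snV; last by apply: snD => //; exact: sn_flat_fun.
(* The denominator is positive because x and 1 - x are never both non-positive. *)
have [x0|x0] := ltP 0 x.
  by rewrite gt_eqF // ltr_pwDl ?flat_fun1_gt0 ?flat_fun1_ge0.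
by rewrite gt_eqF // ltr_wpDl ?flat_fun1_ge0 // flat_fun1_gt0 // subr_gt0 (le_lt_trans x0).
Qed.

Lemma bump_rV n (z0 : 'rV[R]_n) (r : R) : 0 < r ->
  exists chi : 'rV[R]_n -> R, [/\ forall z, smooth_near chi z,
    forall z, `|z - z0| <= r / 2 -> chi z = 1 &
    forall z, chi z != 0 -> `|z - z0| < r].
Proof.
move=> r0.
(* A product over the coordinates fits the sup norm, and the square avoids the kink of the absolute
   value. For a relative deviation u, the argument 4/3 (1 - u^2) is at least 1 when |u| <= 1/2 and
   at most 0 when |u| >= 1. *)
exists (fun z => \prod_i smooth_step (4 / 3 * (1 - ((z 0 i - z0 0 i) / r) ^+ 2))); split.
- move=> z; apply: sn_prod => i _.
  apply: (sn_comp (f := smooth_step)); [exact: fdim_real | exact: sn_smooth_step |].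
  apply: snM; first exact: sn_cst.
  have -> : (fun x : 'rV[R]_n => 1 - ((x 0 i - z0 0 i) / r) ^+ 2) =
    (fun x => 1 + (-1) * (((x 0 i + - z0 0 i) * r^-1) * ((x 0 i + - z0 0 i) * r^-1))).
    by apply/funext => x; rewrite mulN1r expr2.
  have su : smooth_near (fun x : 'rV[R]_n => (x 0 i + - z0 0 i) * r^-1) z.
    apply: snM; last exact: sn_cst.
    by apply: snD; [apply: sn_entry; exact: sn_id | exact: sn_cst].
  apply: snD; first exact: sn_cst.
  by apply: snM; [exact: sn_cst | exact: snM].
- move=> z zr; apply: big1 => i _; apply: smooth_step_ge1.
  have : `|z 0 i - z0 0 i| <= r / 2.
    by apply: le_trans zr; have := mx_entry_le (z - z0) 0 i; rewrite !mxE.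
  rewrite -[_ / r]mulr1 => H.
  have : ((z 0 i - z0 0 i) / r) ^+ 2 <= 1 / 4.
    rewrite -real_normK ?num_real // normrM normfV (gtr0_norm r0).
    have -> : 1 / 4 = (1 / 2) ^+ 2 :> R by field.
    rewrite ler_pXn2r // ?nnegrE ?divr_ge0 ?(ltW r0) //.
    by rewrite ler_pdivrMr // mulrAC mul1r.
  rewrite mulr1; move: (((z 0 i - z0 0 i) / r) ^+ 2) => q q4; lra.
- move=> z; apply: contraNT; rewrite -leNgt => rz.
  have [i ri] : exists i, r <= `|z 0 i - z0 0 i|.
    apply: contrapT => /forallNP H; move: rz; apply/negP; rewrite -ltNge.
    rewrite [ltLHS]/Num.Def.normr /= mx_normrE.
    apply: bigmax_lt => // -[j i] _; rewrite !mxE /= (ord1 j) ltNge.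
    by apply/negP => /H.
  rewrite (bigD1 i) //= smooth_step_le0 ?mul0r //.
  have : 1 <= ((z 0 i - z0 0 i) / r) ^+ 2.
    rewrite -real_normK ?num_real // exprn_ege1 // normrM normfV (gtr0_norm r0).
    by rewrite ler_pdivlMr // mul1r.
  move: (((z 0 i - z0 0 i) / r) ^+ 2) => q q1; lra.
Qed.

End Bump.

(** * Existence of solutions of differential equations *)

Section Picard.
Variable R : realType.

Lemma near_forall (T : topologicalType) (x : T) (I : finType) (P : I -> T -> Prop) :
  (forall i, \forall y \near x, P i y) -> \forall y \near x, forall i, P i y.
Proof. exact: filter_forall. Qed.

Lemma near_dist (V : normedModType R) (x : V) (d : R) :
  0 < d -> \forall y \near x, `|x - y| < d.
Proof. by move=> d0; apply/nbhs_normP; exists d. Qed.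

Lemma near_norm_lt (V : normedModType R) (x : V) (d : R) :
  `|x| < d -> \forall y \near x, `|y| < d.
Proof.
move=> xd; have := near_dist x (_ : 0 < d - `|x|); rewrite subr_gt0 => /(_ xd).
apply: filterS => y; rewrite ltrBrDl; apply: le_lt_trans.
by rewrite distrC -{1}[y](subrK x) addrC; exact: ler_normD.
Qed.

Lemma near_and (T : topologicalType) (x : T) (P Q : T -> Prop) :
  (\forall y \near x, P y) -> (\forall y \near x, Q y) ->
  \forall y \near x, P y /\ Q y.
Proof. by move=> *; exact: filterI. Qed.

Lemma pow2_inv_small (x c : R) : (forall n, x <= c / 2 ^+ n) -> x <= 0.
Proof.
move=> H; rewrite leNgt; apply/negP => x0.
have c0 : 0 < c by have := H 0%N; rewrite expr0 divr1; exact: lt_le_trans.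
pose n := Num.truncn (c / x).
have := H n.+1; rewrite leNgt => /negP; apply.
rewrite ltr_pdivrMr ?exprn_gt0 // mulrC -ltr_pdivrMr //.
apply: lt_le_trans (truncnS_gt _) _; rewrite -/n.
rewrite -natrX ler_nat; exact: ltnW (ltn_expl _ _).
Qed.

(** The intervals with centre [u n] and radius 2c/2^n are nested, so the supremum of their left ends
    lies in all of them. *)
Lemma pow2_cvg (u : nat -> R) (c : R) :
  (forall n, `|u n.+1 - u n| <= c / 2 ^+ n) ->
  exists l, forall n, `|l - u n| <= 2 * c / 2 ^+ n.
Proof.
move=> H; have c0 : 0 <= c.
  by have := H 0%N; rewrite expr0 divr1; exact: le_trans.
pose d n := 2 * c / 2 ^+ n.
have dS n : d n.+1 = c / 2 ^+ n.
  by rewrite /d exprS; field; rewrite expf_neq0.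
have d2 n : d n = c / 2 ^+ n + c / 2 ^+ n.
  by rewrite /d; field; rewrite expf_neq0.
have d0 n : 0 <= d n by apply: mulr_ge0; [exact: mulr_ge0 | rewrite invr_ge0 exprn_ge0].
have lo n m : (n <= m)%N -> u n - d n <= u m - d m.
  elim: m => [|m IH]; first by rewrite leqn0 => /eqP ->.
  rewrite leq_eqVlt => /orP[/eqP -> //|/IH /le_trans]; apply.
  have := H m; rewrite ler_norml => /andP[h1 h2]; rewrite dS d2; lra.
have hi n m : (n <= m)%N -> u m + d m <= u n + d n.
  elim: m => [|m IH]; first by rewrite leqn0 => /eqP ->.
  rewrite leq_eqVlt => /orP[/eqP -> //|/IH]; apply: le_trans.
  have := H m; rewrite ler_norml => /andP[h1 h2]; rewrite dS d2; lra.
have lohi n m : u n - d n <= u m + d m.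
  have [nm|/ltnW mn] := leqP n m.
    by apply: le_trans (lo _ _ nm) _; have := d0 m; lra.
  by apply: le_trans (hi _ _ mn); have := d0 n; lra.
pose S := range (fun n => u n - d n).
have Sub m : ubound S (u m + d m) by move=> _ [n _ <-]; exact: lohi.
have S0 : S !=set0 by exists (u 0%N - d 0%N), 0%N.
exists (sup S) => n; rewrite ler_norml; apply/andP; split.
  have : u n - d n <= sup S.
    by apply: ub_le_sup; [exists (u 0%N + d 0%N); exact: Sub | exists n].
  by rewrite /d; lra.
have : sup S <= u n + d n by apply: ge_sup.
by rewrite /d; lra.
Qed.

Lemma antiderivative (f : R -> R) : continuous f ->
  exists A : R -> R, A 0 = 0 /\ forall t : R, `|t| < 1 -> is_derive t 1 A (f t).
Proof.
move=> cf.
(* Integrating from -1 puts all of ]-1, 1[ in the interior of the domain, where the fundamental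
   theorem gives a two-sided derivative; the value at 0 is subtracted afterwards. *)
pose A (x : R) := (\int[lebesgue_measure]_(t in [set` Interval (BLeft (-1)) (BRight x)]) f t)%R.
exists (fun x => A x - A 0); split; first by rewrite subrr.
move=> t; rewrite ltr_norml => /andP[t1 t2].
have intf : lebesgue_measure.-integrable [set` Interval (BLeft (-1)) (BRight 1)] (EFin \o f).
  apply: continuous_compact_integrable; first exact: segment_compact.
  exact: continuous_subspaceT.
have [dA A'] := @continuous_FTC1 R f (BLeft (-1)) t 1 t2 intf t1 (cf t).
have H : is_derive t 1 A (f t).
  by split; [exact: dA | rewrite -derive1E].
rewrite -[f t]subr0; apply: is_deriveB; exact: is_derive_cst.
Qed.

Lemma antiderivative_rV n (f : R -> 'rV[R]_n) : continuous f ->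
  exists A : R -> 'rV[R]_n, A 0 = 0 /\
    forall t : R, `|t| < 1 -> forall i, is_derive t 1 (fun t : R => A t 0 i) (f t 0 i).
Proof.
move=> cf.
have ci i : continuous (fun t => f t 0 i).
  move=> t; apply: (@continuous_comp _ _ _ f (fun M : 'rV[R]_n => M 0 i)); first exact: cf.
  exact: coord_continuous.
have /choice[A HA] : forall i, exists A : R -> R, A 0 = 0 /\
    forall t : R, `|t| < 1 -> is_derive t 1 A (f t 0 i).
  by move=> i; exact: antiderivative.
exists (fun t => \row_i A i t); split.
  by apply/rowP => i; rewrite !mxE; have [] := HA i.
move=> t t1 i; under eq_fun do rewrite mxE.
by have [_] := HA i; apply.
Qed.

Lemma is_derive_rV n (z : R -> 'rV[R]_n) (t : R) (l : 'rV[R]_n) :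
  (forall i, is_derive t 1 (fun t : R => z t 0 i) (l 0 i)) -> is_derive t 1 z l.
Proof.
move=> H.
have dz : derivable z t 1.
  by apply/derivable_mxP => j i; rewrite (ord1 j); have [] := H i.
split=> //; rewrite derive_mx //; apply/rowP => i; rewrite mxE.
by have [] := H i.
Qed.

Lemma mx_norm_le m n (v : 'M[R]_(m, n)) (c : R) :
  0 <= c -> (forall i j, `|v i j| <= c) -> `|v| <= c.
Proof.
move=> c0 H; rewrite [leLHS]/Num.Def.normr /= mx_normrE.
by apply: bigmax_le => // ij _; exact: H.
Qed.

Lemma smooth_lipschitz n (F : 'rV[R]_n -> R) x0 : smooth_near F x0 ->
  exists K r : R, [/\ 0 < K, 0 < r & forall y y', `|y - x0| < r -> `|y' - x0| < r ->
    `|F y - F y'| <= K * `|y - y'|].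
Proof.
move=> sF.
have [K [K0 HK]] : exists K : R, 0 < K /\ \forall y \near x0, forall v,
    `|'D_v F y| <= K * `|v|.
  (* Near [x0] each partial derivative exceeds its size at [x0] by at most 1, and the coordinates of
     [v] are bounded by its norm. *)
  exists (\sum_i (`|'D_(delta_mx 0 i) F x0| + 1) + 1); split.
    by rewrite ltr_wpDl // sumr_ge0 // => i _; rewrite addr_ge0.
  have H : \forall y \near x0, forall i : 'I_n, `|'D_(delta_mx 0 i) F y| <=
      `|'D_(delta_mx 0 i) F x0| + 1.
    apply: (near_forall (P := fun i y => `|'D_(delta_mx 0 i) F y| <= `|'D_(delta_mx 0 i) F x0| + 1)) => i.
    have := sn_cont (sn_derive (delta_mx 0 i) sF).
    move/cvgrPdist_le => /(_ 1 ltr01); apply: filterS => y Hy.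
    by rewrite -lerBlDl; apply: le_trans (lerB_dist _ _) _; rewrite distrC.
  apply: filterS2 H (sn_near sF) => y H sFy v.
  rewrite sn_derive_rV // (le_trans (ler_norm_sum _ _ _)) // mulrDl mul1r ler_wpDr //.
  rewrite mulr_suml ler_sum // => i _; rewrite normrM mulrC.
  by rewrite ler_pM // mx_entry_le.
have /nbhs_normP[r /= r0 Hr] : \forall y \near x0,
    (forall v, `|'D_v F y| <= K * `|v|) /\ smooth_near F y.
  exact: near_and HK (sn_near sF).
exists K, r; split=> // y y' yr y'r.
(* Convexity of the ball: for s between 0 and 1 the point of the segment stays in it. The
   alternative s < 0 is excluded at each use. *)
have conv (s : R) : `|s| <= `|1 : R| -> (forall v, `|'D_v F (s *: (y - y') + y')| <= K * `|v|) /\ smooth_near F (s *: (y - y') + y') \/ s < 0.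
  move=> s1; have [s0|s0] := leP 0 s; [left|by right].
  apply: Hr; rewrite /= distrC.
  have -> : s *: (y - y') + y' - x0 = s *: (y - x0) + (1 - s) *: (y' - x0).
    by apply/rowP => k; rewrite !mxE; ring.
  move: s1; rewrite normr1 ger0_norm // => s1.
  apply: le_lt_trans (ler_normD _ _) _; rewrite !normrZ ger0_norm //.
  rewrite (ger0_norm (_ : 0 <= 1 - s)) ?subr_ge0 //.
  have [s'|s'] := leP s (1/2).
    have : (1 - s) * `|y' - x0| < (1 - s) * r by rewrite ltr_pM2l //; lra.
    have : s * `|y - x0| <= s * r by rewrite ler_wpM2l // ltW.
    lra.
  have : s * `|y - x0| < s * r by rewrite ltr_pM2l //; lra.
  have : (1 - s) * `|y' - x0| <= (1 - s) * r by rewrite ler_wpM2l ?subr_ge0 // ltW.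
  lra.
pose phi (s : R) := F (s *: (y - y') + y').
have dphi (s : R) : s \in `[0, 1] -> is_derive s 1 phi ('D_(y - y') F (s *: (y - y') + y')).
  rewrite in_itv /= => /andP[s0 s1]; apply: is_derive_line.
  have [|[_ sFs]|] := conv s; first by rewrite !ger0_norm.
    exact: sn_derivable.
  by rewrite ltNge s0.
have cphi : {within `[0 : R, 1 : R], continuous phi}.
  by apply: derivable_within_continuous => s /dphi [].
pose dp (s : R) : R := 'D_(y - y') F (s *: (y - y') + y').
have dphi' (s : R) : s \in `]0, 1[ -> is_derive s 1 phi (dp s).
  by move=> /subset_itv_oo_cc; exact: dphi.
have [s] := MVT_segment ler01 dphi' cphi.
rewrite in_itv /= => /andP[s0 s1].
rewrite /phi scale1r subrK scale0r add0r subr0 mulr1 /dp => ->.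
have [|[+ _]|] := conv s; first by rewrite !ger0_norm.
  exact.
by rewrite ltNge s0.
Qed.

Lemma smooth_lipschitz_rV n p (F : 'rV[R]_n -> 'rV[R]_p) x0 : smooth_near F x0 ->
  exists K r : R, [/\ 0 < K, 0 < r & forall y y', `|y - x0| < r -> `|y' - x0| < r ->
    `|F y - F y'| <= K * `|y - y'|].
Proof.
move=> sF.
have /choice[K HK] : forall i : 'I_p, exists K, exists r : R, [/\ 0 < K, 0 < r & forall y y', `|y - x0| < r -> `|y' - x0| < r ->
    `|F y 0 i - F y' 0 i| <= K * `|y - y'|].
  by move=> i; have [K [r H]] := smooth_lipschitz (sn_entry 0 i sF); exists K, r.
have : \forall r \near (0 : R)^'+, 0 < r /\ forall i y y', `|y - x0| < r -> `|y' - x0| < r ->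
    `|F y 0 i - F y' 0 i| <= K i * `|y - y'|.
  near=> r; split; first by near: r; exact: nbhs_right_gt.
  near: r; apply: filter_forall => i; have [r [K0 r0 Hr]] := HK i.
  near=> r' => y y' yr y'r.
  have rr : r' < r by near: r'; exact: nbhs_right_lt.
  by apply: Hr; apply: lt_trans rr.
move/filter_ex => [r [r0 Hr]].
have K0 i : 0 < K i by have [r' []] := HK i.
exists (\sum_i K i + 1), r; split=> //.
  by rewrite ltr_wpDl // sumr_ge0 // => i _; exact: ltW.
move=> y y' yr y'r; apply: mx_norm_le.
  by rewrite mulr_ge0 // addr_ge0 // sumr_ge0 // => i _; exact: ltW.
move=> j i; rewrite (ord1 j) !mxE; apply: le_trans (Hr i y y' yr y'r) _.
rewrite ler_wpM2r // (bigD1 i) //= -addrA lerDl addr_ge0 // sumr_ge0 // => k _.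
exact: ltW.
Unshelve. all: by end_near. Qed.

(** Freezing time outside [-d, d] makes the Picard iterates functions on the whole line, with bounds
    valid for every t. *)
Definition clamp (d t : R) : R := Num.max (- d) (Num.min d t).

Lemma clamp_le (d t : R) : 0 <= d -> `|clamp d t| <= d.
Proof.
move=> d0; rewrite /clamp ler_norml le_max lexx /= ge_max; apply/andP; split.
  by rewrite ge0_cp.
by rewrite ge_min lexx.
Qed.

Lemma clamp_id (d t : R) : `|t| <= d -> clamp d t = t.
Proof.
by rewrite ler_norml => /andP[t1 t2]; rewrite /clamp (min_idPr t2) (max_idPr t1).
Qed.

Lemma clamp_lip (d t s : R) : `|clamp d t - clamp d s| <= `|t - s|.
Proof.
wlog ts : t s / t <= s => [W|].
  have [/W //|/ltW/W] := leP t s.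
  by rewrite distrC [in X in _ <= X]distrC.
have H : clamp d t <= clamp d s.
  rewrite /clamp ge_max !le_max lexx /=; apply/orP; right.
  by rewrite le_min ge_min lexx /= ge_min ts orbT.
rewrite !ler0_norm ?subr_le0 // !opprB lerBlDl /clamp ge_max; apply/andP; split.
  by rewrite ler_wpDr ?subr_ge0 // le_max lexx.
apply: (@le_trans _ _ (Num.min d t + (s - t))); last first.
  by rewrite lerD2r le_max lexx orbT.
rewrite -lerBlDr le_min; apply/andP; split.
  by rewrite lerBlDr ler_wpDr ?subr_ge0 // ge_min lexx.
by rewrite lerBlDr addrC subrK ge_min lexx orbT.
Qed.

Theorem picard n (F : 'rV[R]_n -> 'rV[R]_n) (x0 : 'rV[R]_n) : smooth_near F x0 ->
  exists (z : R -> 'rV[R]_n) (d : R), [/\ 0 < d, z 0 = x0 &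
    forall t : R, `|t| < d -> is_derive t 1 z (F (z t)) /\ smooth_near z t].
Proof.
move=> sF.
have [K [r1 [K0 r10 HK]]] := smooth_lipschitz_rV sF.
have [r2 /= r20 Hr2] := (nbhs_normP _ _).1 (sn_near sF).
(* [F] is Lipschitz within [r1] and smooth within [r2]; half the minimum brings the closed ball of
   radius [r] inside both. *)
pose r := Num.min r1 r2 / 2.
have r0 : 0 < r by rewrite divr_gt0 // lt_min r10.
have rr : r < Num.min r1 r2 by rewrite ltr_pdivrMr // ltr_pMr ?lt_min ?r10 // ltr1n.
have rr1 (y : 'rV[R]_n) : `|y - x0| <= r -> `|y - x0| < r1.
  by move=> /le_lt_trans; apply; apply: lt_le_trans rr _; rewrite ge_min lexx.
have sFr (y : 'rV[R]_n) : `|y - x0| <= r -> smooth_near F y.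
  move=> yr; apply: Hr2; rewrite /= distrC; apply: le_lt_trans yr _.
  by apply: lt_le_trans rr _; rewrite ge_min lexx orbT.
have lipF (y y' : 'rV[R]_n) : `|y - x0| <= r -> `|y' - x0| <= r ->
    `|F y - F y'| <= K * `|y - y'|.
  by move=> /rr1 yr /rr1 y'r; exact: HK.
pose C := `|F x0| + K * r + 1.
have C0 : 0 < C by rewrite ltr_wpDl // addr_ge0 // mulr_ge0 ?ltW.
have FC (y : 'rV[R]_n) : `|y - x0| <= r -> `|F y| <= C.
  move=> yr; have x00 : `|x0 - x0| <= r by rewrite subrr normr0 ltW.
  have := lipF y x0 yr x00 => /le_trans /(_ (ler_wpM2l (ltW K0) yr)) H.
  rewrite -[F y](subrK (F x0)); apply: le_trans (ler_normD _ _) _.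
  by rewrite /C addrC -addrA lerD2l; lra.
(* The three bounds keep [-d, d] inside ]-1, 1[, where antiderivatives are available, make the
   Picard operator a contraction of factor 1/2, and keep its values in the ball of radius [r]. *)
pose d := Num.min (1 / 2) (Num.min (1 / (2 * K)) (r / (2 * C))).
have d0 : 0 < d by rewrite !lt_min; apply/and3P; split; rewrite divr_gt0 // mulr_gt0.
have d1 : d < 1 by apply: (@le_lt_trans _ _ (1/2)); [rewrite ge_min lexx | lra].
have dK : K * d <= 1 / 2.
  rewrite mulrC -ler_pdivlMr //; apply: (@le_trans _ _ (1 / (2 * K))).
    by rewrite /d !ge_min lexx orbT.
  by rewrite le_eqVlt; apply/orP; left; apply/eqP; field; rewrite gt_eqF.
have dC : 2 * (C * d) <= r.
  rewrite mulrA mulrC -ler_pdivlMr ?mulr_gt0 //.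
  by rewrite /d !ge_min lexx !orbT.
pose good (phi : R -> 'rV[R]_n) := continuous phi /\ forall t, `|phi t - x0| <= r.
(* Antiderivatives of F(phi(t)) are fixed once for all by choice; [A phi] carries no information
   unless [phi] is [good]. *)
have /choice[A HA] : forall phi : R -> 'rV[R]_n, exists A : R -> 'rV[R]_n, good phi ->
   A 0 = 0 /\ forall t : R, `|t| < 1 -> forall i, is_derive t 1 (fun t : R => A t 0 i) (F (phi t) 0 i).
  move=> phi; have [[cphi rphi]|nphi] := pselect (good phi); last by exists (fun=> 0).
  have [|A HA] := @antiderivative_rV _ (fun t => F (phi t)); last by exists A.
  by move=> t; apply: continuous_comp; [exact: cphi | exact/sn_cont/sFr].
pose T (phi : R -> 'rV[R]_n) t := x0 + A phi (clamp d t).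
(* One mean value estimate serves both for the Lipschitz bound of the iterates and for the
   contraction. *)
have est (G : R -> R) dG c : 0 <= c -> (forall t : R, `|t| < 1 -> is_derive t 1 G (dG t)) ->
    (forall t, `|dG t| <= c) -> forall s t, `|G (clamp d s) - G (clamp d t)| <= c * `|clamp d s - clamp d t|.
  move=> c0 HG dGc s t.
  wlog st : s t / clamp d t <= clamp d s => [W|].
    have [/W //|/ltW/W] := leP (clamp d t) (clamp d s).
    by rewrite distrC [in X in _ <= X]distrC.
  have cl1 u : `|clamp d u| < 1 by apply: le_lt_trans d1; exact/clamp_le/ltW.
  have in1 u : u \in `[clamp d t, clamp d s] -> `|u| < 1.
    rewrite in_itv /= => /andP[u1 u2]; rewrite ltr_norml.
    by have := cl1 s; have := cl1 t; rewrite !ltr_norml => /andP[+ _] /andP[_]; lra.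
  have [] := @MVT_segment R G dG _ _ st _.
  - by move=> u /subset_itv_oo_cc /in1; exact: HG.
  - by apply: derivable_within_continuous => u /in1 /HG [].
  - by move=> u _ ->; rewrite normrM ler_wpM2r.
have cl0 : clamp d 0 = 0 by rewrite clamp_id // normr0 ltW.
have T0 phi : good phi -> T phi 0 = x0.
  by move=> /HA[A0 _]; rewrite /T cl0 A0 addr0.
have Tlip phi s t : good phi -> `|T phi s - T phi t| <= C * `|clamp d s - clamp d t|.
  move=> gphi; have [A0 dA] := HA _ gphi; rewrite /T opprD addrACA subrr add0r.
  apply: mx_norm_le => [|j i]; first by rewrite mulr_ge0 // ltW.
  rewrite (ord1 j) !mxE.
  apply: (est (fun t => A phi t 0 i) (fun t => F (phi t) 0 i)) => [|u /dA //|u].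
    exact: ltW.
  apply: le_trans (mx_entry_le _ _ _) _; apply: FC; have [_] := gphi; exact.
have Tgood phi : good phi -> good (T phi).
  move=> gphi; split=> t.
    apply/cvgrPdist_le => eps eps0.
    apply: filterS (near_dist t (divr_gt0 eps0 C0)) => s /ltW ts; apply: le_trans (Tlip _ _ _ gphi) _.
    rewrite mulrC -ler_pdivlMr //; apply: le_trans ts; exact: clamp_lip.
  rewrite -[X in _ - X](T0 _ gphi); apply: le_trans (Tlip _ _ _ gphi) _.
  rewrite cl0 subr0; apply: (@le_trans _ _ (C * d)).
    by rewrite ler_pM2l // clamp_le // ltW.
  apply: le_trans dC; rewrite ler_peMl // ?ler1n //.
  by rewrite mulr_ge0 // ltW.
have Tcontr phi phi' e : good phi -> good phi' -> 0 <= e ->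
    (forall t, `|phi t - phi' t| <= e) -> forall t, `|T phi t - T phi' t| <= e / 2.
  move=> gphi gphi' e0 He t.
  have [A0 dA] := HA _ gphi; have [A0' dA'] := HA _ gphi'.
  rewrite /T opprD addrACA subrr add0r.
  apply: mx_norm_le => [|j i]; first by rewrite divr_ge0.
  rewrite (ord1 j) !mxE.
  pose G t := A phi t 0 i - A phi' t 0 i.
  have := est G (fun t => F (phi t) 0 i - F (phi' t) 0 i) (K * e) _ _ _ t 0.
  rewrite cl0 /G A0 A0' !mxE !subr0 => H.
  apply: le_trans (H _ _ _) _.
  - by rewrite mulr_ge0 // ltW.
  - by move=> u u1; apply: is_deriveB; [exact: dA | exact: dA'].
  - move=> u; have := mx_entry_le (F (phi u) - F (phi' u)) 0 i; rewrite !mxE => /le_trans; apply.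
    have [_ /(_ u) pr] := gphi; have [_ /(_ u) pr'] := gphi'.
    by apply: le_trans (lipF _ _ pr pr') _; rewrite ler_pM2l.
  - apply: (@le_trans _ _ (K * e * d)).
      by rewrite ler_wpM2l ?mulr_ge0 ?clamp_le // ltW.
    by rewrite mulrAC [e / 2]mulrC -[2^-1]mul1r ler_wpM2r.
pose phi n := iter n T (fun=> x0).
have gphi m : good (phi m).
  elim: m => [|m IH]; last exact: Tgood.
  by split=> t; [exact: cvg_cst | rewrite subrr normr0 ltW].
pose c := C * d.
have c0 : 0 <= c by rewrite mulr_ge0 // ltW.
have step m t : `|phi m.+1 t - phi m t| <= c / 2 ^+ m.
  elim: m t => [|m IH] t.
    rewrite expr0 divr1 -[X in _ - X](T0 _ (gphi 0%N)); apply: le_trans (Tlip _ _ _ (gphi 0%N)) _.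
    by rewrite cl0 subr0 ler_pM2l // clamp_le // ltW.
  rewrite exprSr invfM mulrA.
  apply: (Tcontr _ _ _ (gphi m.+1) (gphi m) _ IH).
  by rewrite divr_ge0 // exprn_ge0.
(* The bound does not depend on [t], so this pointwise limit is uniform and inherits continuity from
   the iterates. *)
have /choice[z Hz] : forall t, exists l : 'rV[R]_n, forall m, `|l - phi m t| <= 2 * c / 2 ^+ m.
  move=> t.
  have /choice[l Hl] : forall i, exists l, forall m, `|l - phi m t 0 i| <= 2 * c / 2 ^+ m.
    move=> i; apply: pow2_cvg => m; apply: le_trans (step m t).
    by have := mx_entry_le (phi m.+1 t - phi m t) 0 i; rewrite !mxE.
  exists (\row_i l i) => m; apply: mx_norm_le.
    by apply: mulr_ge0; [exact: mulr_ge0 | rewrite invr_ge0 exprn_ge0].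
  by move=> j i; rewrite (ord1 j) !mxE.
have gz : good z.
  split=> t.
    apply/cvgrPdist_le => eps eps0.
    have [m Hm] : exists m, 2 * c / 2 ^+ m <= eps / 3.
      apply: contrapT => /forallNP H.
      have : eps / 3 <= 0.
        by apply: (@pow2_inv_small _ (2 * c)) => m; have /negP := H m; rewrite -ltNge => /ltW.
      by rewrite leNgt divr_gt0.
    have [cphi _] := gphi m.
    have H3 : \forall s \near t, `|phi m t - phi m s| <= eps / 3.
      by move/cvgrPdist_le: (cphi t); apply; rewrite divr_gt0.
    apply: filterS H3 => s ts.
    have -> : z t - z s = (z t - phi m t) + (phi m t - phi m s) + (phi m s - z s).
      by rewrite !addrA !subrK.
    apply: le_trans (ler_normD _ _) _; apply: le_trans (lerD (ler_normD _ _) (lexx _)) _.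
    rewrite [`|phi m s - _|]distrC.
    have := le_trans (Hz t m) Hm; have := le_trans (Hz s m) Hm; move: ts; lra.
  have := Hz t 0%N; rewrite expr0 divr1 => /le_trans; apply.
  by rewrite /c.
have fixz t : z t = T z t.
  apply/eqP; rewrite -subr_eq0 -normr_le0; apply: (@pow2_inv_small _ (2 * c)) => m.
  have -> : z t - T z t = (z t - phi m.+1 t) + (T (phi m) t - T z t).
    by rewrite addrA subrK.
  apply: le_trans (ler_normD _ _) _.
  have h1 := Hz t m.+1.
  have h2 : `|T (phi m) t - T z t| <= 2 * c / 2 ^+ m / 2.
    apply: Tcontr => //; first by apply: mulr_ge0; [exact: mulr_ge0 | rewrite invr_ge0 exprn_ge0].
    by move=> u; rewrite distrC.
  apply: le_trans (lerD h1 h2) _; rewrite exprS invfM.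
  by move: (2 ^+ m)^-1 => q; lra.
have dz (t : R) : `|t| < d -> is_derive t 1 z (F (z t)).
  move=> td; apply: is_derive_rV => i.
  have [A0 dA] := HA _ gz.
  have near_t : \forall s \near t, x0 0 i + A z s 0 i = z s 0 i.
    apply: filterS (near_norm_lt td) => s sd; rewrite (fixz s) /T clamp_id ?mxE //; exact: ltW.
  apply: near_eq_is_derive near_t _; rewrite -[F _ _ _]add0r.
  apply: is_deriveD; apply: dA; exact: lt_trans d1.
exists z, d; split=> //; first by rewrite fixz T0.
move=> t td; split; first exact: dz.
have oU : open [set t : R | `|t| < d].
  by rewrite openE => s /= sd; exact: (@near_norm_lt (R : normedModType R) s d sd).
exists [set t : R | `|t| < d]; split=> // k.
have [cz rz] := gz.
(* Bootstrap: the derivative of z is F(z), so z of class C^k makes z' of class C^k. *)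
elim: k => [|k IH]; split=> //; try by move=> s _; exact: cz.
move=> v; have dv s (sd : `|s| < d) := is_derive_scale1 v (dz s sd).
split=> [s sd|]; first by have [] := dv s sd.
apply: (@Ck_congr _ _ _ _ _ (fun s => v *: F (z s))) => //.
  by move=> s sd; have [_ ->] := dv s sd.
apply: Ck_mx => // i j.
apply: (@Ck_congr _ _ _ _ _ (fun s => v * F (z s) i j)) => //.
  by move=> s _; rewrite mxE.
apply: CkM => //; first exact: Ck_cst.
have oB : open (interior [set y | smooth_near F y]) by exact: open_interior.
apply: (@Ck_comp R k _ _ _ (interior [set y | smooth_near F y]) (fun y => F y i j) z) => //.
- exact: fdim_rV.
- move=> s _; exact: (sn_near (sFr _ (rz s))).
- by apply: sn_Ck => y /interior_subset sFy; exact: sn_entry.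
Qed.

End Picard.

(** * Charts, smooth maps and tangent vectors *)

Section SmoothVector.
Variable R : realType.
Implicit Types V W : normedModType R.

(** The chain rule is available for scalar outer functions, so [f] is recombined from its
    coefficients in a spanning family of the target. *)
Lemma sn_compW V W W' (f : W -> W') (g : V -> W) x : fdim W -> fdim W' ->
  smooth_near f (g x) -> smooth_near g x -> smooth_near (fun y => f (g y)) x.
Proof.
move=> fW [m [e [c sp]]] sf sg; have [clin cbnd csum] := sp.
have -> : (fun y => f (g y)) = (fun y => \sum_(k < m) c k (f (g y)) *: e k).
  by apply/funext => y; rewrite -csum.
apply: sn_sum => k _.
have sc : smooth_near (fun w => c k (f w)) (g x).
  have [U [oU Ux Cf]] := sf; exists U; split=> // j.
  apply: (@Ck_linear_comp _ _ _ _ _ _ (c k)) => //; first exact: clin.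
  exact: (spanning_cont sp).
have [U [oU Ux Cf]] := sn_comp fW sc sg; exists U; split=> // j.
apply: (@Ck_linear_comp _ _ _ _ _ _ (fun a : R => a *: e k) (fun y => c k (f (g y)))) => //.
  by move=> a u v; rewrite scalerDl scalerA.
by move=> a; apply: cvgZr_tmp; exact: cvg_id.
Qed.

End SmoothVector.

Section Charted.
Variable R : realType.

(** The local part of [is_manifold]; it puts manifolds, flat spaces, the real line and total spaces
    of bundles on the same footing. *)
Record charted (V : normedModType R) (M : Type) (MA : atlas V M) : Prop := Charted {
  ch_fdim : fdim V;
  ch_cover : forall x, exists i : cidx MA, cdom i x;
  ch_coordK : forall (i : cidx MA) x, cdom i x -> cinv i (ccoord i x) = x;
  ch_near : forall (i : cidx MA) x, cdom i x ->
    \forall z \near ccoord i x, cdom i (cinv i z) /\ ccoord i (cinv i z) = z;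
  ch_trans : forall (i j : cidx MA) x, cdom i x -> cdom j x ->
    (\forall z \near ccoord i x, cdom j (cinv i z)) /\
    smooth_near (fun z => ccoord j (cinv i z)) (ccoord i x) }.

(** The bare set [M] carries no topology, so neighbourhoods are read in the charts at [x]. All
    charts occur here, while [mnear1] shows that a single one suffices for the proof of such a
    property. *)
Definition mnear (V : normedModType R) (M : Type) (MA : atlas V M) (x : M)
    (P : M -> Prop) : Prop :=
  forall i : cidx MA, cdom i x -> \forall z \near ccoord i x, P (cinv i z).

Lemma mopen_near (V : normedModType R) (M : Type) (MA : atlas V M) (O : set M) (i : cidx MA) x :
  (forall (i : cidx MA) x, cdom i x -> cinv i (ccoord i x) = x) ->
  mopen MA O -> O x -> cdom i x ->
  \forall z \near ccoord i x, [/\ O (cinv i z), cdom i (cinv i z) & ccoord i (cinv i z) = z].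
Proof.
move=> cK oO Ox ix; have xO : (ccoord i @` (O `&` cdom i)) (ccoord i x) by exists x.
apply: filterS (open_near (oO i) xO) => _ [y [Oy iy] <-].
by rewrite cK.
Qed.

Lemma manifold_charted n (M : Type) (MA : atlas 'rV[R]_n M) :
  is_manifold MA -> charted MA.
Proof.
move=> mM; split.
- exact: fdim_rV.
- exact: mfd_cover.
- exact: mfd_coordK.
- move=> i x ix.
  by apply: filterS (mopen_near (mfd_coordK mM) (mfd_dom_open mM i) ix ix) => z [].
- move=> i j x ix jx; split; last exact: mfd_transition.
  by apply: filterS (mopen_near (mfd_coordK mM) (mfd_dom_open mM j) jx ix) => z [].
Qed.

Lemma flat_charted (V : normedModType R) : fdim V -> charted (flat_atlas V).
Proof.
move=> fV; split; [exact: fV | by move=> x; exists tt | by [] | |].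
  by move=> i x _; near=> z.
move=> i j x _ _; split; first by near=> z.
exact: sn_id.
Unshelve. all: by end_near. Qed.

Lemma real_charted : charted (real_line R).
Proof. exact/flat_charted/fdim_real. Qed.

Section Near.
Variables (V : normedModType R) (M : Type) (MA : atlas V M).
Hypothesis cM : charted MA.

Lemma mnear1 (i : cidx MA) x (P : M -> Prop) : cdom i x ->
  (\forall z \near ccoord i x, P (cinv i z)) -> mnear MA x P.
Proof.
move=> ix Pi j jx; have [ij sij] := ch_trans cM jx ix.
have := sn_cont sij; rewrite /prop_for /continuous_at (ch_coordK cM jx) => /(_ _ Pi) Pj.
near=> z; rewrite -(@ch_coordK _ _ _ cM i (cinv j z)); last by near: z.
by near: z.
Unshelve. all: by end_near. Qed.

Lemma mnearS x (P Q : M -> Prop) :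
  (forall y, P y -> Q y) -> mnear MA x P -> mnear MA x Q.
Proof. by move=> PQ Px i ix; apply: filterS (Px i ix) => z; exact: PQ. Qed.

Lemma mnearI x (P Q : M -> Prop) :
  mnear MA x P -> mnear MA x Q -> mnear MA x (fun y => P y /\ Q y).
Proof. by move=> Px Qx i ix; apply: near_and; [exact: Px | exact: Qx]. Qed.

Lemma mnear_forall x (I : finType) (P : I -> M -> Prop) :
  (forall i, mnear MA x (P i)) -> mnear MA x (fun y => forall i, P i y).
Proof.
by move=> H i ix; apply: (near_forall (P := fun k z => P k (cinv i z))) => k; exact: H.
Qed.

Lemma mnear_self x (P : M -> Prop) : mnear MA x P -> P x.
Proof.
have [i ix] := ch_cover cM x => /(_ i ix) /nbhs_singleton.
by rewrite (ch_coordK cM ix).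
Qed.

Lemma mnear_dom (i : cidx MA) x : cdom i x -> mnear MA x (fun y => cdom i y).
Proof.
move=> ix; apply: (mnear1 ix).
by apply: filterS (ch_near cM ix) => z [].
Qed.

Lemma mnear_mnear x (P : M -> Prop) : mnear MA x P -> mnear MA x (fun y => mnear MA y P).
Proof.
have [i ix] := ch_cover cM x => /(_ i ix) Pi; apply: (mnear1 ix).
have N := near_and (ch_near cM ix) ((nbhs_interior Pi)).
apply: filterS N => z [[iz zK] Pz].
by apply: (mnear1 iz); rewrite zK.
Qed.

Lemma mopen_mnear (O : set M) x : mopen MA O -> O x -> mnear MA x O.
Proof.
move=> oO Ox i ix.
by apply: filterS (mopen_near (ch_coordK cM) oO Ox ix) => z [].
Qed.

Lemma mnear_mopen (O : set M) : (forall x, O x -> mnear MA x O) -> mopen MA O.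
Proof.
move=> H i; rewrite openE => _ [x [Ox ix] <-].
apply: filterS (near_and (ch_near cM ix) (H x Ox i ix)) => z [[iz zK] Oz].
by exists (cinv i z).
Qed.

Lemma mnear_coord (i : cidx MA) x (P : M -> Prop) : cdom i x ->
  mnear MA x P -> \forall z \near ccoord i x, [/\ cdom i (cinv i z), ccoord i (cinv i z) = z & P (cinv i z)].
Proof.
move=> ix Px; apply: filterS (near_and (ch_near cM ix) (Px i ix)).
by move=> z [[]].
Qed.

End Near.

Section Maps.
Variables (V W : normedModType R) (M N : Type) (MA : atlas V M) (NA : atlas W N).
Hypotheses (cM : charted MA) (cN : charted NA).
Implicit Types F G : M -> N.

(** Any other local expression of [F] is this one composed with transition maps on both sides. *)
Lemma sm1 F x (i : cidx MA) (j : cidx NA) : cdom i x -> cdom j (F x) ->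
  (\forall z \near ccoord i x, cdom j (F (cinv i z))) ->
  smooth_near (fun z => ccoord j (F (cinv i z))) (ccoord i x) ->
  smooth_map_at MA NA F x.
Proof.
move=> ix jx ij sij i' j' ix' jx'.
have Fj : mnear MA x (fun y => cdom j (F y)) := mnear1 cM ix ij.
have [ii' sii'] := ch_trans cM ix' ix.
have [jj' sjj'] := ch_trans cN jx jx'.
have eqx : ccoord i (cinv i' (ccoord i' x)) = ccoord i x by rewrite (ch_coordK cM).
have s1 : smooth_near (fun z => ccoord j (F (cinv i (ccoord i (cinv i' z))))) (ccoord i' x).
  apply: (@sn_compW R _ _ _ (fun z => ccoord j (F (cinv i z))) (fun z => ccoord i (cinv i' z))) => //.
  - exact: ch_fdim cM.
  - exact: ch_fdim cN.
  - by rewrite eqx.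
have s2 : smooth_near (fun z => ccoord j (F (cinv i' z))) (ccoord i' x).
  apply: sn_congr s1; apply: filterS ii' => z iz.
  by rewrite (ch_coordK cM iz).
have e2 : ccoord j (F (cinv i' (ccoord i' x))) = ccoord j (F x) by rewrite (ch_coordK cM).
split.
  have c2 := sn_cont s2; rewrite /prop_for /continuous_at e2 in c2.
  have Fj' := Fj i' ix'; have := c2 _ jj' => jj2.
  apply: filterS (near_and Fj' jj2) => z [jz /=].
  by rewrite (ch_coordK cN jz).
apply: (@sn_congr _ _ _ (fun z => ccoord j' (cinv j (ccoord j (F (cinv i' z)))))).
  by apply: filterS (Fj i' ix') => z jz; rewrite (ch_coordK cN jz).
apply: (@sn_compW R _ _ _ (fun z => ccoord j' (cinv j z)) (fun z => ccoord j (F (cinv i' z)))) => //.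
- exact: ch_fdim cN.
- exact: ch_fdim cN.
- by rewrite e2.
Qed.

Lemma sm_mnear F x (P : N -> Prop) : smooth_map_at MA NA F x ->
  mnear NA (F x) P -> mnear MA x (fun y => P (F y)).
Proof.
move=> sF PF; have [i ix] := ch_cover cM x; have [j jx] := ch_cover cN (F x).
have [Fj sFj] := sF i j ix jx.
apply: (mnear1 cM ix).
have := sn_cont sFj; rewrite /prop_for /continuous_at (ch_coordK cM ix).
move=> /(_ _ (PF j jx)) PFj.
apply: filterS (near_and Fj PFj) => z [jz /=].
by rewrite (ch_coordK cN jz).
Qed.

Lemma sm_congr F G x : mnear MA x (fun y => F y = G y) ->
  smooth_map_at MA NA F x -> smooth_map_at MA NA G x.
Proof.
move=> FG sF i j ix jx; have FGx := mnear_self cM FG.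
rewrite -FGx in jx; have [Fj sFj] := sF i j ix jx; split.
  by apply: filterS (near_and Fj (FG i ix)) => z [? <-].
by apply: sn_congr sFj; apply: filterS (FG i ix) => z ->.
Qed.

Lemma sm_near F x : smooth_map_at MA NA F x ->
  mnear MA x (fun y => smooth_map_at MA NA F y).
Proof.
move=> sF; have [i ix] := ch_cover cM x; have [j jx] := ch_cover cN (F x).
have [Fj sFj] := sF i j ix jx; apply: (mnear1 cM ix).
have N1 := near_and (ch_near cM ix) (near_and (nbhs_interior Fj) (sn_near sFj)).
apply: filterS N1 => z [[iz zK] [Fjz sFz]].
apply: (sm1 iz (j := j)); rewrite ?zK //; exact: nbhs_singleton Fjz.
Qed.

End Maps.

Lemma sm_comp (V W X : normedModType R) (M N Q : Type) (MA : atlas V M)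
    (NA : atlas W N) (QA : atlas X Q) (F : M -> N) (G : N -> Q) x :
  charted MA -> charted NA -> charted QA ->
  smooth_map_at MA NA F x -> smooth_map_at NA QA G (F x) ->
  smooth_map_at MA QA (fun y => G (F y)) x.
Proof.
move=> cM cN cQ sF sG.
have [i ix] := ch_cover cM x; have [j jx] := ch_cover cN (F x).
have [k kx] := ch_cover cQ (G (F x)).
have [Fj sFj] := sF i j ix jx; have [Gk sGk] := sG j k jx kx.
have eF : ccoord j (F (cinv i (ccoord i x))) = ccoord j (F x) by rewrite (ch_coordK cM).
apply: (sm1 cM cQ ix kx).
  have c := sn_cont sFj; rewrite /prop_for /continuous_at eF in c.
  apply: filterS (near_and Fj (c _ Gk)) => z [jz /=].
  by rewrite (ch_coordK cN jz).
apply: (@sn_congr _ _ _ (fun z => ccoord k (G (cinv j (ccoord j (F (cinv i z))))))).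
  by apply: filterS Fj => z jz; rewrite (ch_coordK cN jz).
apply: (@sn_compW R _ _ _ (fun z => ccoord k (G (cinv j z)))) => //.
- exact: ch_fdim cN.
- exact: ch_fdim cQ.
- by rewrite eF.
Qed.

Lemma sm_id (V : normedModType R) (M : Type) (MA : atlas V M) x :
  charted MA -> smooth_map_at MA MA (fun y => y) x.
Proof. by move=> cM i j ix jx; exact: ch_trans. Qed.

Section Functions.
Variables (V : normedModType R) (M : Type) (MA : atlas V M).
Hypothesis cM : charted MA.
Implicit Types f h : M -> R.

Lemma sfE f x (i : cidx MA) : cdom i x -> smooth_fun_at MA f x ->
  smooth_near (fun z => f (cinv i z)) (ccoord i x).
Proof. by move=> ix sf; have [_] := sf i tt ix I. Qed.

Lemma sf1 f x (i : cidx MA) : cdom i x ->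
  smooth_near (fun z => f (cinv i z)) (ccoord i x) -> smooth_fun_at MA f x.
Proof.
move=> ix sf; apply: (sm1 cM real_charted (i := i) (j := tt)) => //.
by near=> z.
Unshelve. all: by end_near. Qed.

Lemma sf_cst (c : R) x : smooth_fun_at MA (fun=> c) x.
Proof.
have [i ix] := ch_cover cM x; apply: (sf1 ix); exact: sn_cst.
Qed.

Lemma sfD f h x : smooth_fun_at MA f x -> smooth_fun_at MA h x ->
  smooth_fun_at MA (fun y => f y + h y) x.
Proof.
move=> sf sh; have [i ix] := ch_cover cM x; apply: (sf1 ix).
by apply: snD; exact: sfE.
Qed.

Lemma sfM f h x : smooth_fun_at MA f x -> smooth_fun_at MA h x ->
  smooth_fun_at MA (fun y => f y * h y) x.
Proof.
move=> sf sh; have [i ix] := ch_cover cM x; apply: (sf1 ix).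
by apply: snM; exact: sfE.
Qed.

Lemma sf_sum (I : Type) (r : seq I) (P : pred I) (f : I -> M -> R) x :
  (forall i, P i -> smooth_fun_at MA (f i) x) ->
  smooth_fun_at MA (fun y => \sum_(i <- r | P i) f i y) x.
Proof.
move=> sf; have [i ix] := ch_cover cM x; apply: (sf1 ix).
by apply: sn_sum => k Pk; apply: sfE => //; exact: sf.
Qed.

Lemma sf_congr f h x : mnear MA x (fun y => f y = h y) ->
  smooth_fun_at MA f x -> smooth_fun_at MA h x.
Proof. by move=> H; apply: sm_congr H. Qed.

Lemma sf_near f x : smooth_fun_at MA f x -> mnear MA x (smooth_fun_at MA f).
Proof. by move=> sf; apply: sm_near sf; [exact: cM|exact: real_charted]. Qed.

End Functions.

Lemma sf_comp (V W : normedModType R) (M N : Type) (MA : atlas V M)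
    (NA : atlas W N) (F : M -> N) (f : N -> R) x :
  charted MA -> charted NA -> smooth_map_at MA NA F x ->
  smooth_fun_at NA f (F x) -> smooth_fun_at MA (fun y => f (F y)) x.
Proof. by move=> cM cN; apply: sm_comp => //; exact: real_charted. Qed.

Lemma sf_realline (f : R -> R) t : smooth_fun_at (real_line R) f t <-> smooth_near f t.
Proof.
split=> [sf|sf]; first exact: (@sfE _ _ (real_line R) f t tt I sf).
exact: (@sf1 _ _ (real_line R) real_charted f t tt I sf).
Qed.

Section Charts.
Variables (n : nat) (M : Type) (MA : atlas 'rV[R]_n M).
Hypothesis cM : charted MA.

Lemma sm_coord (i : cidx MA) x : cdom i x ->
  smooth_map_at MA (flat_atlas 'rV[R]_n) (ccoord i) x.
Proof.
move=> ix; apply: (@sm1 _ _ _ _ MA _ cM (flat_charted (fdim_rV R n)) _ _ i tt) => //=.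
  by near=> z.
apply: (@sn_congr _ _ _ (fun z => z)); last exact: sn_id.
by apply: filterS (ch_near cM ix) => z [].
Unshelve. all: by end_near. Qed.

Lemma sm_inv (i : cidx MA) x : cdom i x ->
  smooth_map_at (flat_atlas 'rV[R]_n) MA (cinv i) (ccoord i x).
Proof.
move=> ix; apply: (@sm1 _ _ _ _ _ MA (flat_charted (fdim_rV R n)) cM _ _ tt i) => //=.
- by rewrite (ch_coordK cM ix).
- by apply: filterS (ch_near cM ix) => z [].
- apply: (@sn_congr _ _ _ (fun z => z)); last exact: sn_id.
  by apply: filterS (ch_near cM ix) => z [].
Qed.

Lemma sf_flat (f : 'rV[R]_n -> R) z :
  smooth_fun_at (flat_atlas 'rV[R]_n) f z <-> smooth_near f z.
Proof.
split=> [sf|sf]; first exact: (@sfE _ _ (flat_atlas 'rV[R]_n) f z tt I sf).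
exact: (@sf1 _ _ (flat_atlas 'rV[R]_n) (flat_charted (fdim_rV R n)) f z tt I sf).
Qed.

Lemma sf_coord (i : cidx MA) x k : cdom i x ->
  smooth_fun_at MA (fun y => ccoord i y 0 k) x.
Proof.
move=> ix; apply: (sf_comp (NA := flat_atlas 'rV[R]_n) (f := fun z : 'rV[R]_n => z 0 k)) => //.
- exact/flat_charted/fdim_rV.
- exact: sm_coord.
- by apply/sf_flat; apply: sn_entry; exact: sn_id.
Qed.

Definition tvec_of (i : cidx MA) (x : M) (v : 'rV[R]_n) : tvec R M :=
  fun f => 'D_v (fun z => f (cinv i z)) (ccoord i x).

Definition tcoords (i : cidx MA) (Z : tvec R M) : 'rV[R]_n :=
  \row_k Z (fun y => ccoord i y 0 k).

Lemma velocityE (c : R -> M) t (i : cidx MA) (f : M -> R) :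
  smooth_map_at (real_line R) MA c t -> cdom i (c t) -> smooth_fun_at MA f (c t) ->
  velocity c t f = tvec_of i (c t) ('D_1 (fun s : R => ccoord i (c s)) t) f.
Proof.
move=> sc ic sf; have [ci sci] := sc tt i I ic.
rewrite /velocity derive1E /tvec_of.
rewrite (@near_eq_derive _ _ _ _ (fun s : R => f (cinv i (ccoord i (c s))))); last first.
  by apply: filterS ci => s ics /=; rewrite (ch_coordK cM ics).
apply: (@sn_derive_comp R _ _ (fun z => f (cinv i z)) (fun s : R => ccoord i (c s))) => //.
- exact: ch_fdim cM.
- exact: sfE.
Qed.

(** Replaces a tangent vector, given by an unspecified curve, by a directional derivative in a
    chart. The sum and product rules for tangent vectors follow from it. *)
Lemma tangentE x (Z : tvec R M) (i : cidx MA) : is_tangent MA x Z -> cdom i x ->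
  teq MA x Z (tvec_of i x (tcoords i Z)).
Proof.
move=> [c [sc <- Zc]] ix f sf; rewrite Zc //.
rewrite (velocityE sc ix sf).
suff -> : tcoords i Z = 'D_1 (fun s : R => ccoord i (c s)) 0 by [].
apply/rowP => k; rewrite mxE Zc; last exact: sf_coord.
rewrite sn_derive_mx /velocity ?derive1E //.
by have [] := sc tt i I ix.
Qed.

Lemma tvec_of_lin (i : cidx MA) x f a u v : cdom i x -> smooth_fun_at MA f x ->
  tvec_of i x (a *: u + v) f = a * tvec_of i x u f + tvec_of i x v f.
Proof.
move=> ix sf; apply: sn_derive_lin; [exact: fdim_rV | exact: sfE].
Qed.

Lemma tvec_of_coord (i : cidx MA) x v : cdom i x -> tcoords i (tvec_of i x v) = v.
Proof.
move=> ix; apply/rowP => k; rewrite mxE /tvec_of.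
rewrite (@near_eq_derive _ _ _ _ (fun z : 'rV[R]_n => z 0 k)); last first.
  by apply: filterS (ch_near cM ix) => z [_ ->].
have := @sn_derive_mx R _ _ _ id (ccoord i x) v 0 k (sn_id _).
by rewrite derive_id => ->.
Qed.

Lemma tangent_of (i : cidx MA) x v : cdom i x -> is_tangent MA x (tvec_of i x v).
Proof.
move=> ix; pose c (t : R) := cinv i (t *: v + ccoord i x).
have sl : smooth_near (fun t : R => t *: v + ccoord i x) 0.
  apply: snD; last exact: sn_cst.
  apply: sn_mx => j k; under eq_fun do rewrite mxE.
  by apply: snM; [exact: sn_id | exact: sn_cst].
have e0 : (0 : R) *: v + ccoord i x = ccoord i x by rewrite scale0r add0r.
have c0 : c 0 = x by rewrite /c e0 (ch_coordK cM ix).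
have sc : smooth_map_at (real_line R) MA c 0.
  apply: (sm_comp (NA := flat_atlas 'rV[R]_n) (G := cinv i) (F := fun t : R => t *: v + ccoord i x)) => //.
  - exact: real_charted.
  - exact/flat_charted/fdim_rV.
  - apply: (@sm1 _ _ _ _ _ _ real_charted (flat_charted (fdim_rV R n)) _ _ tt tt) => //=.
    by near=> z.
  - by rewrite e0; exact: sm_inv.
exists c; split=> // f sf.
have ic : cdom i (c 0) by rewrite c0.
rewrite (velocityE sc ic) ?c0 //.
suff -> : 'D_1 (fun s : R => ccoord i (c s)) 0 = v by [].
have near0 : \forall s \near (0 : R), ccoord i (c s) = s *: v + ccoord i x.
  have H := ch_near cM ix; rewrite -e0 in H.
  by apply: (@filterS R (nbhs (0 : R)) _ _ _ _ (sn_cont sl H)) => s [].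
rewrite (near_eq_derive _ near0).
apply/rowP => k; rewrite sn_derive_mx //.
under eq_fun do rewrite !mxE.
have := @is_deriveD R _ _ (fun s : R => s * v 0 k) (fun=> ccoord i x 0 k) 0 1 (v 0 k) 0.
rewrite addr0 => H; have [] := H _ _ => //.
  have := @is_deriveM R _ (fun s : R => s) (fun=> v 0 k) 0 1 1 0 (is_derive_id _ _) (is_derive_cst _ _ _).
  by rewrite scaler0 add0r [_ *: 1]mulr1.
Unshelve. all: by end_near. Qed.

(** Locality of tangent vectors. Smoothness of one function, hence of both, is what allows passing
    to the chart, where the two local expressions agree near the point. *)
Lemma tangent_congr x (Z : tvec R M) f h : is_tangent MA x Z ->
  smooth_fun_at MA f x -> mnear MA x (fun y => f y = h y) -> Z f = Z h.
Proof.
move=> tZ sf fh; have [i ix] := ch_cover cM x.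
rewrite (tangentE tZ ix sf) (tangentE tZ ix (sf_congr cM fh sf)).
exact/near_eq_derive/fh.
Qed.

Lemma tangentD x (Z : tvec R M) f h : is_tangent MA x Z ->
  smooth_fun_at MA f x -> smooth_fun_at MA h x ->
  Z (fun y => f y + h y) = Z f + Z h.
Proof.
move=> tZ sf sh; have [i ix] := ch_cover cM x.
rewrite !(tangentE tZ ix) //; last exact: sfD.
by rewrite /tvec_of [LHS]deriveD //; apply: sn_derivable; exact: sfE.
Qed.

Lemma tangentM x (Z : tvec R M) f h : is_tangent MA x Z ->
  smooth_fun_at MA f x -> smooth_fun_at MA h x ->
  Z (fun y => f y * h y) = f x * Z h + h x * Z f.
Proof.
move=> tZ sf sh; have [i ix] := ch_cover cM x.
rewrite !(tangentE tZ ix) //; last exact: sfM.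
rewrite /tvec_of [LHS]deriveM; [|by apply: sn_derivable; exact: sfE..].
by rewrite (ch_coordK cM ix).
Qed.

Lemma tangent_cst x (Z : tvec R M) c : is_tangent MA x Z -> Z (fun=> c) = 0.
Proof.
move=> tZ; have [i ix] := ch_cover cM x.
rewrite (tangentE tZ ix); last exact: sf_cst.
exact: derive_cst.
Qed.

Lemma tangent_sum x (Z : tvec R M) (I : Type) (r : seq I) (P : pred I) (f : I -> M -> R) :
  is_tangent MA x Z -> (forall i, P i -> smooth_fun_at MA (f i) x) ->
  Z (fun y => \sum_(i <- r | P i) f i y) = \sum_(i <- r | P i) Z (f i).
Proof.
move=> tZ sf; elim: r => [|i r IH].
  under eq_fun do rewrite big_nil.
  by rewrite big_nil (tangent_cst _ tZ).
rewrite big_cons; have [Pi|/negbTE Pi] := boolP (P i).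
  have -> : (fun y => \sum_(j <- i :: r | P j) f j y) =
     (fun y => f i y + \sum_(j <- r | P j) f j y).
    by apply/funext => y; rewrite big_cons Pi.
  by rewrite (tangentD tZ) ?IH //; [exact: sf | exact: sf_sum].
have -> : (fun y => \sum_(j <- i :: r | P j) f j y) = (fun y => \sum_(j <- r | P j) f j y).
  by apply/funext => y; rewrite big_cons Pi.
exact: IH.
Qed.

End Charts.

Lemma push_tangent n p (M N : Type) (MA : atlas 'rV[R]_n M) (NA : atlas 'rV[R]_p N)
    (F : M -> N) x (Z : tvec R M) :
  charted MA -> charted NA -> smooth_map_at MA NA F x ->
  is_tangent MA x Z -> is_tangent NA (F x) (push F Z).
Proof.
move=> cM cN sF [c [sc cx Zc]]; exists (fun t => F (c t)); split.
- apply: (sm_comp real_charted cM cN sc); by rewrite cx.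
- by rewrite cx.
- move=> f sf; rewrite /push Zc //.
  by rewrite /comp; apply: (sf_comp cM cN sF).
Qed.

End Charted.

(** * Vector bundles and extension of sections *)

Section Blocks.
Variable R : realType.
Implicit Types V : normedModType R.

Lemma sn_lsubmx V n1 n2 (f : V -> 'rV[R]_(n1 + n2)) x :
  smooth_near f x -> smooth_near (fun y => lsubmx (f y)) x.
Proof. by move=> sf; apply: sn_mx => i j; under eq_fun do rewrite mxE; exact: sn_entry. Qed.

Lemma sn_row_mx V n1 n2 (f : V -> 'rV[R]_n1) (g : V -> 'rV[R]_n2) x :
  smooth_near f x -> smooth_near g x -> smooth_near (fun y => row_mx (f y) (g y)) x.
Proof.
move=> sf sg; apply: sn_mx => i j; rewrite -(splitK j).
case: (fintype.split j) => k /=.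
  by under eq_fun do rewrite row_mxEl; exact: sn_entry.
by under eq_fun do rewrite row_mxEr; exact: sn_entry.
Qed.

Lemma near_lsubmx n1 n2 (z : 'rV[R]_(n1 + n2)) (P : 'rV[R]_n1 -> Prop) :
  (\forall y \near lsubmx z, P y) -> \forall y \near z, P (lsubmx y).
Proof. exact: (sn_cont (sn_lsubmx (sn_id z))). Qed.

End Blocks.

Section BundleTheory.
Variables (R : realType) (n r : nat) (M : Type) (MA : atlas 'rV[R]_n M).
Variables (A : M -> lmodType R) (tA : trivs A r).
Hypotheses (cM : charted MA) (bA : is_bundle MA tA).
Local Notation tot := (total_atlas MA tA).
Implicit Type k : tidx tA.

Lemma tcoord0 k x : tdom k x -> tcoord k (0 : A x) = 0.
Proof.
move=> kx; have := bdl_lin bA kx (-1) 0 0.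
by rewrite !scaleN1r addNr => ->; rewrite addNr.
Qed.

Lemma tcoordD k x (u v : A x) : tdom k x -> tcoord k (u + v) = tcoord k u + tcoord k v.
Proof. by move=> kx; have := bdl_lin bA kx 1 u v; rewrite !scale1r. Qed.

Lemma tcoordZ k x c (u : A x) : tdom k x -> tcoord k (c *: u) = c *: tcoord k u.
Proof. by move=> kx; have := bdl_lin bA kx c u 0; rewrite !addr0 tcoord0 // addr0. Qed.

Lemma tcoordB k x (u v : A x) : tdom k x -> tcoord k (u - v) = tcoord k u - tcoord k v.
Proof. by move=> kx; rewrite tcoordD // -scaleN1r tcoordZ // scaleN1r. Qed.

Lemma tcoord_sum k x (I : Type) (s : seq I) (P : pred I) (F : I -> A x) : tdom k x ->
  tcoord k (\sum_(i <- s | P i) F i) = \sum_(i <- s | P i) tcoord k (F i).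
Proof.
move=> kx; apply: (big_morph (fun u : A x => tcoord k u)); last exact: tcoord0.
by move=> u v; exact: tcoordD.
Qed.

Lemma tcoord_inj k x (u v : A x) : tdom k x -> tcoord k u = tcoord k v -> u = v.
Proof. by move=> kx /(congr1 (tfib k x)); rewrite !(bdl_coordK bA kx). Qed.

Lemma tfibE k x w : tdom k x -> tfib k x w = \sum_j w 0 j *: tfib k x (delta_mx 0 j).
Proof.
move=> kx; apply: (tcoord_inj kx); rewrite (bdl_fibK bA kx) tcoord_sum //.
rewrite {1}(row_sum_delta w); apply: eq_bigr => j _.
by rewrite tcoordZ // (bdl_fibK bA kx).
Qed.

Lemma fib_expand k x (u : A x) : tdom k x ->
  u = \sum_j tcoord k u 0 j *: tfib k x (delta_mx 0 j).
Proof. by move=> kx; rewrite -tfibE // (bdl_coordK bA kx). Qed.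

Lemma fib_basis k x : tdom k x ->
  is_basis [set: A x] (fun j => tfib k x (delta_mx 0 j)).
Proof.
move=> kx; split=> //.
- by move=> v _; exists (fun j => tcoord k v 0 j); exact: fib_expand.
- move=> p Hp j; pose w := \row_j p j : 'rV[R]_r.
  have : tfib k x w = 0.
    by rewrite tfibE // -[RHS]Hp; apply: eq_bigr => i _; rewrite mxE.
  move/(congr1 (@tcoord _ _ _ _ tA k x)); rewrite (bdl_fibK bA kx) tcoord0 //.
  by move/rowP/(_ j); rewrite !mxE.
Qed.

Lemma tdom_near k x : tdom k x -> mnear MA x (fun y => tdom k y).
Proof. by move=> kx; apply: (mopen_mnear cM) => //; exact: bdl_open bA k. Qed.

Lemma sf_transition k k' x w j : tdom k x -> tdom k' x ->
  smooth_fun_at MA (fun y => tcoord k' (tfib k y w) 0 j) x.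
Proof.
move=> kx k'x.
have H : smooth_fun_at (flat_atlas 'rV[R]_r) (fun z : 'rV[R]_r => z 0 j) (tcoord k' (tfib k x w)).
  by apply/sf_flat; apply: sn_entry; exact: sn_id.
have E := @sf_comp R _ _ _ _ MA (flat_atlas 'rV[R]_r) (fun y => tcoord k' (tfib k y w))
  (fun z : 'rV[R]_r => z 0 j) x cM (flat_charted (fdim_rV R r)) (@bdl_transition _ _ _ _ _ _ _ bA k k' x kx k'x w) H.
exact: E.
Qed.

Lemma elt_tfib k x y w : x = y -> elt (tfib k x w) = elt (tfib k y w) :> totspace A.
Proof. by move=> ->. Qed.

Lemma elt_fib (a : totspace A) : elt (fib_elt a) = a.
Proof. by case: a. Qed.

Lemma tot_charted : charted tot.
Proof.
split.
- exact: fdim_rV.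
- move=> a; have [i ia] := ch_cover cM (bproj a); have [k ka] := bdl_cover bA (bproj a).
  by exists (i, k).
- move=> [i k] a /= [ia ka]; rewrite row_mxKl row_mxKr.
  rewrite (elt_tfib k _ (ch_coordK cM ia)) (bdl_coordK bA ka); exact: elt_fib.
- move=> [i k] a /= [ia ka].
  have H := mnear_coord cM ia (tdom_near ka).
  rewrite -(row_mxKl (ccoord i (bproj a)) (tcoord k (fib_elt a))) in H.
  apply: filterS (near_lsubmx H) => z [iz zK kz].
  by split=> //; rewrite /fib_elt /= zK (bdl_fibK bA kz) hsubmxK.
- move=> [i k] [i' k'] a /= [ia ka] [i'a k'a].
  have H : mnear MA (bproj a) (fun y => [/\ tdom k y, cdom i' y & tdom k' y]).
    apply: mnearS (mnearI (tdom_near ka) (mnearI (mnear_dom cM i'a) (tdom_near k'a))).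
    by move=> y [? []].
  have H1 := near_lsubmx (eq_ind_r (fun z => \forall y \near z, _) (mnear_coord cM ia H)
    (row_mxKl (ccoord i (bproj a)) (tcoord k (fib_elt a)))).
  split; first by apply: filterS H1 => z [_ _ [? ? ?]].
  apply: sn_row_mx.
    apply: (@sn_compW R _ _ _ (fun z => ccoord i' (cinv i z)) (fun z => lsubmx z)).
    + exact: fdim_rV.
    + exact: fdim_rV.
    + by rewrite row_mxKl; have [] := ch_trans cM ia i'a.
    + exact/sn_lsubmx/sn_id.
  (* [bdl_transition] gives smoothness in the base point for each fixed [w]; linearity along the
     fibre reduces joint smoothness to the standard basis vectors. *)
  apply: (@sn_congr _ _ _ (fun z => \sum_j (rsubmx z) 0 j *:
     (tcoord k' (tfib k (cinv i (lsubmx z)) (delta_mx 0 j))))).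
    apply: filterS H1 => z [iz zK [kz i'z k'z]].
    rewrite /fib_elt /= [in RHS]tfibE // tcoord_sum //.
    by apply: eq_bigr => j _; rewrite tcoordZ.
  apply: sn_sum => j _; apply: sn_mx => l m; under eq_fun do rewrite !mxE.
  apply: snM; first by apply: sn_entry; exact: sn_id.
  apply: (@sn_comp R _ _ (fun z => tcoord k' (tfib k (cinv i z) (delta_mx 0 j)) l m) (fun z => lsubmx z)).
  + exact: fdim_rV.
  + rewrite row_mxKl (ord1 l); apply: (sfE (f := fun y => tcoord k' (tfib k y (delta_mx 0 j)) 0 m)) => //.
    exact: sf_transition.
  + exact/sn_lsubmx/sn_id.
Qed.

Lemma sm_bproj a : smooth_map_at tot MA (@bproj R M A) a.
Proof.
have [i ia] := ch_cover cM (bproj a); have [k ka] := bdl_cover bA (bproj a).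
apply: (@sm1 _ _ _ _ _ tot MA tot_charted cM _ _ (i, k) i) => //=.
  have H := mnear_dom cM ia ia.
  by apply: (near_lsubmx (P := fun z => cdom i (cinv i z))); rewrite row_mxKl.
apply: (@sn_compW R _ _ _ (fun z => ccoord i (cinv i z)) (fun z => lsubmx z)).
- exact: fdim_rV.
- exact: fdim_rV.
- by rewrite row_mxKl; have [] := ch_trans cM ia ia.
- exact/sn_lsubmx/sn_id.
Qed.

Lemma sf_fib k a j : tdom k (bproj a) ->
  smooth_fun_at tot (fun b => tcoord k (fib_elt b) 0 j) a.
Proof.
move=> ka; have [i ia] := ch_cover cM (bproj a).
have dom : @cdom _ _ _ tot (i, k) a by [].
have := @sf_coord R _ _ tot tot_charted (i, k) a (rshift n j) dom => /=.
by under eq_fun do rewrite row_mxEr.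
Qed.

Lemma sm_tot (V : normedModType R) (N : Type) (NA : atlas V N) (F : N -> totspace A) x k :
  charted NA -> smooth_map_at NA MA (fun y => bproj (F y)) x -> tdom k (bproj (F x)) ->
  (forall j, smooth_fun_at NA (fun y => tcoord k (fib_elt (F y)) 0 j) x) ->
  smooth_map_at NA tot F x.
Proof.
move=> cN sB kx sj; have [i ix] := ch_cover cM (bproj (F x)).
have [m mx] := ch_cover cN x.
apply: (@sm1 _ _ _ _ _ NA tot cN tot_charted _ _ m (i, k)) => //=.
  have H := sm_mnear cN cM sB (mnearI (mnear_dom cM ix) (tdom_near kx)).
  exact: H.
apply: sn_row_mx; first by have [] := sB m i mx ix.
apply: sn_mx => l j; rewrite (ord1 l).
exact: (sfE (f := fun y => tcoord k (fib_elt (F y)) 0 j)).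
Qed.

Lemma sect_coord (s : forall x, A x) k x j :
  smooth_map_at MA tot (fun y => elt (s y)) x -> tdom k x ->
  smooth_fun_at MA (fun y => tcoord k (s y) 0 j) x.
Proof.
move=> ss kx.
have H : smooth_fun_at tot (fun b => tcoord k (fib_elt b) 0 j) (elt (s x)) by exact: sf_fib.
exact: (@sf_comp R _ _ _ _ MA tot (fun y => elt (s y)) (fun b => tcoord k (fib_elt b) 0 j)
  x cM tot_charted ss H).
Qed.

Lemma sect1 (s : forall x, A x) k x : tdom k x ->
  (forall j, smooth_fun_at MA (fun y => tcoord k (s y) 0 j) x) ->
  smooth_map_at MA tot (fun y => elt (s y)) x.
Proof.
by move=> kx sj; apply: (sm_tot (k := k) cM) => //; exact: sm_id.
Qed.

Lemma sect_congr (s t : forall x, A x) x : mnear MA x (fun y => s y = t y) ->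
  smooth_map_at MA tot (fun y => elt (s y)) x -> smooth_map_at MA tot (fun y => elt (t y)) x.
Proof.
move=> st; apply: (sm_congr cM); apply: mnearS st => y; by move=> ->.
Qed.

Lemma sect_scale (f : M -> R) (s : forall x, A x) x : smooth_fun_at MA f x ->
  smooth_map_at MA tot (fun y => elt (s y)) x ->
  smooth_map_at MA tot (fun y => elt (f y *: s y)) x.
Proof.
move=> sf ss; have [k kx] := bdl_cover bA x; apply: (sect1 kx) => j.
apply: (sf_congr cM (f := fun y => f y * tcoord k (s y) 0 j)).
  by apply: mnearS (tdom_near kx) => y ky; rewrite tcoordZ // mxE.
by apply: sfM => //; exact: sect_coord.
Qed.

Lemma sect_add (s t : forall x, A x) x :
  smooth_map_at MA tot (fun y => elt (s y)) x ->
  smooth_map_at MA tot (fun y => elt (t y)) x ->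
  smooth_map_at MA tot (fun y => elt (s y + t y)) x.
Proof.
move=> ss st; have [k kx] := bdl_cover bA x; apply: (sect1 kx) => j.
apply: (sf_congr cM (f := fun y => tcoord k (s y) 0 j + tcoord k (t y) 0 j)).
  by apply: mnearS (tdom_near kx) => y ky; rewrite tcoordD // mxE.
by apply: sfD => //; exact: sect_coord.
Qed.

Lemma sect0 x : smooth_map_at MA tot (fun y => elt (0 : A y)) x.
Proof.
have [k kx] := bdl_cover bA x; apply: (sect1 kx) => j.
apply: (sf_congr cM (f := fun y => 0)); last exact: sf_cst.
by apply: mnearS (tdom_near kx) => y ky; rewrite tcoord0 // mxE.
Qed.

Lemma sect_sum (I : Type) (l : seq I) (P : pred I) (s : I -> forall x, A x) x :
  (forall i, P i -> smooth_map_at MA tot (fun y => elt (s i y)) x) ->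
  smooth_map_at MA tot (fun y => elt (\sum_(i <- l | P i) s i y)) x.
Proof.
move=> ss; elim: l => [|i l IH].
  by under eq_fun do rewrite big_nil; exact: sect0.
have [Pi|/negbTE Pi] := boolP (P i); under eq_fun do rewrite big_cons Pi //.
  exact: (@sect_add (s i) (fun y => \sum_(j <- l | P j) s j y) x (ss i Pi) IH).
exact: IH.
Qed.

Lemma sect_fib k x w : tdom k x ->
  smooth_map_at MA tot (fun y => elt (tfib k y w)) x.
Proof.
move=> kx; apply: (sect1 kx) => j; exact: sf_transition.
Qed.

End BundleTheory.

(** * Cut-off functions on a manifold and extension of local sections *)

Section Extension.
Variables (R : realType) (n : nat) (M : Type) (MA : atlas 'rV[R]_n M).
Hypothesis mM : is_manifold MA.
Let cM := manifold_charted mM.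

Lemma box_compact (z0 : 'rV[R]_n) (r : R) :
  compact [set v : 'rV[R]_n | forall i, v ord0 i \in `[z0 ord0 i - r, z0 ord0 i + r]].
Proof.
apply: (@rV_compact _ _ (fun i => `[z0 ord0 i - r, z0 ord0 i + r]%classic)).
by move=> i; exact: segment_compact.
Qed.

(** The image of a compact set of coordinates is closed: each of its points is separated from [y] by
    the Hausdorff axiom, and compactness yields one neighbourhood of [y] that misses all of them. *)
Lemma compact_chart_closed (i : cidx MA) (B : set 'rV[R]_n) y :
  compact B -> (forall z, B z -> cdom i (cinv i z) /\ ccoord i (cinv i z) = z) ->
  (forall z, B z -> cinv i z <> y) -> mnear MA y (fun y' => forall z, B z -> cinv i z <> y').
Proof.
move=> /compact_near_coveringP cB Bi By j jy.
apply: (cB _ (nbhs (ccoord j y)) (fun z' z => cinv i z <> cinv j z')) => z Bz.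
have [iz zK] := Bi z Bz.
have [P [Q [oP oQ Pz Qy PQ]]] := mfd_hausdorff mM (By z Bz).
have N1 := mopen_mnear cM oP Pz iz; rewrite zK in N1.
have N2 := mopen_mnear cM oQ Qy jy.
exists ([set z | P (cinv i z)], [set z | Q (cinv j z)]); first by split.
move=> [z1 z2] /= [Pz1 Qz2] E.
have : (P `&` Q) (cinv i z1) by split=> //; rewrite E.
by rewrite PQ.
Qed.

(** The last conclusion is the form used for extension by zero: at every point either the local
    object is at hand, or its product with [chi] vanishes nearby. *)
Lemma bump_ex x (O : M -> Prop) : mnear MA x O ->
  exists chi : M -> R, [/\ forall y, smooth_fun_at MA chi y,
    mnear MA x (fun y => chi y = 1) &
    forall y, O y \/ mnear MA y (fun y' => chi y' = 0)].
Proof.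
move=> Ox; have [i ix] := ch_cover cM x.
have /nbhs_normP[r' /= r'0 Hr'] := mnear_coord cM ix Ox.
set z0 := ccoord i x in Hr'.
(* The support has radius at most r < r', so the closed box [B] around it still lies in the good
   part of the chart. *)
pose r := r' / 2; have r0 : 0 < r by rewrite divr_gt0.
have rr' : r < r' by rewrite ltr_pdivrMr // ltr_pMr // ltr1n.
have [chi [schi chi1 chi0]] := bump_rV z0 r0.
pose f y := if `[< cdom i y >] then chi (ccoord i y) else 0.
have fi y : cdom i y -> f y = chi (ccoord i y) by move=> iy; rewrite /f asboolT.
pose B := [set v : 'rV[R]_n | forall k, v ord0 k \in `[z0 ord0 k - r, z0 ord0 k + r]].
have Br v : B v -> `|z0 - v| < r'.
  move=> Bv; apply: le_lt_trans rr'; apply: mx_norm_le; first exact: ltW.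
  move=> a b; rewrite (ord1 a) !mxE; have := Bv b; rewrite in_itv /= => /andP[b1 b2].
  by rewrite ler_norml; apply/andP; split; lra.
have fnear y : cdom i y -> mnear MA y (fun y' => chi (ccoord i y') = f y').
  by move=> iy; apply: mnearS (mnear_dom cM iy) => y' iy'; rewrite fi.
have schic y : cdom i y -> smooth_fun_at MA f y.
  move=> iy; apply: (sf_congr cM (fnear y iy)).
  apply: (sf_comp (NA := flat_atlas 'rV[R]_n) cM (flat_charted (fdim_rV R n))).
    exact: sm_coord.
  exact/sf_flat/schi.
(* Off the good part of the chart, [y] is not in the closed image of [B], so a whole neighbourhood
   of [y] misses that image and [f] vanishes there. *)
have alt y : (cdom i y /\ O y) \/ mnear MA y (fun y' => f y' = 0).
  have [[iy yr]|ny] := pselect (cdom i y /\ `|z0 - ccoord i y| < r').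
    by left; split=> //; have [_ _] := Hr' _ yr; rewrite (ch_coordK cM iy).
  right.
  have H : mnear MA y (fun y' => forall z, B z -> cinv i z <> y').
    apply: compact_chart_closed; first exact: box_compact.
      by move=> z /Br /Hr' [].
    move=> z Bz E; apply: ny; have [iz zK _] := Hr' _ (Br _ Bz).
    by rewrite -E zK; split=> //; exact: Br.
  apply: mnearS H => y' Hy'; rewrite /f; case: asboolP => // iy'.
  apply/eqP; apply: contrapT => /negP /chi0 cr.
  apply: (Hy' (ccoord i y')); last by rewrite (ch_coordK cM iy').
  move=> k; have := mx_entry_le (ccoord i y' - z0) 0 k; rewrite !mxE => /le_lt_trans /(_ cr).
  by rewrite ltr_norml in_itv /= => /andP[k1 k2]; apply/andP; split; lra.
exists f; split.
- move=> y; have [[iy _]|f0] := alt y; first exact: schic.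
  apply: (sf_congr cM (f := fun=> 0)); last exact: sf_cst.
  by apply: mnearS f0 => y' ->.
- apply: (mnear1 cM ix); have r20 : 0 < r / 2 by rewrite divr_gt0.
  apply: filterS (near_and (ch_near cM ix) (near_dist (ccoord i x) r20)) => z [[iz zK] zr].
  by rewrite fi // zK chi1 // distrC ltW.
- by move=> y; have [[_ Oy]|f0] := alt y; [left|right].
Qed.

Lemma ext_fun (f : M -> R) x : smooth_fun_at MA f x ->
  exists h : M -> R, (forall y, smooth_fun_at MA h y) /\ mnear MA x (fun y => h y = f y).
Proof.
move=> sf; have [chi [schi chi1 chi0]] := bump_ex (sf_near cM sf).
exists (fun y => chi y * f y); split; last first.
  by apply: mnearS chi1 => y ->; rewrite mul1r.
move=> y; have [sfy|c0] := chi0 y; first exact: sfM.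
apply: (sf_congr cM (f := fun=> 0)); last exact: sf_cst.
by apply: mnearS c0 => y' ->; rewrite mul0r.
Qed.

Variables (r : nat) (A : M -> lmodType R) (tA : trivs A r).
Hypothesis bA : is_bundle MA tA.

Lemma ext_sect (s : forall x, A x) x :
  smooth_map_at MA (total_atlas MA tA) (fun y => elt (s y)) x ->
  exists t : forall x, A x, smooth_section MA tA t /\ mnear MA x (fun y => t y = s y).
Proof.
move=> ss; have [chi [schi chi1 chi0]] := bump_ex (sm_near cM (tot_charted cM bA) ss).
exists (fun y => chi y *: s y); split; last first.
  by apply: mnearS chi1 => y ->; rewrite scale1r.
move=> y; have [sfy|c0] := chi0 y; first exact: (sect_scale cM bA (schi y) sfy).
apply: (sect_congr cM (s := fun y => 0)); last exact: (sect0 cM bA).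
by apply: mnearS c0 => y' ->; rewrite scale0r.
Qed.

(** Provides global sections, to which the bracket and [D] apply, that coincide near [x] with the
    frame of the trivialisation. *)
Lemma ext_frame (k : tidx tA) x : tdom k x ->
  exists e : 'I_r -> forall x, A x, (forall j, smooth_section MA tA (e j)) /\
    mnear MA x (fun y => tdom k y /\ forall j, e j y = tfib k y (delta_mx 0 j)).
Proof.
move=> kx.
have /choice[e He] : forall j : 'I_r, exists t : forall x, A x,
   smooth_section MA tA t /\ mnear MA x (fun y => t y = tfib k y (delta_mx 0 j)).
  by move=> j; apply: ext_sect; exact: (sect_fib cM bA).
exists e; split; first by move=> j; have [] := He j.
apply: mnearI; first exact: (tdom_near cM bA).
by apply: mnear_forall => j; have [] := He j.
Qed.

End Extension.

(** * The bracket in a local frame *)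

Section BracketCalculus.
Variables (R : realType) (n r : nat) (M : manifold R n) (A : vbundle M r).
Variables (LA : lie_algebroid A) (g : riem_metric A).
Notation sect := (forall x : M, A x).
Notation smooth_sect := (smooth_section (matlas M) (btrivs A)).
Notation totA := (total_atlas (matlas M) (btrivs A)).
Notation sfun := (smooth_fun_at (matlas M)).
Let cM := manifold_charted (mfdP M).
Let bA := bundleP A.
Let cA := tot_charted cM bA.

Lemma smooth_lincomb k (a b : sect) : smooth_sect a -> smooth_sect b ->
  smooth_sect (fun y => k *: a y + b y).
Proof.
move=> sa sb x; apply: (sect_add cM bA _ (sb x)).
by apply: (sect_scale cM bA _ (sa x)); exact: sf_cst.
Qed.

Lemma smooth_scale (f : M -> R) (a : sect) : (forall x, sfun f x) -> smooth_sect a ->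
  smooth_sect (fun y => f y *: a y).
Proof. by move=> sf sa x; exact: (sect_scale cM bA (sf x) (sa x)). Qed.

Lemma smooth_sum (I : Type) (l : seq I) (s : I -> sect) :
  (forall i, smooth_sect (s i)) -> smooth_sect (fun y => \sum_(i <- l) s i y).
Proof.
by move=> ss x; apply: (@sect_sum _ _ _ _ _ _ _ cM bA I l xpredT s x) => i _; exact: ss.
Qed.

Lemma smooth0 : smooth_sect (fun y => 0).
Proof. by move=> x; exact: (sect0 cM bA). Qed.

Lemma anchor_lin x k (u v : A x) f : sfun f x ->
  anchor LA (k *: u + v) f = k * anchor LA u f + anchor LA v f.
Proof. by move=> sf; exact: (anchor_linear LA k u v). Qed.

Lemma anchor0 x f : sfun f x -> anchor LA (0 : A x) f = 0.
Proof.
by move=> sf; have := anchor_lin (-1) (0 : A x) 0 sf; rewrite scaler0 addr0 mulN1r addNr.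
Qed.

Lemma anchor_sum x (I : Type) (l : seq I) (p : I -> R) (u : I -> A x) f : sfun f x ->
  anchor LA (\sum_(i <- l) p i *: u i) f = \sum_(i <- l) p i * anchor LA (u i) f.
Proof.
move=> sf; elim: l => [|i l IH]; first by rewrite !big_nil anchor0.
by rewrite !big_cons anchor_lin // IH.
Qed.

Lemma anchor_tan x (u : A x) : is_tangent (matlas M) x (anchor LA u).
Proof. exact: anchor_tangent. Qed.

Lemma bracket_sum (I : Type) (l : seq I) (p : I -> R) (s : I -> sect) (c : sect) x :
  (forall i, smooth_sect (s i)) -> smooth_sect c ->
  bracket LA (fun y => \sum_(i <- l) p i *: s i y) c x =
  \sum_(i <- l) p i *: bracket LA (s i) c x.
Proof.
move=> ss sc.
have sl l' : smooth_sect (fun y => \sum_(i <- l') p i *: s i y).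
  by apply: smooth_sum => i; apply: smooth_scale => // x'; exact: sf_cst.
elim: l => [|i l IH].
  rewrite big_nil.
  have -> : (fun y => \sum_(i <- [::]) p i *: s i y) = (fun y : M => -1 *: (0 : A y) + 0).
    by apply: functional_extensionality_dep => y; rewrite big_nil scaler0 addr0.
  by rewrite (bracket_linear LA (-1) smooth0 smooth0 sc) scaleN1r addNr.
rewrite big_cons -IH.
have -> : (fun y => \sum_(j <- i :: l) p j *: s j y) =
    (fun y => p i *: s i y + \sum_(j <- l) p j *: s j y).
  by apply: functional_extensionality_dep => y; rewrite big_cons.
by rewrite (bracket_linear LA).
Qed.

Lemma bracket_sumr (I : Type) (l : seq I) (p : I -> R) (s : I -> sect) (c : sect) x :
  (forall i, smooth_sect (s i)) -> smooth_sect c ->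
  bracket LA c (fun y => \sum_(i <- l) p i *: s i y) x =
  \sum_(i <- l) p i *: bracket LA c (s i) x.
Proof.
move=> ss sc; rewrite (bracket_anti LA) //; last first.
  by apply: smooth_sum => i; apply: smooth_scale => // x'; exact: sf_cst.
rewrite bracket_sum // -sumrN; apply: eq_bigr => i _.
by rewrite (bracket_anti LA (ss i) sc) scalerN opprK.
Qed.

Lemma bracket_linr k (a b c : sect) x : smooth_sect a -> smooth_sect b -> smooth_sect c ->
  bracket LA c (fun y => k *: a y + b y) x = k *: bracket LA c a x + bracket LA c b x.
Proof.
move=> sa sb sc; rewrite (bracket_anti LA) //; last exact: smooth_lincomb.
rewrite (bracket_linear LA) // opprD -scalerN.
by rewrite (bracket_anti LA sc sa) (bracket_anti LA sc sb).
Qed.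

(* A cut-off function makes the bracket at x insensitive to changes of its
   arguments away from x. *)
Lemma bracket_local (c b b' : sect) x : smooth_sect c -> smooth_sect b -> smooth_sect b' ->
  mnear (matlas M) x (fun y => b y = b' y) -> bracket LA c b x = bracket LA c b' x.
Proof.
move=> sc sb sb' bb'.
pose d y := -1 *: b' y + b y.
have sd : smooth_sect d by exact: smooth_lincomb.
have [chi [schi chi1 chi0]] := bump_ex (mfdP M) bb'.
pose f y := 1 + -1 * chi y.
have sf y : sfun f y.
  by apply: (sfD cM); [exact: sf_cst | apply: (sfM cM); [exact: sf_cst|]].
have dx : d x = 0.
  by rewrite /d (mnear_self cM bb') scaleN1r addNr.
have fx : f x = 0 by rewrite /f (mnear_self cM chi1) mulr1 subrr.
have E : (fun y => f y *: d y) = d.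
  apply: functional_extensionality_dep => y; rewrite /f.
  have [by_|c0] := chi0 y.
    by rewrite /d by_ scaleN1r addNr scaler0.
  by rewrite (mnear_self cM c0) mulr0 addr0 scale1r.
have := bracket_leibniz LA sf sc sd x.
rewrite E fx dx scaler0 scale0r addr0 /d bracket_linr // scaleN1r addrC => /eqP.
by rewrite subr_eq0 => /eqP.
Qed.

Lemma sp_lin x k (u v w : A x) : g x (k *: u + v) w = k * g x u w + g x v w.
Proof. exact: sp_linear. Qed.

Lemma sp0 x (w : A x) : g x 0 w = 0.
Proof. by have := sp_lin (-1) (0 : A x) 0 w; rewrite scaler0 addr0 mulN1r addNr. Qed.

Lemma sp_add x (u v w : A x) : g x (u + v) w = g x u w + g x v w.
Proof. by have := sp_lin 1 u v w; rewrite scale1r mul1r. Qed.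

Lemma sp_scale x k (u w : A x) : g x (k *: u) w = k * g x u w.
Proof. by have := sp_lin k u 0 w; rewrite !addr0 sp0 addr0. Qed.

Lemma sp_opp x (u w : A x) : g x (- u) w = - g x u w.
Proof. by rewrite -scaleN1r sp_scale mulN1r. Qed.

Lemma sp_sum x (I : Type) (l : seq I) (P : pred I) (u : I -> A x) (w : A x) :
  g x (\sum_(i <- l | P i) u i) w = \sum_(i <- l | P i) g x (u i) w.
Proof.
by apply: (big_morph (fun u => g x u w)); [move=> u' v; exact: sp_add | exact: sp0].
Qed.

Lemma sp_addr x (u v w : A x) : g x w (u + v) = g x w u + g x w v.
Proof. by rewrite !(sp_sym g w) sp_add. Qed.

Lemma sp_scaler x k (u w : A x) : g x w (k *: u) = k * g x w u.
Proof. by rewrite !(sp_sym g w) sp_scale. Qed.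

Lemma sp_sumr x (I : Type) (l : seq I) (P : pred I) (u : I -> A x) (w : A x) :
  g x w (\sum_(i <- l | P i) u i) = \sum_(i <- l | P i) g x w (u i).
Proof. by rewrite (sp_sym g w) sp_sum; apply: eq_bigr => i _; rewrite (sp_sym g w). Qed.

Lemma sp_linr x k (u v w : A x) : g x w (k *: u + v) = k * g x w u + g x w v.
Proof. by rewrite sp_addr sp_scaler. Qed.

Lemma sf_sp (a b : sect) x : smooth_sect a -> smooth_sect b ->
  sfun (fun y => g y (a y) (b y)) x.
Proof. by move=> sa sb; exact: sp_smooth. Qed.

Section Frame.
Variables (k : tidx (btrivs A)) (x : M) (e : 'I_r -> sect).
Hypotheses (kx : tdom k x) (se : forall j, smooth_sect (e j)).
Hypothesis fe : mnear (matlas M) x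
  (fun y => tdom k y /\ forall j, e j y = tfib k y (delta_mx 0 j)).
Local Notation co s j := (fun y => tcoord k (s y) 0 j).
Local Notation C i j := (bracket LA (e i) (e j) x).
Local Notation G i j := (fun y => g y (e i y) (e j y)).

Lemma frame_expand (s : sect) : mnear (matlas M) x (fun y => s y = \sum_j co s j y *: e j y).
Proof.
apply: mnearS fe => y [ky ey].
by rewrite {1}(fib_expand bA (s y) ky); apply: eq_bigr => j _; rewrite ey.
Qed.

Lemma sf_co (s : sect) j : smooth_sect s -> sfun (co s j) x.
Proof. by move=> ss; exact: (sect_coord cM bA (j := j) (ss x) kx). Qed.
Arguments sf_co s j _ : clear implicits.

Lemma bracket_expand_r (c b : sect) : smooth_sect c -> smooth_sect b ->
  bracket LA c b x = \sum_j (co b j x *: bracket LA c (e j) x +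
    anchor LA (c x) (co b j) *: e j x).
Proof.
move=> sc sb.
(* The coefficients of [b] are smooth near [x] only, whereas the Leibniz rule asks for functions
   smooth everywhere. *)
have /choice[f Hf] : forall j, exists h : M -> R, (forall y, sfun h y) /\
    mnear (matlas M) x (fun y => h y = co b j y).
  by move=> j; apply: (ext_fun (mfdP M)); exact: sf_co.
have sfe j : smooth_sect (fun y => f j y *: e j y).
  by apply: smooth_scale => //; have [] := Hf j.
rewrite (@bracket_local c b (fun y => \sum_j 1 *: (f j y *: e j y))) //.
- rewrite bracket_sumr //; apply: eq_bigr => j _; rewrite scale1r.
  have [sfj fj] := Hf j; rewrite (bracket_leibniz LA) // (mnear_self cM fj).
  by rewrite (tangent_congr cM (anchor_tan (c x)) (sfj x) fj).
- apply: smooth_sum => j.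
  by apply: (@smooth_scale (fun=> 1)) => // y; exact: sf_cst.
- have H : mnear (matlas M) x (fun y => forall j, f j y = co b j y).
    by apply: mnear_forall => j; have [] := Hf j.
  apply: mnearS (mnearI H (frame_expand b)) => y [Hy E].
  by rewrite E; apply: eq_bigr => j _; rewrite scale1r Hy.
Qed.

Lemma anchor_expand (b : sect) f : sfun f x ->
  anchor LA (b x) f = \sum_j co b j x * anchor LA (e j x) f.
Proof.
by move=> sf; rewrite {1}(mnear_self cM (frame_expand b)) anchor_sum.
Qed.

(** The Leibniz rule concerns the second argument; antisymmetry carries the expansion over to the
    first. *)
Lemma bracket_coord (a b : sect) : smooth_sect a -> smooth_sect b ->
  bracket LA a b x = \sum_i \sum_j (co a i x * co b j x) *: C i j +
    \sum_j anchor LA (a x) (co b j) *: e j x -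
    \sum_i anchor LA (b x) (co a i) *: e i x.
Proof.
move=> sa sb; rewrite bracket_expand_r // big_split /= [RHS]addrAC.
congr (_ + _).
transitivity (\sum_j (\sum_i (co a i x * co b j x) *: C i j -
    \sum_i (co b j x * anchor LA (e j x) (co a i)) *: e i x)).
  apply: eq_bigr => j _; rewrite (bracket_anti LA) // bracket_expand_r //.
  rewrite -sumrN scaler_sumr -sumrN -big_split /=; apply: eq_bigr => i _.
  rewrite opprD scalerDr !scalerN scalerA -[C j i]opprK -(bracket_anti LA) //.
  by rewrite scalerN opprK scalerA mulrC.
rewrite sumrB exchange_big /=; congr (_ - _).
rewrite exchange_big /=; apply: eq_bigr => i _.
by rewrite (anchor_expand b (sf_co a i sa)) scaler_suml.
Qed.

Lemma sf_G i j : sfun (G i j) x.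
Proof. exact: sf_sp. Qed.

Lemma sp_expand (a b : sect) : mnear (matlas M) x (fun y =>
  g y (a y) (b y) = \sum_i \sum_j co a i y * co b j y * G i j y).
Proof.
apply: mnearS (mnearI (frame_expand a) (frame_expand b)) => y [{1}-> {1}->].
rewrite sp_sum; apply: eq_bigr => i _; rewrite sp_scale sp_sumr mulr_sumr.
by apply: eq_bigr => j _; rewrite sp_scaler mulrA.
Qed.

Lemma sp_frame (b : sect) j : g x (e j x) (b x) = \sum_i co b i x * G i j x.
Proof.
rewrite {1}(mnear_self cM (frame_expand b)) sp_sumr.
by apply: eq_bigr => i _; rewrite sp_scaler (sp_sym g).
Qed.

Lemma anchor_sp (u : A x) (s : sect) : smooth_sect s ->
  anchor LA u (fun y => g y (s y) (s y)) =
  2 * (\sum_i anchor LA u (co s i) * g x (e i x) (s x)) +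
  \sum_i \sum_j co s i x * co s j x * anchor LA u (G i j).
Proof.
move=> ss; have tu := anchor_tan u.
have sc i := sf_co s i ss.
rewrite (tangent_congr cM tu _ (sp_expand s s)); last exact: sf_sp.
have ssum i : sfun (fun y => \sum_j co s i y * co s j y * G i j y) x.
  by apply: (sf_sum cM) => j _; apply: (sfM cM); [exact: (sfM cM) | exact: sf_G].
rewrite (tangent_sum cM _ tu); last by move=> i _; exact: ssum.
have sm i j : sfun (fun y => co s i y * co s j y) x by exact: (sfM cM).
transitivity (\sum_i \sum_j (anchor LA u (co s i) * (co s j x * G j i x) +
    anchor LA u (co s j) * (co s i x * G i j x) +
    co s i x * co s j x * anchor LA u (G i j))).
  apply: eq_bigr => i _; rewrite (tangent_sum cM _ tu); last first.
    by move=> j _; apply: (sfM cM); [exact: sm | exact: sf_G].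
  apply: eq_bigr => j _; rewrite (tangentM cM tu (sm i j)); last exact: sf_G.
  rewrite (tangentM cM tu (sc i) (sc j)) /= (sp_sym g (e j x) (e i x)).
  by ring.
under eq_bigr do rewrite !big_split /=.
rewrite !big_split /=; congr (_ + _).
rewrite mulr_natl mulr2n; congr (_ + _).
  by apply: eq_bigr => i _; rewrite sp_frame mulr_sumr.
rewrite exchange_big /=.
by apply: eq_bigr => i _; rewrite sp_frame mulr_sumr.
Qed.

(* Half the Lie derivative of the metric along c, evaluated on (s, s). *)
Definition half_lie (c s : sect) : R :=
  2^-1 * anchor LA (c x) (fun y => g y (s y) (s y)) - g x (bracket LA c s x) (s x).

(** The derivatives of the coefficients of [s] cancel between the two terms. The derivatives of
    those of [c] survive in the last sum only, which vanishes when [s x] is vertical. *)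
Lemma half_lieE (c s : sect) : smooth_sect c -> smooth_sect s ->
  half_lie c s =
  2^-1 * (\sum_i \sum_j co s i x * co s j x * anchor LA (c x) (G i j)) -
  \sum_i \sum_j co c i x * co s j x * g x (C i j) (s x) +
  \sum_i anchor LA (s x) (co c i) * g x (e i x) (s x).
Proof.
move=> sc ss; rewrite /half_lie anchor_sp // bracket_coord // !sp_add sp_opp !sp_sum.
rewrite mulrDr mulrA mulVf ?pnatr_eq0 // mul1r.
have -> : \sum_i g x (\sum_j (co c i x * co s j x) *: C i j) (s x) =
   \sum_i \sum_j co c i x * co s j x * g x (C i j) (s x).
  by apply: eq_bigr => i _; rewrite sp_sum; apply: eq_bigr => j _; rewrite sp_scale.
have E (F : 'I_r -> R) : \sum_i g x (F i *: e i x) (s x) = \sum_i F i * g x (e i x) (s x).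
  by apply: eq_bigr => i _; rewrite sp_scale.
by rewrite !E; ring.
Qed.

Lemma co_frame i j : mnear (matlas M) x (fun y => co (e i) j y = (i == j)%:R).
Proof.
apply: mnearS fe => y [ky ey]; rewrite ey (bdl_fibK bA ky) mxE eqxx /=.
by rewrite eq_sym.
Qed.

Lemma anchor_co_frame (u : A x) i j : anchor LA u (co (e i) j) = 0.
Proof.
rewrite (tangent_congr cM (anchor_tan u) _ (co_frame i j)); last exact: sf_co.
exact: (tangent_cst cM _ (anchor_tan u)).
Qed.

Lemma half_lie_frame m (s : sect) : smooth_sect s ->
  half_lie (e m) s =
  2^-1 * (\sum_i \sum_j co s i x * co s j x * anchor LA (e m x) (G i j)) -
  \sum_j co s j x * g x (C m j) (s x).
Proof.
move=> ss; rewrite half_lieE // [X in _ + X]big1 ?addr0 => [|i _]; last first.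
  by rewrite anchor_co_frame mul0r.
congr (_ - _); rewrite (bigD1 m) //= (mnear_self cM (co_frame m m)) eqxx.
rewrite [X in _ + X]big1 ?addr0 => [|i im].
  by apply: eq_bigr => j _; rewrite mul1r.
rewrite (mnear_self cM (co_frame m i)) eq_sym (negbTE im).
by apply: big1 => j _; rewrite !mul0r.
Qed.

End Frame.
End BracketCalculus.

(** * The geodesic field *)

Section IntegralCurves.
Variables (R : realType) (n : nat) (M : Type) (MA : atlas 'rV[R]_n M).
Hypothesis cM : charted MA.

(** Picard's theorem in one chart; time is shortened so that the solution stays where the chart and
    its inverse cancel. *)
Lemma integral_curve_ex (X : M -> tvec R M) x : smooth_vfield MA X ->
  exists (c : R -> M) (d : R), [/\ 0 < d, c 0 = x & integral_curve MA X c (- d) d].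
Proof.
move=> [tX sX]; have [i ix] := ch_cover cM x.
pose F z := tcoords i (X (cinv i z)).
have sF : smooth_near F (ccoord i x).
  apply: sn_mx => j k; rewrite /F; under eq_fun do rewrite mxE.
  apply: (sfE (f := fun y => X y (fun y => ccoord i y 0 k))) => //.
  by apply: sX; exact: sf_coord.
have [z [d [d0 z0 dz]]] := picard sF.
have sz0 : smooth_near z 0 by have [] := dz 0; rewrite ?normr0.
have H := ch_near cM ix; rewrite -z0 in H.
have [d' /= d'0 Hd'] := (nbhs_normP _ _).1 (sn_cont sz0 H).
pose m := Num.min d d' / 2.
have m0 : 0 < m by rewrite divr_gt0 // lt_min d0.
have ltm (t : R) : `|t| <= m -> `|t| < d /\ `|t| < d'.
  move=> tm; have : m < Num.min d d' by rewrite ltr_pdivrMr // ltr_pMr ?lt_min ?d0 // ltr1n.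
  by rewrite lt_min => /andP[md md']; split; apply: le_lt_trans tm _.
have good (t : R) : `|t| < d' -> cdom i (cinv i (z t)) /\ ccoord i (cinv i (z t)) = z t.
  by move=> td; apply: Hd'; rewrite /= sub0r normrN.
exists (fun t => cinv i (z t)), m; split=> //; first by rewrite z0 (ch_coordK cM).
move=> t; rewrite -ler_norml => /ltm[td td'].
have [iz zK] := good t td'; have [dzt szt] := dz t td.
have sc : smooth_map_at (real_line R) MA (fun t => cinv i (z t)) t.
  apply: (@sm_comp R _ _ _ _ _ _ (real_line R) (flat_atlas 'rV[R]_n) MA z (cinv i) t) => //.
  - exact: real_charted.
  - exact/flat_charted/fdim_rV.
  - apply: (@sm1 _ _ _ _ _ _ _ (real_charted R) (flat_charted (fdim_rV R n)) _ _ tt tt) => //=.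
    by near=> s.
  - by rewrite -zK; exact: sm_inv.
split=> // f sf.
rewrite (velocityE cM sc iz sf) (tangentE cM (tX _) iz sf).
suff -> : 'D_1 (fun s : R => ccoord i (cinv i (z s))) t = tcoords i (X (cinv i (z t))) by [].
have [_ Hz] := dzt; rewrite -[RHS]/(F (z t)) -Hz.
apply: near_eq_derive; apply: filterS (near_norm_lt td') => s sd'.
by have [] := good s sd'.
Unshelve. all: by end_near. Qed.

End IntegralCurves.

Lemma unitmx_inj (R : fieldType) n (E : 'M[R]_n) :
  (forall v : 'rV_n, v *m E = 0 -> v = 0) -> E \in unitmx.
Proof.
move=> H; rewrite -row_free_unit -kermx_eq0; apply/eqP/row_matrixP => i.
rewrite row0; apply: H; rewrite -row_mul mulmx_ker row0 //.
Qed.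

(** * The geodesic field computed from the Koszul formula *)

Section Geodesics.
Variables (R : realType) (n r : nat) (M : manifold R n) (A : vbundle M r).
Variables (LA : lie_algebroid A) (g : riem_metric A).
Notation sect := (forall x : M, A x).
Notation smooth_sect := (smooth_section (matlas M) (btrivs A)).
Notation totA := (total_atlas (matlas M) (btrivs A)).
Notation sfun := (smooth_fun_at (matlas M)).
Let cM := manifold_charted (mfdP M).
Let bA := bundleP A.
Let cA := tot_charted cM bA.
Variable D : sect -> sect -> sect.
Hypothesis hD : is_levi_civita LA g D.

Definition koszul (a b c : sect) (x : M) : R :=
  anchor LA (a x) (fun y => g y (b y) (c y)) +
  anchor LA (b x) (fun y => g y (a y) (c y)) -
  anchor LA (c x) (fun y => g y (a y) (b y)) +
  g x (bracket LA c a x) (b x) + g x (bracket LA c b x) (a x) +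
  g x (bracket LA a b x) (c x).

Lemma anchor_sp_linl (u : forall x, A x) x k (a b c : sect) :
  smooth_sect a -> smooth_sect b -> smooth_sect c ->
  anchor LA (u x) (fun y => g y (k *: a y + b y) (c y)) =
  k * anchor LA (u x) (fun y => g y (a y) (c y)) + anchor LA (u x) (fun y => g y (b y) (c y)).
Proof.
move=> sa sb sc; have tu := anchor_tan LA (u x).
have -> : (fun y => g y (k *: a y + b y) (c y)) =
    (fun y => (fun=> k) y * g y (a y) (c y) + g y (b y) (c y)).
  by apply/funext => y; rewrite sp_lin.
have sk : sfun (fun=> k) x by exact: sf_cst.
have sac := @sf_sp _ _ _ _ _ g a c x sa sc; have sbc := @sf_sp _ _ _ _ _ g b c x sb sc.
rewrite (tangentD cM tu (sfM cM sk sac) sbc) (tangentM cM tu sk sac).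
by rewrite (tangent_cst cM k tu) mulr0 addr0.
Qed.

Lemma anchor_sp_linr (u : forall x, A x) x k (a b c : sect) :
  smooth_sect a -> smooth_sect b -> smooth_sect c ->
  anchor LA (u x) (fun y => g y (c y) (k *: a y + b y)) =
  k * anchor LA (u x) (fun y => g y (c y) (a y)) + anchor LA (u x) (fun y => g y (c y) (b y)).
Proof.
move=> sa sb sc; have E (s : sect) : (fun y => g y (c y) (s y)) = (fun y => g y (s y) (c y)).
  by apply/funext => y; rewrite (sp_sym g).
by rewrite (E (fun y => k *: a y + b y)) !E; exact: anchor_sp_linl.
Qed.

Lemma koszul_linl k (a a' b c : sect) x :
  smooth_sect a -> smooth_sect a' -> smooth_sect b -> smooth_sect c ->
  koszul (fun y => k *: a y + a' y) b c x = k * koszul a b c x + koszul a' b c x.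
Proof.
move=> sa sa' sb sc; rewrite /koszul !anchor_sp_linl // anchor_lin; last exact: sf_sp.
rewrite bracket_linr // (bracket_linear LA) // !sp_lin !sp_linr.
by ring.
Qed.

Lemma koszul_linr k (b b' a c : sect) x :
  smooth_sect b -> smooth_sect b' -> smooth_sect a -> smooth_sect c ->
  koszul a (fun y => k *: b y + b' y) c x = k * koszul a b c x + koszul a b' c x.
Proof.
move=> sb sb' sa sc; rewrite /koszul !anchor_sp_linl // anchor_sp_linr //.
rewrite anchor_lin; last exact: sf_sp.
rewrite !bracket_linr // !sp_lin !sp_linr.
by ring.
Qed.

Lemma linear_sect_sum (B : sect -> R) (I : Type) (l : seq I) (p : I -> R) (s : I -> sect) :
  (forall k (a b : sect), smooth_sect a -> smooth_sect b ->
    B (fun y => k *: a y + b y) = k * B a + B b) ->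
  (forall i, smooth_sect (s i)) ->
  B (fun y => \sum_(i <- l) p i *: s i y) = \sum_(i <- l) p i * B (s i).
Proof.
move=> lB ss.
have sl l' : smooth_sect (fun y => \sum_(i <- l') p i *: s i y).
  apply: smooth_sum => i; apply: (@smooth_scale _ _ _ _ _ (fun=> p i)) => // x; exact: sf_cst.
elim: l => [|i l IH].
  rewrite big_nil.
  have -> : (fun y => \sum_(i <- [::]) p i *: s i y) = (fun y : M => -1 *: (0 : A y) + 0).
    by apply: functional_extensionality_dep => y; rewrite big_nil scaler0 addr0.
  rewrite lB; [by rewrite mulN1r addNr|exact: smooth0..].
rewrite big_cons -IH -lB //; congr B.
by apply: functional_extensionality_dep => y; rewrite big_cons.
Qed.

(** On the diagonal the term with [S, S] disappears and the remaining terms of the Koszul expression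
    pair up. As the [p i] are constants, linearity of [koszul] over the reals is sufficient. *)
Lemma koszul_quad (e : 'I_r -> sect) (p : 'I_r -> R) (c : sect) x :
  (forall i, smooth_sect (e i)) -> smooth_sect c ->
  let S := (fun y => \sum_i p i *: e i y) : sect in
  2 * (\sum_i \sum_j p i * p j * g x (D (e i) (e j) x) (c x)) =
  2 * anchor LA (S x) (fun y => g y (S y) (c y)) -
  anchor LA (c x) (fun y => g y (S y) (S y)) + 2 * g x (bracket LA c S x) (S x).
Proof.
move=> se sc S.
have sS : smooth_sect S.
  apply: smooth_sum => i; apply: (@smooth_scale _ _ _ _ _ (fun=> p i)) => // y; exact: sf_cst.
have [sD lc] := hD.
have -> : 2 * (\sum_i \sum_j p i * p j * g x (D (e i) (e j) x) (c x)) = koszul S S c x.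
  rewrite (@linear_sect_sum (fun a => koszul a S c x)) //; last first.
    by move=> k a b sa sb; exact: koszul_linl.
  rewrite mulr_sumr; apply: eq_bigr => i _.
  rewrite (@linear_sect_sum (fun b => koszul (e i) b c x)) //; last first.
    by move=> k a b sa sb; exact: koszul_linr.
  rewrite !mulr_sumr; apply: eq_bigr => j _.
  by rewrite -[koszul _ _ _ _](lc _ _ _ (se i) (se j) sc x); ring.
have SS0 : g x (bracket LA S S x) (c x) = 0.
  have := bracket_anti LA sS sS x => /(congr1 (fun u => g x u (c x))).
  by rewrite sp_opp => /eqP; rewrite -addr_eq0 -mulr2n mulrn_eq0 /= => /eqP.
by rewrite /koszul SS0; ring.
Qed.

Variables (X : totspace A -> tvec R (totspace A)).
Hypothesis hX : is_geodesic_field LA D X.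

Lemma sf_sp_fib (c : sect) a : smooth_sect c ->
  smooth_fun_at totA (fun b => g _ (fib_elt b) (c (bproj b))) a.
Proof.
move=> sc; have [k ka] := bdl_cover bA (bproj a).
have [e [se fe]] := ext_frame (mfdP M) bA ka.
have spr : smooth_map_at totA (matlas M) (@bproj R M A) a by exact: (sm_bproj cM bA).
apply: (sf_congr cA (f := fun b => \sum_j tcoord k (fib_elt b) 0 j *
   g _ (e j (bproj b)) (c (bproj b)))).
  apply: (mnearS _ (sm_mnear cA cM spr fe)) => b [kb eb].
  rewrite [in RHS](fib_expand bA (fib_elt b) kb) sp_sum.
  by apply: eq_bigr => j _; rewrite sp_scale eb.
apply: (sf_sum cA) => j _; apply: (sfM cA); first exact: (sf_fib cM bA).
have H : sfun (fun y => g y (e j y) (c y)) (bproj a) by exact: sf_sp.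
exact: (@sf_comp R _ _ _ _ _ _ _ _ a cA cM spr H).
Qed.

(** [dalong] does not require its coefficients to be smooth. They are, being the solution of a
    linear system with smooth data and invertible matrix. *)
Lemma frame_coef_smooth (gam : R -> totspace A) (e : 'I_r -> sect) (q : 'I_r -> R -> R) t :
  smooth_map_at (real_line R) totA gam t -> (forall i, smooth_sect (e i)) ->
  is_basis [set: A (bproj (gam t))] (fun i => e i (bproj (gam t))) ->
  (\forall s \near t, fib_elt (gam s) = \sum_j q j s *: e j (bproj (gam s))) ->
  forall j, smooth_near (q j) t.
Proof.
move=> sg se [_ _ ind] qe j.
have [k kt] := bdl_cover bA (bproj (gam t)).
have cR := real_charted R.
have sb : smooth_map_at (real_line R) (matlas M) (fun s => bproj (gam s)) t.
  have spr : smooth_map_at totA (matlas M) (@bproj R M A) (gam t) by exact: (sm_bproj cM bA).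
  exact: (@sm_comp R _ _ _ _ _ _ _ _ _ _ _ t cR cA cM sg spr).
pose w s := tcoord k (fib_elt (gam s)).
pose E s := \matrix_i tcoord k (e i (bproj (gam s))).
have sw : smooth_near w t.
  apply: sn_mx => i l; rewrite (ord1 i); apply/sf_realline.
  have H : smooth_fun_at totA (fun b => tcoord k (fib_elt b) 0 l) (gam t) by exact: (sf_fib cM bA).
  exact: (@sf_comp R _ _ _ _ _ _ _ _ t cR cA sg H).
have sE : smooth_near E t.
  apply: sn_mx => i l; under eq_fun do rewrite mxE; apply/sf_realline.
  have H : sfun (fun y => tcoord k (e i y) 0 l) (bproj (gam t)).
    exact: (sect_coord cM bA (j := l) (se i _) kt).
  exact: (@sf_comp R _ _ _ _ _ _ _ _ t cR cM sb H).
have wE : \forall s \near t, w s = (\row_i q i s) *m E s.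
  have H := sm_mnear cR cM sb (tdom_near cM bA kt).
  have {}H : \forall s \near t, tdom k (bproj (gam s)) by exact: (H tt I).
  apply: filterS (near_and qe H) => s [qs ks].
  rewrite /w qs (tcoord_sum bA) //; apply/rowP => l; rewrite summxE mxE.
  by apply: eq_bigr => i _; rewrite (tcoordZ bA) // !mxE.
have Eu : E t \in unitmx.
  apply: unitmx_inj => v vE; apply/rowP => i; rewrite [RHS]mxE; apply: (ind (fun i => v 0 i)).
  apply: (tcoord_inj bA kt); rewrite (tcoord0 bA kt) (tcoord_sum bA) //.
  apply/rowP => l; rewrite summxE -[RHS](congr1 (fun u : 'rV[R]_r => u 0 l) vE) mxE.
  by apply: eq_bigr => i' _; rewrite (tcoordZ bA) // !mxE.
have Eu' : \forall s \near t, E s \in unitmx.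
  have d0 : \det (E t) != 0 by rewrite -unitfE -unitmxE.
  have H := cvgr_neq0 _ (sn_cont (sn_det sE)) d0.
  by near=> s; rewrite unitmxE unitfE; near: s; exact: H.
apply: (@sn_congr _ _ _ (fun s => (w s *m invmx (E s)) 0 j)).
  apply: filterS (near_and wE Eu') => s [-> us].
  by rewrite mulmxK // mxE.
by apply: sn_entry; apply: sn_mulmx => //; exact: sn_invmx.
Unshelve. all: by end_near. Qed.

(** The integral curve through [a] is a geodesic; differentiating along it at time 0 a function of
    the base point, or the product with a section [c], reads off [X a] on these functions. The
    section [s] has constant coefficients in the frame supplied by the geodesic equation. *)
Lemma geodesic_field_main (a : totspace A) :
  (forall f, sfun f (bproj a) -> X a (fun b => f (bproj b)) = anchor LA (fib_elt a) f) /\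
  (forall c, smooth_sect c -> exists s : sect, [/\ smooth_sect s, s (bproj a) = fib_elt a &
    X a (fun b => g _ (fib_elt b) (c (bproj b))) = half_lie LA g (bproj a) c s]).
Proof.
have [vX gX] := hX; have [tX _] := vX.
have [gam [d [d0 <- Hg]]] := integral_curve_ex cA a vX.
pose c t := bproj (gam t); pose al t := fib_elt (gam t) : A (c t).
have gE : curve_in al = gam by apply/funext => t; exact: elt_fib.
have [] := gX c al (- d) d; first by rewrite gt0_cp.
rewrite gE => _ /(_ Hg) [Hap Hd].
have I0 : - d <= 0 <= d by rewrite oppr_le0 !ltW.
have [sg apt] := Hap 0 I0; rewrite gE in sg.
have [_ vg] := Hg 0 I0.
have cR := real_charted R.
have spr : smooth_map_at totA (matlas M) (@bproj R M A) (gam 0) by exact: (sm_bproj cM bA).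
have E1 f : sfun f (bproj (gam 0)) -> X (gam 0) (fun b => f (bproj b)) = anchor LA (fib_elt (gam 0)) f.
  move=> sf; rewrite -vg; last exact: (@sf_comp R _ _ _ _ _ _ _ _ (gam 0) cA cM spr sf).
  by rewrite -[RHS]/(anchor LA (al 0) f) apt.
split=> // c' sc'.
have [e [p [q [[se [U [oU U0 Ub]]] alp alq D0]]]] := Hd 0 I0.
have basis0 := Ub _ U0.
pose S := (fun y => \sum_i p i *: e i y) : sect.
exists S; split.
- by apply: smooth_sum => i; apply: (@smooth_scale _ _ _ _ _ (fun=> p i)) => // y; exact: sf_cst.
- by rewrite -[RHS]/(al 0) alp.
have sq := frame_coef_smooth sg se basis0 alq.
(* The frame expresses the curve at time 0 twice, as [alpha] by the [p j] and as [beta] by the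
   [q j 0]; independence identifies the two. *)
have q0 j : q j 0 = p j.
  have [_ _ ind] := basis0; have := nbhs_singleton alq.
  rewrite alp => H; apply/eqP; rewrite -subr_eq0; apply/eqP.
  apply: (ind (fun j => q j 0 - p j)).
  by under eq_bigr do rewrite scalerBl; rewrite sumrB -H subrr.
have sec j : sfun (fun y => g y (e j y) (c' y)) (c 0) by exact: sf_sp.
have scc j : smooth_near (fun s => g (c s) (e j (c s)) (c' (c s))) (0 : R).
  apply/sf_realline.
  have sb : smooth_map_at (real_line R) (matlas M) c 0.
    exact: (@sm_comp R _ _ _ _ _ _ _ _ _ _ _ 0 cR cA cM sg spr).
  exact: (@sf_comp R _ _ _ _ _ _ _ _ 0 cR cM sb (sec j)).
rewrite -vg; last exact: sf_sp_fib.
rewrite /velocity derive1E.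
rewrite (@near_eq_derive _ _ _ _ (fun s : R => \sum_j q j s * g (c s) (e j (c s)) (c' (c s)))); last first.
  apply: filterS alq => s Hs; rewrite -[LHS]/(g (c s) (al s) (c' (c s))) Hs sp_sum.
  by apply: eq_bigr => j _; rewrite sp_scale.
have dsum : 'D_1 (fun s : R => \sum_j q j s * g (c s) (e j (c s)) (c' (c s))) 0 =
   \sum_j ('D_1 (q j) 0 * g (c 0) (e j (c 0)) (c' (c 0)) + p j * anchor LA (al 0) (fun y => g y (e j y) (c' y))).
  have -> : (fun s : R => \sum_j q j s * g (c s) (e j (c s)) (c' (c s))) =
    \sum_j (fun s : R => q j s * g (c s) (e j (c s)) (c' (c s))).
    by apply/funext => s; rewrite fct_sumE.
  rewrite derive_sum => [|j]; last by apply: sn_derivable; exact: snM.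
  apply: eq_bigr => j _.
  rewrite [LHS]deriveM; [|exact: sn_derivable..].
  rewrite q0 addrC mulrC; congr (_ * _ + _ * _).
  by rewrite (apt _ (sec j)) /velocity derive1E.
rewrite dsum big_split /=.
(* The geodesic equation, paired with the section. *)
have E2 : \sum_j 'D_1 (q j) 0 * g (c 0) (e j (c 0)) (c' (c 0)) =
   - \sum_i \sum_j p i * p j * g (c 0) (D (e i) (e j) (c 0)) (c' (c 0)).
  apply/eqP; rewrite -addr_eq0; apply/eqP.
  have HD := congr1 (fun u => g (c 0) u (c' (c 0))) D0.
  rewrite /= sp0 sp_add !sp_sum in HD; rewrite [RHS]HD; congr (_ + _).
    by apply: eq_bigr => j _; rewrite sp_scale derive1E.
  apply: eq_bigr => i _; rewrite sp_sum; apply: eq_bigr => j _.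
  by rewrite sp_scale q0.
have E3 : \sum_j p j * anchor LA (al 0) (fun y => g y (e j y) (c' y)) =
    anchor LA (S (c 0)) (fun y => g y (S y) (c' y)).
  rewrite (@linear_sect_sum (fun s => anchor LA (S (c 0)) (fun y => g y (s y) (c' y)))) //.
    by rewrite /S -alp.
  by move=> k a' b' sa sb; exact: anchor_sp_linl.
rewrite E2 E3 /half_lie.
have := koszul_quad p (c 0) se sc'; rewrite -/S /=.
set K := \sum_i _; set a1 := anchor _ _ _; set a2 := anchor _ _ _; set b1 := g _ _ _ => HK.
have -> : K = a1 - 2^-1 * a2 + b1 by lra.
by rewrite -/a2 -/b1; lra.
Qed.

Section FrameFormula.
Variables (k : tidx (btrivs A)) (x : M) (e : 'I_r -> sect).
Hypotheses (kx : tdom k x) (se : forall j, smooth_sect (e j)).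
Hypothesis fe : mnear (matlas M) x
  (fun y => tdom k y /\ forall j, e j y = tfib k y (delta_mx 0 j)).

Lemma geodesic_field_frame (u : A x) m : let w := tcoord k u in
  \sum_j X (elt u) (fun b => tcoord k (fib_elt b) 0 j) * g x (e j x) (e m x) =
  2^-1 * (\sum_i \sum_j w 0 i * w 0 j * anchor LA (e m x) (fun y => g y (e i y) (e j y))) -
  \sum_j w 0 j * g x (bracket LA (e m) (e j) x) u -
  \sum_j w 0 j * anchor LA u (fun y => g y (e j y) (e m y)).
Proof.
move=> w; have [[tX _] _] := hX.
have [E1 E2] := geodesic_field_main (elt u).
have [s [ss su Xs]] := E2 (e m) (@se m).
move: Xs; rewrite (half_lie_frame LA g kx (@se) fe m ss).
have sx : s x = u := su; rewrite sx -/w => <-.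
pose Gm j (b : totspace A) := g (bproj b) (e j (bproj b)) (e m (bproj b)).
have spr : smooth_map_at totA (matlas M) (@bproj R M A) (elt u) by exact: (sm_bproj cM bA).
have sG j : sfun (fun y => g y (e j y) (e m y)) x by exact: sf_sp.
have sGm j : smooth_fun_at totA (Gm j) (elt u).
  exact: (@sf_comp R _ _ _ _ _ _ _ _ (elt u) cA cM spr (sG j)).
have sw j : smooth_fun_at totA (fun b => tcoord k (fib_elt b) 0 j) (elt u).
  exact: (sf_fib cM bA).
have -> : X (elt u) (fun b => g _ (fib_elt b) (e m (bproj b))) =
   X (elt u) (fun b => \sum_j tcoord k (fib_elt b) 0 j * Gm j b).
  apply: (tangent_congr cA (tX (elt u))); first exact: sf_sp_fib.
  apply: (mnearS _ (sm_mnear cA cM spr fe)) => b [kb eb].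
  rewrite {1}(fib_expand bA (fib_elt b) kb) sp_sum.
  by apply: eq_bigr => j _; rewrite sp_scale /Gm !eb.
rewrite (tangent_sum cA _ (tX (elt u))); last by move=> j _; exact: (sfM cA).
apply/eqP; rewrite eq_sym subr_eq -big_split /=; apply/eqP; apply: eq_bigr => j _.
rewrite (tangentM cA (tX (elt u)) (sw j) (sGm j)).
have -> : X (elt u) (Gm j) = anchor LA u (fun y => g y (e j y) (e m y)).
  exact: (E1 (fun y => g y (e j y) (e m y)) (sG j)).
by rewrite /Gm /=; ring.
Qed.

End FrameFormula.
End Geodesics.

(** * Matrix calculus and trace identities *)

Section MatrixCalculus.
Variables (R : realType) (V : normedModType R).

Lemma derive_sn_sum (I : finType) (f : I -> V -> R) x v :
  (forall i, smooth_near (f i) x) ->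
  'D_v (fun y => \sum_i f i y) x = \sum_i 'D_v (f i) x.
Proof.
move=> sf.
have H (s : seq I) : 'D_v (fun y => \sum_(i <- s) f i y) x = \sum_(i <- s) 'D_v (f i) x.
  elim: s => [|i s IH].
    rewrite big_nil; under eq_fun do rewrite big_nil; exact: derive_cst.
  rewrite big_cons -IH; under eq_fun do rewrite big_cons.
  by rewrite [LHS]deriveD //; apply: sn_derivable => //; exact: sn_sum.
exact: H.
Qed.

Lemma derive_mul (f h : V -> R) x v : derivable f x v -> derivable h x v ->
  'D_v (fun y => f y * h y) x = 'D_v f x * h x + f x * 'D_v h x.
Proof. by move=> df dh; rewrite [LHS]deriveM // addrC mulrC. Qed.

Lemma derive_snM (f h : V -> R) x v : smooth_near f x -> smooth_near h x ->
  'D_v (fun y => f y * h y) x = 'D_v f x * h x + f x * 'D_v h x.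
Proof. by move=> sf sh; apply: derive_mul; exact: sn_derivable. Qed.

Lemma derive_mulmx p q s (f : V -> 'M[R]_(p, q)) (h : V -> 'M[R]_(q, s)) x v :
  smooth_near f x -> smooth_near h x ->
  'D_v (fun y => f y *m h y) x = 'D_v f x *m h x + f x *m 'D_v h x.
Proof.
move=> sf sh; apply/matrixP => i j; rewrite sn_derive_mx; last exact: sn_mulmx.
under eq_fun do rewrite mxE.
rewrite derive_sn_sum; last by move=> k; apply: snM; exact: sn_entry.
rewrite !mxE -big_split /=; apply: eq_bigr => k _.
rewrite derive_snM; [|exact: sn_entry..].
by rewrite !sn_derive_mx.
Qed.

Lemma sn_trmx p q (f : V -> 'M[R]_(p, q)) x : smooth_near f x ->
  smooth_near (fun y => (f y)^T) x.
Proof. by move=> sf; apply: sn_mx => i j; under eq_fun do rewrite mxE; exact: sn_entry. Qed.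

Lemma derive_trmx p q (f : V -> 'M[R]_(p, q)) x v : smooth_near f x ->
  'D_v (fun y => (f y)^T) x = ('D_v f x)^T.
Proof.
move=> sf; apply/matrixP => i j; rewrite sn_derive_mx; last exact: sn_trmx.
by under eq_fun do rewrite mxE; rewrite mxE sn_derive_mx.
Qed.

Lemma near_unitmx n (f : V -> 'M[R]_n) x : smooth_near f x -> f x \in unitmx ->
  \forall y \near x, f y \in unitmx.
Proof.
move=> sf fx.
have d0 : \det (f x) != 0 by rewrite -unitfE -unitmxE.
have H := cvgr_neq0 _ (sn_cont (sn_det sf)) d0.
by near=> y; rewrite unitmxE unitfE; near: y; exact: H.
Unshelve. all: by end_near. Qed.

Lemma derive_invmx n (f : V -> 'M[R]_n) x v : smooth_near f x -> f x \in unitmx ->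
  'D_v (fun y => invmx (f y)) x = - (invmx (f x) *m 'D_v f x *m invmx (f x)).
Proof.
move=> sf fx; have si := sn_invmx fx sf.
have E : 'D_v f x *m invmx (f x) + f x *m 'D_v (fun y => invmx (f y)) x = 0.
  rewrite -derive_mulmx // (@near_eq_derive _ _ _ _ (fun=> 1%:M)).
    exact: derive_cst.
  by apply: filterS (near_unitmx sf fx) => y fy; rewrite mulmxV.
rewrite -[LHS](mulKmx fx); move/eqP: E; rewrite addrC addr_eq0 => /eqP ->.
by rewrite mulmxN mulmxA.
Qed.

Lemma adj1 n : \adj (1%:M : 'M[R]_n) = 1%:M.
Proof. by have := mul_mx_adj (1%:M : 'M[R]_n); rewrite mul1mx det1. Qed.

Lemma sn_cofactor n (f : V -> 'M[R]_n) x i j : smooth_near f x ->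
  smooth_near (fun y => cofactor (f y) i j) x.
Proof.
move=> sf; apply: snM; first exact: sn_cst.
apply: sn_det; apply: sn_mx => k m; under eq_fun do rewrite !mxE; exact: sn_entry.
Qed.

(** Expansion along the first row: at the identity only the first cofactor is non-zero, and only its
    derivative is multiplied by a non-zero entry; that derivative is the statement for size n. *)
Lemma derive_det_at1 n (f : V -> 'M[R]_n) x v : smooth_near f x -> f x = 1%:M ->
  'D_v (fun y => \det (f y)) x = \tr ('D_v f x).
Proof.
elim: n f => [|n IH] f sf fx.
  rewrite /mxtrace big_ord0 (_ : (fun y => \det (f y)) = fun=> 1); first exact: derive_cst.
  by apply/funext => y; rewrite det_mx00.
have -> : (fun y => \det (f y)) = (fun y => \sum_j f y 0 j * cofactor (f y) 0 j).
  by apply/funext => y; rewrite (expand_det_row _ 0).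
have sfe i j : smooth_near (fun y => f y i j) x by exact: sn_entry.
rewrite derive_sn_sum; last by move=> j; apply: snM => //; exact: sn_cofactor.
rewrite /mxtrace [RHS]big_ord_recl.
have cof j : cofactor (f x) 0 j = (j == 0)%:R.
  have /matrixP/(_ j 0) := adj1 n.+1; rewrite fx !mxE => ->.
  by rewrite -val_eqE.
transitivity (\sum_j ('D_v f x 0 j * (j == 0)%:R + (0 == j :> 'I_n.+1)%:R *
    'D_v (fun y => cofactor (f y) 0 j) x)).
  apply: eq_bigr => j _; rewrite derive_snM //; last exact: sn_cofactor.
  by rewrite cof fx mxE sn_derive_mx.
rewrite big_split /=; congr (_ + _).
  rewrite (bigD1 0) //= mulr1 big1 ?addr0 // => j j0.
  by rewrite (negbTE j0) mulr0.
rewrite (bigD1 0) //= mul1r big1 ?addr0 => [|j j0]; last first.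
  by rewrite eq_sym (negbTE j0) mul0r.
pose f' y := row' 0 (col' 0 (f y)).
have sf' : smooth_near f' x.
  by apply: sn_mx => i j; rewrite /f'; under eq_fun do rewrite !mxE; exact: sn_entry.
have -> : (fun y => cofactor (f y) 0 0) = (fun y => \det (f' y)).
  by apply/funext => y; rewrite /cofactor /= addn0 expr0 mul1r.
rewrite IH //.
  apply: eq_bigr => i _; rewrite !sn_derive_mx // /f'; congr ('D_v _ x).
  by apply/funext => y; rewrite !mxE.
apply/matrixP => i j; rewrite /f' fx !mxE.
by rewrite (inj_eq (@lift_inj _ 0)).
Qed.

(** Jacobi's formula, reduced to the case of the identity by multiplying with the constant matrix
    [invmx (f x)]. *)
Lemma derive_det n (f : V -> 'M[R]_n) x v : smooth_near f x -> f x \in unitmx ->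
  'D_v (fun y => \det (f y)) x = \det (f x) * \tr (invmx (f x) *m 'D_v f x).
Proof.
move=> sf fx; pose h y := invmx (f x) *m f y.
have sh : smooth_near h x by apply: sn_mulmx => //; exact: sn_cst.
have -> : (fun y => \det (f y)) = (fun y => \det (f x) * \det (h y)).
  apply/funext => y; rewrite /h det_mulmx det_inv mulrA divff ?mul1r //.
  by rewrite -unitfE -unitmxE.
rewrite derive_snM; [|exact: sn_cst|exact: sn_det].
rewrite derive_cst mul0r add0r derive_det_at1 //; last by rewrite /h mulVmx.
congr (_ * \tr _).
rewrite /h derive_mulmx //; last exact: sn_cst.
by rewrite derive_cst mul0mx add0r.
Qed.

Lemma derive_sqrt_comp (f : V -> R) x v : smooth_near f x -> 0 < f x ->
  derivable (fun y => Num.sqrt (f y)) x v /\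
  'D_v (fun y => Num.sqrt (f y)) x = 'D_v f x / (2 * Num.sqrt (f x)).
Proof.
move=> sf f0.
have sl : is_derive (0 : R) 1 (fun t : R => f (t *: v + x)) ('D_v f x).
  have := @is_derive_line R V R f x v 0; rewrite scale0r add0r; apply.
  exact: sn_derivable.
have e0 : f ((0 : R) *: v + x) = f x by rewrite scale0r add0r.
have sq : is_derive (f ((0 : R) *: v + x)) 1 Num.sqrt (2 * Num.sqrt (f x))^-1.
  by rewrite e0; exact: is_derive1_sqrt.
have H := is_derive1_comp sq sl; have [H1 H2] := H.
split; first by apply/derivable1P; exact: H1.
rewrite mulrC -H2; apply: derive_line; near=> t.
by rewrite /= addr0 [t *: 1]mulr1.
Unshelve. all: by end_near. Qed.

End MatrixCalculus.

(** * The anchor matrix, the induced metric and the trace identity *)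

Section LinearAlgebra.
Variables (R : realType) (r l : nat) (P : 'M[R]_(r, l)) (G : 'M[R]_r).
Hypothesis Gsym : G^T = G.
Hypothesis Gpos : forall v : 'rV[R]_r, v != 0 -> 0 < (v *m G *m v^T) 0 0.
Variable Q : 'M[R]_(l, r).
Hypothesis QP : Q *m P = 1%:M.

Lemma posdef_unit n (H : 'M[R]_n) :
  (forall v : 'rV[R]_n, v != 0 -> 0 < (v *m H *m v^T) 0 0) -> H \in unitmx.
Proof.
move=> Hpos; apply: unitmx_inj => v vH; apply/eqP; apply: contrapT => /negP /Hpos.
by rewrite vH mul0mx mxE ltxx.
Qed.

Lemma Gunit : G \in unitmx. Proof. exact: posdef_unit. Qed.

Lemma GVsym : (invmx G)^T = invmx G. Proof. by rewrite trmx_inv Gsym. Qed.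

Lemma GVpos (v : 'rV[R]_r) : v != 0 -> 0 < (v *m invmx G *m v^T) 0 0.
Proof.
move=> v0; have := Gpos (v := v *m invmx G).
rewrite mulmxKV ?Gunit // trmx_mul GVsym mulmxA; apply.
apply: contraNneq v0 => H; rewrite -[v](mulmxKV Gunit) H mul0mx //.
Qed.

(** Vectors are rows and the anchor is u |-> u P. Then [hmetric] is the Gram matrix of the leaf
    metric, and [hproj] is the orthogonal projection onto the complement of the kernel of [P],
    acting on the right. *)
Definition cometric : 'M[R]_l := P^T *m invmx G *m P.
Definition hmetric : 'M[R]_l := invmx cometric.
Definition hproj : 'M[R]_r := P *m hmetric *m P^T *m invmx G.

Lemma cometric_pos (v : 'rV[R]_l) : v != 0 -> 0 < (v *m cometric *m v^T) 0 0.
Proof.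
move=> v0; have -> : v *m cometric *m v^T = (v *m P^T) *m invmx G *m (v *m P^T)^T.
  by rewrite /cometric trmx_mul trmxK !mulmxA.
apply: GVpos; apply: contraNneq v0 => H.
by rewrite -[v]mulmx1 -trmx1 -QP trmx_mul mulmxA H mul0mx.
Qed.

Lemma cometric_unit : cometric \in unitmx. Proof. exact: posdef_unit cometric_pos. Qed.

Lemma cometric_sym : cometric^T = cometric.
Proof. by rewrite /cometric !trmx_mul trmxK GVsym mulmxA. Qed.

Lemma hmetric_sym : hmetric^T = hmetric.
Proof. by rewrite /hmetric trmx_inv cometric_sym. Qed.

Lemma hprojP : hproj *m P = P.
Proof.
by rewrite /hproj -!mulmxA [P^T *m _]mulmxA -/cometric /hmetric mulVmx ?cometric_unit // mulmx1.
Qed.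

Lemma hprojG : hproj *m G = P *m hmetric *m P^T.
Proof. by rewrite /hproj mulmxKV ?Gunit. Qed.

(* b: the matrix whose rows are an orthonormal basis of the kernel of P *)
Lemma vproj_basis s (b : 'M[R]_(s, r)) : b *m P = 0 -> b *m G *m b^T = 1%:M ->
  (forall w : 'rV[R]_r, w *m P = 0 -> exists p : 'rV[R]_s, w = p *m b) ->
  1%:M - hproj = G *m b^T *m b.
Proof.
move=> bP bG span; apply/row_matrixP => i; set w := row i _.
have wP : w *m P = 0 by rewrite /w -row_mul mulmxBl mul1mx hprojP subrr row0.
have [p wp] := span w wP.
have H : w *m G *m b^T = p by rewrite wp -!mulmxA [b *m _]mulmxA bG mulmx1.
rewrite {1}wp -H /w -!row_mul; congr (row i _); congr (_ *m _).
rewrite mulmxBl mul1mx mulmxBl hprojG -!mulmxA -trmx_mul bP trmx0 !mulmx0 subr0 //.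
Qed.

(* dG, dP: derivatives of G, P along w P; Dv: the Jacobian of x |-> w P(x);
   C: the bracket with the constant section w. *)
Lemma trace_identity (dG C : 'M[R]_r) (dP : 'M[R]_(r, l)) (Dv : 'M[R]_l) s (b : 'M[R]_(s, r)) :
  dG^T = dG -> P *m Dv - dP = C *m P -> 1%:M - hproj = G *m b^T *m b ->
  2^-1 * (\tr (invmx G *m dG) - \tr (hmetric *m (dP^T *m invmx G *m P +
    P^T *m invmx G *m dP - P^T *m invmx G *m dG *m invmx G *m P))) + \tr Dv -
    \tr (invmx G *m dG) - \tr C =
  - (2^-1 * \tr (b *m dG *m b^T)) - \tr (b *m C *m G *m b^T).
Proof.
move=> dGs HC Hb.
have tC : \tr (b *m C *m G *m b^T) = \tr C - \tr (C *m hproj).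
  transitivity (\tr (C *m (1%:M - hproj))); last by rewrite mulmxBr mulmx1 raddfB.
  by rewrite Hb -!mulmxA [LHS]mxtrace_mulC !mulmxA.
have tG : \tr (b *m dG *m b^T) = \tr (invmx G *m dG) - \tr (invmx G *m hproj *m dG).
  transitivity (\tr (invmx G *m (1%:M - hproj) *m dG)); last by rewrite mulmxBr mulmx1 mulmxBl raddfB.
  by rewrite Hb !mulmxA mulVmx ?Gunit // mul1mx [LHS]mxtrace_mulC mulmxA.
have t1 : \tr (hmetric *m (dP^T *m invmx G *m P)) = \tr (hmetric *m (P^T *m invmx G *m dP)).
  rewrite -[LHS]mxtrace_tr !trmx_mul trmxK GVsym hmetric_sym mulmxA [LHS]mxtrace_mulC.
  by rewrite !mulmxA.
(* [dP] is eliminated by the bracket relation [HC]; this produces the trace of [Dv] that cancels the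
   divergence of the leaf components. *)
have t2 : \tr (hmetric *m (P^T *m invmx G *m dP)) = \tr Dv - \tr (C *m hproj).
  have -> : dP = P *m Dv - C *m P by rewrite -HC opprB addrC subrK.
  rewrite mulmxBr mulmxBr raddfB /=; congr (_ - _).
    rewrite mulmxA -/cometric mulmxA -/cometric /hmetric.
    by rewrite -[_ *m P]mulmxA -/cometric mulVmx ?cometric_unit // mul1mx.
  rewrite /hproj -!mulmxA [RHS]mxtrace_mulC -!mulmxA [RHS]mxtrace_mulC.
  by rewrite -!mulmxA.
have t3 : \tr (hmetric *m (P^T *m invmx G *m dG *m invmx G *m P)) = \tr (invmx G *m hproj *m dG).
  rewrite /hproj -!mulmxA [RHS]mxtrace_mulC -!mulmxA [RHS]mxtrace_mulC.
  by rewrite -!mulmxA.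
have -> : \tr (hmetric *m (dP^T *m invmx G *m P +
    P^T *m invmx G *m dP - P^T *m invmx G *m dG *m invmx G *m P)) =
    \tr (hmetric *m (dP^T *m invmx G *m P)) + \tr (hmetric *m (P^T *m invmx G *m dP)) -
    \tr (hmetric *m (P^T *m invmx G *m dG *m invmx G *m P)).
  rewrite -mxtraceD -mulmxDr; have trB n (U V : 'M[R]_n) : \tr U - \tr V = \tr (U - V).
    by rewrite raddfB.
  by rewrite trB -mulmxBr.
rewrite t1 t2 t3 tC tG.
by move: (\tr _) (\tr Dv) (\tr C) (\tr (C *m hproj)) (\tr (invmx G *m hproj *m dG)) => a b' c d f; lra.
Qed.

End LinearAlgebra.

(** * The divergence of the quadratic fibre part of the geodesic field *)

Section SprayTrace.
Variables (R : realType) (r : nat) (G : 'M[R]_r) (A : 'I_r -> 'M[R]_r) (c : 'I_r -> 'M[R]_r).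
Hypotheses (Gsym : G^T = G) (Gu : G \in unitmx).

(* A m: derivative of the Gram matrix along the m-th frame section;
   c m: the row j, column p entry is the product of [e_m, e_j] with e_p. *)
Lemma spray_trace (xi : 'rV[R]_r -> 'rV[R]_r) (w : 'rV[R]_r) :
  (forall m, (A m)^T = A m) -> (forall m j, row j (c m) = - row m (c j)) ->
  (forall u m, (xi u *m G) 0 m = 2^-1 * (\sum_i \sum_j u 0 i * u 0 j * A m i j) -
     \sum_j \sum_p u 0 j * u 0 p * c m j p - \sum_j \sum_i u 0 j * u 0 i * A i j m) ->
  \sum_j 'D_(delta_mx 0 j) (fun u => xi u 0 j) w =
    - \tr (invmx G *m \sum_i w 0 i *: A i) -
      \tr ((\matrix_(m, p) \sum_i w 0 i * c m i p) *m invmx G).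
Proof.
move=> As ca Hxi.
pose eta m (u : 'rV[R]_r) := 2^-1 * (\sum_i \sum_j u 0 i * u 0 j * A m i j) -
     \sum_j \sum_p u 0 j * u 0 p * c m j p - \sum_j \sum_i u 0 j * u 0 i * A i j m.
have xiE j : (fun u => xi u 0 j) = (fun u => \sum_m eta m u * invmx G m j).
  apply/funext => u; rewrite -[xi u in LHS](mulmxK Gu) mxE.
  by apply: eq_bigr => m _; rewrite Hxi.
have su i : smooth_near (fun u : 'rV[R]_r => u 0 i) w by apply: sn_entry; exact: sn_id.
have squad (B : 'I_r -> 'I_r -> R) :
    smooth_near (fun u : 'rV[R]_r => \sum_i \sum_j u 0 i * u 0 j * B i j) w.
  apply: sn_sum => i _; apply: sn_sum => j _.
  by apply: snM; [exact: snM | exact: sn_cst].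
have dquad (B : 'I_r -> 'I_r -> R) k :
    'D_(delta_mx 0 k) (fun u : 'rV[R]_r => \sum_i \sum_j u 0 i * u 0 j * B i j) w =
    \sum_j w 0 j * (B k j + B j k).
  have du i : 'D_(delta_mx 0 k) (fun u : 'rV[R]_r => u 0 i) w = (i == k)%:R.
    have := @sn_derive_mx R _ _ _ id w (delta_mx 0 k) 0 i (sn_id _).
    by rewrite derive_id => <-; rewrite mxE eqxx.
  rewrite derive_sn_sum => [|i]; last first.
    by apply: sn_sum => j _; apply: snM; [exact: snM | exact: sn_cst].
  transitivity (\sum_i \sum_j ((i == k)%:R * (w 0 j * B i j) + (j == k)%:R * (w 0 i * B i j))).
    apply: eq_bigr => i _; rewrite derive_sn_sum => [|j]; last first.
      by apply: snM; [exact: snM | exact: sn_cst].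
    apply: eq_bigr => j _; rewrite derive_snM; [|exact: snM|exact: sn_cst].
    by rewrite derive_cst mulr0 addr0 derive_snM // !du; ring.
  under eq_bigr do rewrite big_split /=.
  rewrite big_split /=.
  under [RHS]eq_bigr do rewrite mulrDr.
  rewrite big_split /=; congr (_ + _).
    rewrite (bigD1 k) //= [X in _ + X]big1 ?addr0 => [|i ik].
      by apply: eq_bigr => j _; rewrite eqxx mul1r.
    by apply: big1 => j _; rewrite (negbTE ik) mul0r.
  apply: eq_bigr => i _; rewrite (bigD1 k) //= eqxx mul1r big1 ?addr0 // => j jk.
  by rewrite (negbTE jk) mul0r.
have snN (f : 'rV[R]_r -> R) : smooth_near f w -> smooth_near (fun u => - f u) w.
  move=> sf; have -> : (fun u => - f u) = (fun u => (-1) * f u).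
    by apply/funext => u; rewrite mulN1r.
  by apply: snM => //; exact: sn_cst.
have s1 m : smooth_near (fun u : 'rV[R]_r => 2^-1 * (\sum_i \sum_j u 0 i * u 0 j * A m i j)) w.
  by apply: snM; [exact: sn_cst | exact: squad].
have s2 m : smooth_near (fun u : 'rV[R]_r => \sum_j \sum_p u 0 j * u 0 p * c m j p) w.
  exact: squad.
have s3 m : smooth_near (fun u : 'rV[R]_r => \sum_j \sum_i u 0 j * u 0 i * A i j m) w.
  exact: (squad (fun j i => A i j m)).
have seta m : smooth_near (eta m) w.
  by apply: snD; [apply: snD; [exact: s1 | exact/snN/s2] | exact/snN/s3].
have deta m k : 'D_(delta_mx 0 k) (eta m) w =
    \sum_j w 0 j * (A m k j - (c m k j + c m j k) - (A j k m + A k j m)).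
  rewrite /eta [LHS]deriveB; [|by apply: sn_derivable; apply: snD; [exact: s1|exact/snN/s2]
    |by apply: sn_derivable; exact: s3].
  rewrite deriveB; [|exact: sn_derivable..].
  rewrite derive_snM ?derive_cst ?mul0r ?add0r; [|exact: sn_cst|exact: squad].
  rewrite !dquad mulr_sumr -!sumrB.
  apply: eq_bigr => j _; have -> : A m j k = A m k j by rewrite -{1}(As m) mxE.
  by field.
transitivity (\sum_k \sum_m (\sum_j w 0 j * (A m k j - (c m k j + c m j k) - (A j k m + A k j m))) * invmx G m k).
  apply: eq_bigr => k _; rewrite xiE derive_sn_sum => [|m]; last by apply: snM => //; exact: sn_cst.
  apply: eq_bigr => m _; rewrite derive_snM ?derive_cst ?mulr0 ?addr0 ?deta //; exact: sn_cst.
have GVs m k : invmx G m k = invmx G k m.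
  by rewrite -[in LHS](trmxK (invmx G)) trmx_inv Gsym mxE.
have Asw m i j : A m i j = A m j i by rewrite -{1}(As m) mxE.
have canti m k j : c m k j = - c k m j.
  by have /rowP/(_ j) := ca m k; rewrite !mxE.
(* A skew array contracted with the symmetric inverse Gram matrix gives zero. *)
have sym0 (F : 'I_r -> 'I_r -> R) : (forall m k, F m k = - F k m) ->
    \sum_k \sum_m F m k * invmx G m k = 0.
  move=> Fa; set S := \sum_k _.
  have : S = - S.
    rewrite {1}/S exchange_big /= /S -sumrN; apply: eq_bigr => k _.
    by rewrite -sumrN; apply: eq_bigr => m _; rewrite Fa GVs mulNr.
  by move/eqP; rewrite -addr_eq0 -mulr2n mulrn_eq0 /= => /eqP.
(* The part of the derivative of [eta] that is skew in (m, k); what is left over are the two traces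
   of the statement. *)
have z1 : \sum_k \sum_m (\sum_j w 0 j * (A m k j - A k j m - c m k j)) * invmx G m k = 0.
  apply: (sym0 (fun m k => \sum_j w 0 j * (A m k j - A k j m - c m k j))) => m k.
  rewrite -sumrN; apply: eq_bigr => j _.
  by rewrite (canti m k) (Asw m j k) (Asw k j m); ring.
have -> : \tr (invmx G *m \sum_i w 0 i *: A i) =
    \sum_k \sum_m (\sum_j w 0 j * A j k m) * invmx G m k.
  rewrite mxtrace_mulC /mxtrace; apply: eq_bigr => k _; rewrite mxE.
  apply: eq_bigr => m _; rewrite summxE; congr (_ * _).
  by apply: eq_bigr => j _; rewrite mxE.
have -> : \tr ((\matrix_(m, p) \sum_i w 0 i * c m i p) *m invmx G) =
    \sum_k \sum_m (\sum_j w 0 j * c m j k) * invmx G m k.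
  rewrite /mxtrace exchange_big /=; apply: eq_bigr => m _; rewrite mxE.
  by apply: eq_bigr => k _; rewrite mxE GVs.
rewrite -sumrN -sumrB -[RHS]addr0 -[X in _ + X]z1 -big_split /=.
apply: eq_bigr => k _; rewrite -sumrN -sumrB -big_split /=.
apply: eq_bigr => m _; rewrite -!mulNr -!mulrDl; congr (_ * _).
rewrite -!sumrN -!big_split /=; apply: eq_bigr => j _.
by ring.
Qed.

End SprayTrace.

(** * The restriction to a leaf *)

(** The segment from the identity to [H] consists of positive definite, hence invertible matrices,
    so the determinant cannot change sign along it. *)
Lemma posdef_det (R : realType) n (H : 'M[R]_n) :
  (forall u : 'rV[R]_n, u != 0 -> 0 < (u *m H *m u^T) 0 0) -> 0 < \det H.
Proof.
move=> Hp; rewrite ltNge; apply/negP => d0.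
pose F (t : R) : 'M[R]_n := t *: H + (1 - t) *: 1%:M.
have cF : continuous (fun t => \det (F t)).
  move=> t; apply: sn_cont; apply: sn_det; apply: sn_mx => i j.
  rewrite /F; under eq_fun do rewrite !mxE.
  apply: snD; first by apply: snM; [exact: sn_id|exact: sn_cst].
  apply: snM; last exact: sn_cst.
  apply: snD; first exact: sn_cst.
  have -> : (-%R : R -> R) = fun t => (-1) * t by apply/funext => s; rewrite mulN1r.
  by apply: snM; [exact: sn_cst|exact: sn_id].
have F0 : \det (F 0) = 1 by rewrite /F scale0r add0r subr0 scale1r det1.
have F1 : \det (F 1) = \det H by rewrite /F scale1r subrr scale0r addr0.
have [||t] := @IVT R (fun t => \det (F t)) 0 1 0 ler01.
- exact: continuous_subspaceT.
- by rewrite F0 F1 ge_min le_max d0 ler01 orbT.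
rewrite in_itv /= => /andP[t0 t1] Ft.
have : F t \in unitmx.
  apply: posdef_unit => u u0.
  have -> : u *m F t *m u^T = t *: (u *m H *m u^T) + (1 - t) *: (u *m u^T).
    by rewrite /F mulmxDr mulmxDl -!scalemxAr -!scalemxAl mulmx1.
  have nu : 0 < (u *m u^T) 0 0.
    have -> : (u *m u^T) 0 0 = \sum_i u 0 i ^+ 2.
      by rewrite mxE; apply: eq_bigr => i _; rewrite mxE.
    rewrite lt_neqAle sumr_ge0 ?andbT => [|i _]; last exact: sqr_ge0.
    apply: contraNneq u0 => /esym /eqP; rewrite psumr_eq0 => [/allP H0|i _]; last exact: sqr_ge0.
    apply/eqP/rowP => i; rewrite mxE; apply/eqP; rewrite -sqrf_eq0.
    exact: (implyP (H0 i (mem_index_enum i)) isT).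
  rewrite !mxE in nu *; have := Hp u u0; rewrite mxE.
  move: t0; rewrite le_eqVlt => /orP[/eqP <- |t0] Hu; first by rewrite mul0r add0r subr0 mul1r.
  by apply: ltr_pwDl; [exact: mulr_gt0 | apply: mulr_ge0; [rewrite subr_ge0 | exact: ltW]].
by rewrite unitmxE Ft unitr0.
Qed.

(** [trace_on] chooses among all bases, of lengths that are not known to agree. The two
    change-of-basis matrices are inverse to each other on both sides and conjugate [m'] into [m];
    coordinates are rows, hence the transposes. *)
Lemma trace_on_basis (R : realType) (V : lmodType R) (S : set V) (f : V -> V) s
    (b : 'I_s -> V) (m : 'M[R]_s) :
  is_basis S b -> (forall p : 'I_s -> R, f (\sum_i p i *: b i) = \sum_i p i *: f (b i)) ->
  (forall j, f (b j) = \sum_i m i j *: b i) -> trace_on S f = \tr m.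
Proof.
move=> bb fl fm; have [bS bs bf] := bb.
apply: xget_unique; first by exists s, b, m.
move=> _ [s' [b' [m' [[b'S b's b'f] fm' ->]]]].
have [p pE] := choice (fun j => bs _ (b'S j)); have [q qE] := choice (fun i => b's _ (bS i)).
pose B (n : nat) (c : 'I_n -> V) (u : 'rV[R]_n) := \sum_i u 0 i *: c i.
have Binj (u v : 'rV[R]_s) : B s b u = B s b v -> u = v.
  move=> /eqP; rewrite -subr_eq0 -sumrB => /eqP H; apply/rowP => i; apply/eqP; rewrite -subr_eq0; apply/eqP.
  by move: i; apply: bf; rewrite -[RHS]H; apply: eq_bigr => i _; rewrite scalerBl.
have Binj' (u v : 'rV[R]_s') : B s' b' u = B s' b' v -> u = v.
  move=> /eqP; rewrite -subr_eq0 -sumrB => /eqP H; apply/rowP => i; apply/eqP; rewrite -subr_eq0; apply/eqP.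
  by move: i; apply: b'f; rewrite -[RHS]H; apply: eq_bigr => i _; rewrite scalerBl.
pose Pm : 'M[R]_(s', s) := \matrix_(j, i) p j i; pose Qm : 'M[R]_(s, s') := \matrix_(i, j) q i j.
have Blin n n' (c : 'I_n -> V) (c' : 'I_n' -> V) (N : 'M[R]_(n', n)) (u : 'rV[R]_n') :
    (forall j, c' j = \sum_i N j i *: c i) -> B n' c' u = B n c (u *m N).
  move=> cN; rewrite /B; under eq_bigr do rewrite cN scaler_sumr.
  rewrite exchange_big /=; apply: eq_bigr => i _; rewrite mxE scaler_suml.
  by apply: eq_bigr => j _; rewrite scalerA.
have B'E u : B s' b' u = B s b (u *m Pm).
  by apply: Blin => j; rewrite pE; apply: eq_bigr => i _; rewrite mxE.
have BE u : B s b u = B s' b' (u *m Qm).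
  by apply: Blin => j; rewrite qE; apply: eq_bigr => i _; rewrite mxE.
have QP : Qm *m Pm = 1%:M.
  by apply/row_matrixP => i; rewrite row_mul row1; apply: Binj; rewrite -B'E rowE -BE.
have fB (u : 'rV[R]_s) : f (B s b u) = B s b (u *m m^T).
  rewrite fl; apply: Blin => j; rewrite fm; by apply: eq_bigr => i _; rewrite mxE.
have PM : m'^T *m Pm = Pm *m m^T.
  apply/row_matrixP => j; rewrite !row_mul; apply: Binj; rewrite -B'E -fB.
  have -> : B s b (row j Pm) = b' j by rewrite pE; apply: eq_bigr => i _; rewrite !mxE.
  by rewrite fm'; apply: eq_bigr => i _; rewrite !mxE.
have PQ : Pm *m Qm = 1%:M.
  by apply/row_matrixP => i; rewrite row_mul row1; apply: Binj'; rewrite -BE rowE -B'E.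
rewrite -[LHS]mxtrace_tr -[RHS]mxtrace_tr -[m'^T]mulmx1 -PQ mulmxA PM -mulmxA mxtrace_mulC.
by rewrite -mulmxA QP mulmx1.
Qed.

(* smooth_map_at, smooth_fun_at, smooth_section and teq unfold to products,
   whose arguments would otherwise become implicit. *)
Arguments sm_comp {R V W X M N Q MA NA QA F G x} _ _ _ _ _.
Arguments sf_comp {R V W M N MA NA F f x} _ _ _ _.
Arguments sm1 {R V W M N MA NA} cM cN {F x i j} _ _ _ _.
Arguments sm_congr {R V W M N MA NA} cM {F G x} _ _.
Arguments sm_id {R V M MA} x _.
Arguments sf1 {R V M MA} cM {f x i} _ _.
Arguments sf_cst {R V M MA} cM c x.
Arguments sfD {R V M MA} cM {f h x} _ _.
Arguments sfM {R V M MA} cM {f h x} _ _.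
Arguments sf_sum {R V M MA} cM {I r P f x} _.
Arguments sf_congr {R V M MA} cM {f h x} _ _.
Arguments sm_coord {R n M MA} cM {i x} _.
Arguments sm_inv {R n M MA} cM {i x} _.
Arguments sf_coord {R n M MA} cM {i x k} _.
Arguments tangentE {R n M MA} cM {x Z i} _ _.
Arguments sm_bproj {R n r M MA A tA} cM bA a.
Arguments sf_fib {R n r M MA A tA} cM bA {k a j} _.
Arguments sm_tot {R n r M MA A tA} cM bA {V N NA F x} k _ _ _ _.
Arguments sect_coord {R n r M MA A tA} cM bA {s k x} j _ _.
Arguments sect1 {R n r M MA A tA} cM bA {s k x} _ _.
Arguments sect_fib {R n r M MA A tA} cM bA {k x} w _.
Arguments sf_sp {R n r M A} g {a b} x _ _.
Arguments sf_G {R n r M A} g {x e} _ i j.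
Arguments sf_co {R n r M A k x} _ s j _.

(** * The bundle over the leaf *)

Section LeafBundle.
Variables (R : realType) (n r : nat) (M : manifold R n) (A : vbundle M r).
Variables (l : nat) (L : manifold R l) (iota : L -> M).
Hypothesis si : forall y, smooth_map_at (matlas L) (matlas M) iota y.
Let cM := manifold_charted (mfdP M).
Let cL := manifold_charted (mfdP L).
Let bA := bundleP A.
Let cA := tot_charted cM bA.

Lemma restr_bundle : is_bundle (matlas L) (restr_trivs A iota).
Proof.
have tn (k : tidx (btrivs A)) y : tdom k (iota y) -> mnear (matlas L) y (fun z => tdom k (iota z)).
  by move=> ky; exact: (sm_mnear cL cM (@si y) (tdom_near cM bA ky)).
split => /=.
- by move=> y; exact: (bdl_cover bA (iota y)).
- by move=> k; apply: (mnear_mopen cL) => y; exact: tn.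
- by move=> k y ky; exact: (bdl_lin bA ky).
- by move=> k y ky u; exact: (bdl_coordK bA ky).
- by move=> k y ky w; exact: (bdl_fibK bA ky).
- move=> k k' y ky ky' w.
  have cF := @flat_charted R 'rV[R]_r (fdim_rV R r).
  exact: (sm_comp cL cM cF (@si y) (@bdl_transition _ _ _ _ _ _ _ bA k k' _ ky ky' w)).
Qed.

Lemma restr_charted : charted (restr_atlas A iota).
Proof. exact: (tot_charted cL restr_bundle). Qed.

Lemma sm_restr_incl (a : totspace (restr_fib A iota)) :
  smooth_map_at (restr_atlas A iota) (total_atlas (matlas M) (btrivs A))
    (@restr_incl R n r M A l L iota) a.
Proof.
have [k ka] := bdl_cover bA (iota (bproj a)).
apply: (sm_tot cM bA k restr_charted).
- exact: (sm_comp restr_charted cL cM (sm_bproj cL restr_bundle a) (@si (bproj a))).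
- exact: ka.
- by move=> j; exact: (sf_fib cL restr_bundle (k := k : tidx (restr_trivs A iota)) ka).
Qed.

Lemma sf_iota f y : smooth_fun_at (matlas M) f (iota y) ->
  smooth_fun_at (matlas L) (fun z => f (iota z)) y.
Proof. by move=> sf; exact: (sf_comp cL cM (@si y) sf). Qed.

End LeafBundle.
Arguments restr_bundle {R n r M} A {l L iota} si.
Arguments restr_charted {R n r M} A {l L iota} si.
Arguments sm_restr_incl {R n r M} A {l L iota} si a.
Arguments sf_iota {R n M l L iota} si {f y} _.

(** * Anchor, metric and projections in coordinates of the leaf *)

Section LeafFrame.
Variables (R : realType) (n r : nat) (M : manifold R n) (A : vbundle M r).
Variables (LA : lie_algebroid A) (g : riem_metric A).
Notation sect := (forall x : M, A x).
Notation smooth_sect := (smooth_section (matlas M) (btrivs A)).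
Notation totA := (total_atlas (matlas M) (btrivs A)).
Notation sfun := (smooth_fun_at (matlas M)).
Variable D : sect -> sect -> sect.
Hypothesis hD : is_levi_civita LA g D.
Variables (l : nat) (L : manifold R l) (iota : L -> M).
Hypothesis hL : integral_manifold LA iota.
Variable X : totspace A -> tvec R (totspace A).
Hypothesis hX : is_geodesic_field LA D X.
Variable XL : totspace (restr_fib A iota) -> tvec R (totspace (restr_fib A iota)).
Hypothesis hXL : restricts_to X XL.
Notation AL := (restr_fib A iota).
Notation totL := (restr_atlas A iota).
Notation sfL := (smooth_fun_at (matlas L)).
Let cM := manifold_charted (mfdP M).
Let cL := manifold_charted (mfdP L).
Let bA := bundleP A.
Let cA := tot_charted cM bA.
Let si := im_smooth hL.
Let bL := restr_bundle A si.
Let cAL : charted totL := restr_charted A si.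

(* The geodesic field projects onto the anchor, so XL yields a smooth lift of
   the anchor to the leaf; in the chart c it is the row vector Pvec c u. *)
Definition Pvec (c : cidx (matlas L)) (y : L) (u : A (iota y)) : 'rV[R]_l :=
  tcoords c (push (@bproj R L AL) (XL (@elt R L AL y u))).
Arguments Pvec c [y] u.

Lemma XL_tangent a : is_tangent totL a (XL a).
Proof. by have [[tX _] _] := hXL. Qed.

Lemma leaf_anchor (c : cidx (matlas L)) y (u : A (iota y)) f : cdom c y -> sfun f (iota y) ->
  anchor LA u f = tvec_of c y (Pvec c u) (fun z => f (iota z)).
Proof.
move=> cy sf.
have [E1 _] := geodesic_field_main hD hX (elt u).
rewrite -(E1 f sf).
have sfb : smooth_fun_at totA (fun b => f (bproj b)) (elt u).
  exact: (sf_comp cA cM (sm_bproj cM bA (elt u)) sf).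
have [_ /(_ (@elt R L AL y u) _ sfb) <-] := hXL.
have sp : smooth_map_at totL (matlas L) (@bproj R L AL) (@elt R L AL y u).
  exact: (sm_bproj cL bL _).
have tp : is_tangent (matlas L) y (push (@bproj R L AL) (XL (@elt R L AL y u))).
  exact: (push_tangent cAL cL sp (XL_tangent _)).
exact: (tangentE cL tp cy _ (sf_iota si sf)).
Qed.

(** The immersion property in coordinates: a tangent vector of the leaf is determined by its effect
    on functions pulled back from [M]. It transfers identities for the anchor to the leaf. *)
Lemma imm_eq (c : cidx (matlas L)) y v v' : cdom c y ->
  (forall f, sfun f (iota y) -> tvec_of c y v (fun z => f (iota z)) = tvec_of c y v' (fun z => f (iota z))) ->
  v = v'.
Proof.
move=> cy H; apply/eqP; rewrite -subr_eq0; apply/eqP.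
have E f : smooth_fun_at (matlas L) f y -> tvec_of c y (v - v') f = tvec_of c y v f - tvec_of c y v' f.
  by move=> sf; rewrite -scaleN1r addrC tvec_of_lin // mulN1r addrC.
have Z := im_immersion hL (tangent_of cL (v - v') cy).
rewrite -[LHS](tvec_of_coord cL (v - v') cy); apply/rowP => k; rewrite !mxE.
apply: Z; last exact: (sf_coord cL cy).
by move=> f sf; rewrite /push [LHS](E _ (sf_iota si sf)) (H _ sf) subrr.
Qed.

(** Linearity along the fibres is not part of what is known of [XL]; it comes from the anchor,
    through the immersion. *)
Lemma Pvec_lin (c : cidx (matlas L)) y k (u v : A (iota y)) : cdom c y ->
  Pvec c (k *: u + v) = k *: Pvec c u + Pvec c v.
Proof.
move=> cy; apply: (imm_eq cy) => f sf.
rewrite -leaf_anchor // tvec_of_lin //; last exact: (sf_iota si sf).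
by rewrite -!leaf_anchor // anchor_lin.
Qed.

Lemma isotropyP (c : cidx (matlas L)) y (u : A (iota y)) : cdom c y ->
  isotropy LA (iota y) u <-> Pvec c u = 0.
Proof.
move=> cy; split => H.
  apply: (imm_eq cy) => f sf; rewrite -leaf_anchor // H //.
  by rewrite /tvec_of derive0.
by move=> f sf; rewrite (leaf_anchor u cy sf) H /tvec_of derive0.
Qed.

Lemma anchor_lift (c : cidx (matlas L)) y (u : A (iota y)) (Y : tvec R L) : cdom c y ->
  is_tangent (matlas L) y Y ->
  teq (matlas M) (iota y) (push iota Y) (anchor LA u) <-> Pvec c u = tcoords c Y.
Proof.
move=> cy tY; split => H.
  apply: (imm_eq cy) => f sf; rewrite -leaf_anchor // -(H f sf).
  exact: (tangentE cL tY cy _ (sf_iota si sf)).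
move=> f sf; rewrite (leaf_anchor u cy sf) H.
exact: (tangentE cL tY cy _ (sf_iota si sf)).
Qed.

Lemma Pvec_surj (c : cidx (matlas L)) y v : cdom c y -> exists u : A (iota y), Pvec c u = v.
Proof.
move=> cy; have tY := tangent_of cL v cy.
have [u Hu] := im_sub hL tY; exists u.
by rewrite (proj1 (anchor_lift u cy tY) Hu) (tvec_of_coord cL).
Qed.

Section Point.
Variables (c : cidx (matlas L)) (k : tidx (btrivs A)).

Definition Pmx (y : L) : 'M[R]_(r, l) :=
  \matrix_(j, q) Pvec c (tfib k (iota y) (delta_mx 0 j)) 0 q.
Definition Gmx (x : M) : 'M[R]_r :=
  \matrix_(i, j) g x (tfib k x (delta_mx 0 i)) (tfib k x (delta_mx 0 j)).

Lemma sp_mx x (u w : A x) : tdom k x ->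
  g x u w = (tcoord k u *m Gmx x *m (tcoord k w)^T) 0 0.
Proof.
move=> kx; rewrite {1}(fib_expand bA u kx) {1}(fib_expand bA w kx) sp_sum !mxE.
under eq_bigr do rewrite sp_scale sp_sumr.
under [RHS]eq_bigr do rewrite !mxE mulr_suml.
rewrite exchange_big /=; apply: eq_bigr => i _; rewrite mulr_sumr.
by apply: eq_bigr => j _; rewrite sp_scaler !mxE; ring.
Qed.

Lemma Gmx_sym x : (Gmx x)^T = Gmx x.
Proof. by apply/matrixP => i j; rewrite !mxE sp_sym. Qed.

Lemma Gmx_pos x (v : 'rV[R]_r) : tdom k x -> v != 0 -> 0 < (v *m Gmx x *m v^T) 0 0.
Proof.
move=> kx v0; have := @sp_mx x (tfib k x v) (tfib k x v) kx.
rewrite (bdl_fibK bA kx) => <-; apply: sp_pos; apply: contraNneq v0 => H.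
by rewrite -(bdl_fibK bA kx v) H (tcoord0 bA).
Qed.

Variable y : L.
Hypotheses (cy : cdom c y) (ky : tdom k (iota y)).
Notation P := (Pmx y).
Notation G := (Gmx (iota y)).

Lemma Pvec_mx (u : A (iota y)) : Pvec c u = tcoord k u *m P.
Proof.
have P0 : Pvec c (0 : A (iota y)) = 0.
  have := @Pvec_lin c y (-1) 0 0 cy; rewrite scaler0 addr0 => ->.
  by rewrite scaleN1r addNr.
have Psum (s : seq 'I_r) (p : 'I_r -> R) (v : 'I_r -> A (iota y)) :
    Pvec c (\sum_(i <- s) p i *: v i) = \sum_(i <- s) p i *: Pvec c (v i).
  by elim: s => [|i s IH]; rewrite ?big_nil // !big_cons Pvec_lin // IH.
rewrite {1}(fib_expand bA u ky) Psum; apply/rowP => q.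
rewrite summxE mxE; apply: eq_bigr => j _; by rewrite !mxE.
Qed.

Lemma Pmx_full : exists Q : 'M[R]_(l, r), Q *m P = 1%:M.
Proof.
have [u uP] := choice (fun q => @Pvec_surj c y (delta_mx 0 q) cy).
exists (\matrix_q tcoord k (u q)).
by apply/row_matrixP => q; rewrite row_mul row1 -uP Pvec_mx rowK.
Qed.

Notation Pi := (hproj P G).

Lemma horizontal_iso0 (u : A (iota y)) : horizontal LA g u -> isotropy LA (iota y) u -> u = 0.
Proof.
move=> hu iu; apply/eqP; apply: contraT => /(sp_pos g).
by rewrite hu // ltxx.
Qed.

Lemma horizontal_sub (x : M) (u v : A x) : horizontal LA g u -> horizontal LA g v -> horizontal LA g (u - v).
Proof. by move=> hu hv w iw; rewrite sp_add sp_opp hu // hv // subrr. Qed.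

(** The right-hand side defines a vertical vector with horizontal difference, and such a vector is
    unique because a vector both vertical and horizontal has length zero. *)
Lemma vpart_coord (u : A (iota y)) : tcoord k (vpart LA g u) = tcoord k u *m (1%:M - Pi).
Proof.
have [Q QP] := Pmx_full.
have Gs := Gmx_sym (iota y); have Gp := fun v => @Gmx_pos (iota y) v ky.
pose v := tfib k (iota y) (tcoord k u *m (1%:M - Pi)).
have cv : tcoord k v = tcoord k u *m (1%:M - Pi) by exact: (bdl_fibK bA ky).
suff -> : vpart LA g u = v by [].
have iv : isotropy LA (iota y) v.
  by apply/(isotropyP v cy); rewrite Pvec_mx cv -mulmxA mulmxBl mul1mx (hprojP Gs Gp QP) subrr mulmx0.
have hv : horizontal LA g (u - v).
  move=> w /(isotropyP w cy); rewrite Pvec_mx => wP.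
  rewrite sp_mx // (tcoordB bA) // cv mulmxBr mulmx1 opprB addrC subrK -[X in X *m _]mulmxA (hprojG _ Gp).
  by rewrite !mulmxA -mulmxA -trmx_mul wP trmx0 mulmx0 mxE.
apply: xget_unique => // v' [iv' hv'].
apply/eqP; rewrite -subr_eq0; apply/eqP; apply: horizontal_iso0.
  have -> : v' - v = (u - v) - (u - v') by rewrite opprB [RHS]addrC addrA subrK.
  exact: horizontal_sub.
apply/(isotropyP _ cy); rewrite Pvec_mx (tcoordB bA) // mulmxBl -!Pvec_mx.
by rewrite (proj1 (isotropyP v cy) iv) (proj1 (isotropyP v' cy) iv') subrr.
Qed.

Lemma hpart_coord (u : A (iota y)) : tcoord k (hpart LA g u) = tcoord k u *m Pi.
Proof.
by rewrite /hpart (tcoordB bA) // vpart_coord mulmxBr mulmx1 opprB addrC subrK.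
Qed.

(** The horizontal lift of v is v h P^T G^-1 with h = [hmetric P G]. The product of two lifts
    collapses since h is inverse to P^T G^-1 P. *)
Lemma leaf_metric_coord (Y Z : tvec R L) : is_tangent (matlas L) y Y -> is_tangent (matlas L) y Z ->
  leaf_metric LA g iota y Y Z = (tcoords c Y *m hmetric P G *m (tcoords c Z)^T) 0 0.
Proof.
move=> tY tZ; have [Q QP] := Pmx_full.
have Gs := Gmx_sym (iota y); have Gp := fun v => @Gmx_pos (iota y) v ky.
have lift V : is_tangent (matlas L) y V -> exists u : A (iota y),
    [/\ horizontal LA g u, teq (matlas M) (iota y) (push iota V) (anchor LA u),
        tcoord k u = tcoords c V *m hmetric P G *m P^T *m invmx G &
        forall u', horizontal LA g u' -> teq (matlas M) (iota y) (push iota V) (anchor LA u') -> u' = u].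
  move=> tV; pose u := tfib k (iota y) (tcoords c V *m hmetric P G *m P^T *m invmx G).
  have cu : tcoord k u = tcoords c V *m hmetric P G *m P^T *m invmx G by exact: (bdl_fibK bA ky).
  have hu : horizontal LA g u.
    move=> w /(isotropyP w cy); rewrite Pvec_mx => wP.
    rewrite sp_mx // cu mulmxKV ?(Gunit Gp) // -!mulmxA -trmx_mul wP trmx0 !mulmx0 mxE //.
  have au : Pvec c u = tcoords c V.
    rewrite Pvec_mx cu -!mulmxA [P^T *m _]mulmxA -/(cometric P G).
    by rewrite mulmxA mulmxKV ?(cometric_unit Gs Gp QP).
  exists u; split => //; first by apply/(anchor_lift u cy tV).
  move=> u' hu' /(anchor_lift u' cy tV) au'; apply/eqP; rewrite -subr_eq0; apply/eqP.
  apply: horizontal_iso0; first exact: horizontal_sub.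
  by apply/(isotropyP _ cy); rewrite Pvec_mx (tcoordB bA) // mulmxBl -!Pvec_mx au au' subrr.
have [u [hu tu cu uu]] := lift Y tY; have [w [hw tw cw uw]] := lift Z tZ.
have E : g (iota y) u w = (tcoords c Y *m hmetric P G *m (tcoords c Z)^T) 0 0.
  rewrite sp_mx // cu cw mulmxKV ?(Gunit Gp) // !trmx_mul trmxK (GVsym Gs) (hmetric_sym _ Gs).
  congr (_ _ 0 0); rewrite !mulmxA; congr (_ *m _).
  rewrite -[_ *m P^T *m _]mulmxA -[_ *m (P^T *m _) *m _]mulmxA -/(cometric P G).
  by rewrite -[_ *m cometric P G *m _]mulmxA /hmetric mulmxV ?(cometric_unit Gs Gp QP) // mulmx1.
apply: xget_unique; first by exists u, w; split.
by move=> rho [u' [w' [hu' hw' tu' tw' ->]]]; rewrite (uu _ hu' tu') (uw _ hw' tw').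
Qed.

End Point.

(** * The map K on the fibre directions *)

Section Sasaki.
Variables (c : cidx (matlas L)) (k : tidx (btrivs A)).
Let ck : cidx totL := (c, k).

Lemma partial_tangent (a : totspace AL) q : cdom ck a ->
  is_tangent totL a (partial_vec (MA := totL) ck q a).
Proof. by move=> Ha; exact: (tangent_of cAL (delta_mx 0 q) Ha). Qed.

Lemma partial_rshift_bproj (a : totspace AL) j (f : L -> R) :
  partial_vec (MA := totL) ck (rshift l j) a (fun b => f (bproj b)) = 0.
Proof.
rewrite /partial_vec -(@derive_cst R _ _ (f (cinv c (lsubmx (ccoord ck a)))) (delta_mx 0 (rshift l j)) (ccoord ck a)).
apply: derive_line; near=> t => /=.
congr (f (cinv c _)); apply/rowP => q; rewrite !mxE /=.
by rewrite eq_lrshift mulr0 add0r.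
Unshelve. all: by end_near. Qed.

Lemma partial_rshift_fib (a : totspace AL) j m : cdom ck a ->
  partial_vec (MA := totL) ck (rshift l j) a (fun b => tcoord k (fib_elt b) 0 m) = (j == m)%:R.
Proof.
move=> Ha.
have -> : (fun b : totspace AL => tcoord k (fib_elt b) 0 m) = fun b => ccoord ck b 0 (rshift l m).
  by apply/funext => b; rewrite row_mxEr.
transitivity (tcoords ck (tvec_of ck a (delta_mx 0 (rshift l j))) 0 (rshift l m)).
  by rewrite mxE.
by rewrite (tvec_of_coord cAL _ Ha) mxE eqxx eq_shift eq_sym.
Qed.

Lemma partial_bproj (a : totspace AL) q : cdom ck a ->
  tcoords c (push (@bproj R L AL) (partial_vec (MA := totL) ck q a)) = lsubmx (delta_mx 0 q).
Proof.
move=> Ha; rewrite -(tvec_of_coord cAL (delta_mx 0 q) Ha); apply/rowP => p; rewrite !mxE.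
rewrite /push; congr (partial_vec (MA := totL) ck q a _).
by apply/funext => b; rewrite /= row_mxEl.
Qed.

Lemma curve_of_fibre y (w v : 'rV[R]_r) (t : R) : tdom k (iota y) ->
  smooth_map_at (real_line R) totL (fun s : R => @elt R L AL y (tfib k (iota y) (w + s *: v))) t.
Proof.
move=> ky.
have cR : charted (real_line R) := real_charted R.
have s0 : smooth_map_at (real_line R) (matlas L) (fun _ : R => y) t.
  have [i iy] := ch_cover cL y.
  refine (sm1 cR cL (i := tt : cidx (real_line R)) (j := i) I iy _ _).
    by near=> s; exact: iy.
  exact: sn_cst.
refine (sm_tot cL bL (F := fun s : R => @elt R L AL y (tfib k (iota y) (w + s *: v)))
  (k : tidx (restr_trivs A iota)) cR s0 ky _) => j.
apply/sf_realline => /=.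
have -> : (fun s : R => tcoord k (tfib k (iota y) (w + s *: v)) 0 j) = fun s => w 0 j + s * v 0 j.
  by apply/funext => s; rewrite (bdl_fibK bA ky) !mxE.
apply: snD; first exact: sn_cst.
by apply: snM; [exact: sn_id | exact: sn_cst].
Unshelve. all: by end_near. Qed.

Lemma local_frame_of (e : 'I_r -> sect) x : (forall j, smooth_sect (e j)) ->
  mnear (matlas M) x (fun y => tdom k y /\ forall j, e j y = tfib k y (delta_mx 0 j)) ->
  local_frame e x.
Proof.
move=> se fe; split => //.
exists [set x | mnear (matlas M) x (fun y => tdom k y /\ forall j, e j y = tfib k y (delta_mx 0 j))].
split => //; first by apply: (mnear_mopen cM) => y; exact: mnear_mnear.
move=> y /(mnear_self cM) [ky ey].
have -> : (fun i => e i y) = fun i => tfib k y (delta_mx 0 i) by apply/funext.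
exact: (fib_basis bA ky).
Qed.

(* A vertical vector is the velocity of a straight line in a fibre, along
   which alpha = 0 and D reduces to the derivative of the coordinates. *)
Lemma sasaki_K_fibre (a : totspace AL) j : cdom ck a ->
  sasaki_K LA g D a (partial_vec (MA := totL) ck (rshift l j) a) =
  tfib k (iota (bproj a)) (delta_mx 0 j).
Proof.
move=> Ha; have [ca ka] : cdom c (bproj a) /\ tdom k (iota (bproj a)) by [].
have cR : charted (real_line R) := real_charted R.
pose Z := partial_vec (MA := totL) ck (rshift l j) a.
rewrite -/Z.
have tcb m : smooth_fun_at totL (fun b => tcoord k (fib_elt b) 0 m) a.
  exact: (sf_fib cL bL (k := k : tidx (restr_trivs A iota)) ka).
(* Stated for a variable [a'] so that the equation [curve_in beta 0 = a'] can be substituted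
   although the fibres depend on the base point. *)
have uni (a' : totspace AL) (h : R -> L) (beta alpha : forall t, AL (h t)) (k0 : AL (h 0)) :
    curve_in beta 0 = a' -> cdom ck a' ->
    smooth_map_at (real_line R) totL (curve_in beta) 0 ->
    teq totL a' (partial_vec (MA := totL) ck (rshift l j) a') (velocity (curve_in beta) 0) ->
    @is_apath R n r M A LA (iota \o h) alpha 0 1 ->
    horizontal LA g (alpha 0) ->
    @dalong R n r M A D (iota \o h) alpha beta 0 k0 ->
    @elt R L AL _ k0 = @elt R L AL (bproj a') (tfib k (iota (bproj a')) (delta_mx 0 j)).
  move=> <- [/= ch kh] sb Zv ap ha [e [p [q [ [hse [U [opU Uh eB]]] alE beE k0E]]]].
  (* The base velocity of [beta] is zero at time 0, so [alpha 0] is vertical; being horizontal as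
     well, it is zero. *)
  have ia : isotropy LA (iota (h 0)) (alpha 0).
    move=> f sf; have [|_ apt] := ap 0; first by rewrite lexx ler01.
    rewrite (apt f sf) /=.
    have sfb : smooth_fun_at totL (fun b => f (iota (bproj b))) (curve_in beta 0).
      exact: (sf_comp (f := fun z => f (iota z)) cAL cL (sm_bproj cL bL (curve_in beta 0)) (sf_iota si sf)).
    have := Zv _ sfb; rewrite (partial_rshift_bproj _ j (fun z => f (iota z))) => H.
    by rewrite [LHS](_ : _ = velocity (curve_in beta) 0 (fun b => f (iota (bproj b)))) // -H.
  have a0 : alpha 0 = 0 by exact: horizontal_iso0 ha ia.
  have bas : is_basis [set: A (iota (h 0))] (fun i => e i (iota (h 0))) := eB _ Uh.
  have p0 i : p i = 0.
    by have [_ _ fr] := bas; apply: fr; rewrite -[RHS]a0; exact: esym alE.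
  have sib := sm_comp cR cAL cA sb (sm_restr_incl A si _).
  have sq i : smooth_near (q i) (0 : R).
    exact: (@frame_coef_smooth R n r M A _ e q 0 sib hse bas beE).
  have k0E' : k0 = \sum_i derive1 (q i) 0 *: e i (iota (h 0)).
    rewrite k0E [X in _ + X]big1 ?addr0 // => i _.
    by apply: big1 => m _; rewrite p0 mul0r scale0r.
  suff -> : k0 = tfib k (iota (h 0)) (delta_mx 0 j) by [].
  apply: (tcoord_inj bA kh); rewrite (bdl_fibK bA kh) k0E'.
  apply/rowP => m; rewrite (tcoord_sum bA) // summxE.
  have Ei i : sfun (fun x => tcoord k (e i x) 0 m) (iota (h 0)).
    exact: (sect_coord cM bA m (hse i _) kh).
  have sh : smooth_map_at (real_line R) (matlas M) (iota \o h) 0.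
    exact: (sm_comp cR cA cM sib (sm_bproj cM bA _)).
  have sEi i : smooth_near (fun s : R => tcoord k (e i (iota (h s))) 0 m) (0 : R).
    exact/sf_realline/(sf_comp cR cM sh (Ei i)).
  (* The base point is stationary to first order, hence so are the coordinates of the frame. *)
  have dEi i : 'D_1 (fun s : R => tcoord k (e i (iota (h s))) 0 m) 0 = 0.
    have [|_ apt] := ap 0; first by rewrite lexx ler01.
    have := apt _ (Ei i); rewrite a0 (anchor0 LA (Ei i)) /velocity derive1E.
    exact: esym.
  have sfm : smooth_fun_at totL (fun b => tcoord k (fib_elt b) 0 m) (curve_in beta 0).
    exact: (sf_fib cL bL (k := k : tidx (restr_trivs A iota)) (a := curve_in beta 0) kh).
  have H := Zv _ sfm; rewrite partial_rshift_fib // in H.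
  rewrite [RHS]mxE eqxx /= eq_sym H /velocity derive1E.
  transitivity ('D_1 (fun s : R => \sum_i q i s * tcoord k (e i (iota (h s))) 0 m) 0).
    rewrite derive_sn_sum; last by move=> i; exact: snM.
    apply: eq_bigr => i _; rewrite derive_snM // dEi mulr0 addr0 (tcoordZ bA) // mxE derive1E //.
  have kn : \forall s \near (0 : R), tdom k (iota (h s)).
    by have := mnear_coord cR (i := tt : cidx (real_line R)) I (sm_mnear cR cM sh (tdom_near cM bA kh));
       apply: filterS => s [].
  apply: near_eq_derive; apply: filterS2 kn beE => s ks bs /=.
  rewrite /curve_in /= bs (tcoord_sum bA) // summxE.
  by apply: eq_bigr => i _; rewrite (tcoordZ bA) // mxE.
(* An equality in the total space is brought back to one fibre through the coordinates, which do not
   depend on the base point in their type. *)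
have eltI (u v : AL (bproj a)) : @elt R L AL _ u = @elt R L AL _ v -> u = v.
  move=> H; apply: (tcoord_inj bA ka).
  exact: (congr1 (fun b : totspace AL => @tcoord _ _ _ _ (btrivs A) k (iota (bproj b)) (fib_elt b)) H).
apply: xget_unique.
  (* Witness: the straight line in the fibre with constant base path, whose horizontal [A]-path is
     zero. *)
  pose w := tcoord k (fib_elt a : A (iota (bproj a))).
  pose beta (t : R) : AL (bproj a) := tfib k (iota (bproj a)) (w + t *: delta_mx 0 j).
  have [e [se fe]] := ext_frame (mfdP M) bA ka.
  have [_ fex] := mnear_self cM fe.
  have b0 : curve_in beta 0 = a.
    by rewrite /curve_in /beta scale0r addr0 (bdl_coordK bA ka) elt_fib.
  exists (fun=> bproj a), beta, (fun=> 0), (tfib k (iota (bproj a)) (delta_mx 0 j)); split.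
  - by move=> t _; exact: curve_of_fibre.
  - split=> // f sf; rewrite /velocity derive1E /Z /partial_vec.
    apply: derive_line; near=> t => /=.
    rewrite addr0 [t *: 1]mulr1 /curve_in; congr f.
    have -> : rsubmx (t *: delta_mx 0 (rshift l j) + row_mx (ccoord c (bproj a)) (tcoord k (fib_elt a))) =
        w + t *: delta_mx 0 j.
      rewrite linearD /= row_mxKr addrC; congr (_ + _).
      by apply/rowP => m; rewrite !mxE eq_rshift.
    have -> : lsubmx (t *: delta_mx 0 (rshift l j) + row_mx (ccoord c (bproj a)) (tcoord k (fib_elt a))) =
        ccoord c (bproj a).
      by rewrite linearD /= row_mxKl; apply/rowP => m; rewrite !mxE eq_lrshift mulr0 add0r.
    exact: (@elt_tfib R r L AL (restr_trivs A iota) k _ _ (w + t *: delta_mx 0 j) (ch_coordK cL ca)).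
  - split; last by move=> t _ v _; exact: sp0.
    move=> t _; split.
      have := sm_comp cR cAL cA (curve_of_fibre (w := 0) (v := 0) (t := t) ka) (sm_restr_incl A si _).
      have tf0 : tfib k (iota (bproj a)) 0 = 0 by rewrite -(tcoord0 bA ka) (bdl_coordK bA ka).
      have -> : (fun s : R => restr_incl (@elt R L AL (bproj a)
          (tfib k (iota (bproj a)) (0 + s *: 0)))) = fun=> @elt R M A (iota (bproj a)) 0.
        by apply/funext => s0; rewrite scaler0 addr0 tf0.
      exact.
    move=> f sf /=; rewrite (anchor0 LA sf) /velocity.
    by rewrite (_ : f \o _ = fun=> f (iota (bproj a))) // derive1_cst.
  - exists e, (fun=> 0), (fun m s => (w + s *: delta_mx 0 j) 0 m); split.
    + exact: local_frame_of.
    + by rewrite big1 // => i _; rewrite scale0r.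
    + near=> s; rewrite /beta (tfibE bA) //.
      by apply: eq_bigr => m _; rewrite fex.
    + rewrite [X in _ + X]big1 ?addr0 => [|i _]; last first.
        by apply: big1 => m _; rewrite mul0r scale0r.
      rewrite (tfibE bA) //; apply: eq_bigr => m _; rewrite fex; congr (_ *: _).
      rewrite derive1E.
      have -> : (fun s : R => (w + s *: delta_mx 0 j) 0 m) = fun s : R => w 0 m + s * (delta_mx 0 j : 'rV[R]_r) 0 m.
        by apply/funext => s; rewrite !mxE.
      rewrite deriveD; [|exact: derivable_cst|by apply: derivableM; [exact: derivable_id|exact: derivable_cst]].
      rewrite derive_cst add0r derive_snM ?derive_id ?derive_cst ?mul1r ?mulr0 ?addr0 //; [exact: sn_id | exact: sn_cst].
  - by [].
move=> v [h [beta [alpha [k0 [sb [b0 Zv] [ap ha] da ek]]]]]; apply: eltI; rewrite -ek.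
apply: (uni a h beta alpha k0 b0 Ha _ Zv ap _ da).
  by apply: sb; rewrite lexx ler01.
by apply: ha; rewrite lexx ler01.
Unshelve. all: by end_near. Qed.

End Sasaki.

(** * The volume density of the Sasaki metric *)

Section SasakiVolume.
Variables (c : cidx (matlas L)) (k : tidx (btrivs A)).
Let ck : cidx totL := (c, k).
Notation P y := (Pmx c k y).
Notation G x := (Gmx k x).

(** The Gram matrix is (E K) diag(h, G) (E K)^T, where E and K list the values of the projection and
    of the map K on the coordinate vectors. On fibre directions these are 0 and the identity, so (E
    K) is block unitriangular whatever its remaining block. *)
Lemma det_sasaki (a : totspace AL) : cdom ck a ->
  \det (\matrix_(p, q) sasaki LA g D a (partial_vec (MA := totL) ck p a)
          (partial_vec (MA := totL) ck q a)) =
  \det (hmetric (P (bproj a)) (G (iota (bproj a)))) * \det (G (iota (bproj a))).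
Proof.
move=> Ha; have [ca ka] : cdom c (bproj a) /\ tdom k (iota (bproj a)) by [].
set h := hmetric _ _; set G0 := Gmx _ _.
pose K : 'M[R]_(l + r, r) := \matrix_(p, j) tcoord k
  (sasaki_K LA g D a (partial_vec (MA := totL) ck p a) : A (iota (bproj a))) 0 j.
pose E : 'M[R]_(l + r, l) := col_mx 1%:M 0.
have rowsE s (B : 'M[R]_(l + r, s)) H p q :
    (row p B *m H *m (row q B)^T) 0 0 = (B *m H *m B^T) p q.
  by rewrite -row_mul !mxE; apply: eq_bigr => i _; rewrite !mxE.
have KE p : tcoord k (sasaki_K LA g D a (partial_vec (MA := totL) ck p a) : A (iota (bproj a))) = row p K.
  by apply/rowP => j; rewrite !mxE.
have EE p : tcoords c (push (@bproj R L AL) (partial_vec (MA := totL) ck p a)) = row p E.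
  rewrite (partial_bproj p Ha) rowE /E -[delta_mx 0 p in RHS]hsubmxK.
  by rewrite mul_row_col mulmx1 mulmx0 addr0.
have K1 : K = col_mx (usubmx K) 1%:M.
  rewrite -[LHS]vsubmxK; congr col_mx; apply/matrixP => i j.
  by rewrite !mxE (sasaki_K_fibre i Ha) (bdl_fibK bA ka) mxE eqxx eq_sym.
have -> : (\matrix_(p, q) sasaki LA g D a (partial_vec (MA := totL) ck p a)
          (partial_vec (MA := totL) ck q a)) = row_mx E K *m block_mx h 0 0 G0 *m (row_mx E K)^T.
  have tp q : is_tangent (matlas L) (bproj a) (push (@bproj R L AL) (partial_vec (MA := totL) ck q a)).
    exact: (push_tangent cAL cL (sm_bproj cL bL a) (partial_tangent q Ha)).
  rewrite tr_row_mx mul_row_block !mulmx0 addr0 add0r mul_row_col.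
  apply/matrixP => p q; rewrite mxE [RHS]mxE -!rowsE /sasaki -!EE -!KE; congr (_ + _).
    exact: (leaf_metric_coord ca ka (tp p) (tp q)).
  exact: (sp_mx _ _ ka).
rewrite !det_mulmx det_tr K1 /E -block_mxEh det_ublock !det1 det_ublock.
by rewrite !mul1r mulr1.
Qed.

Definition sasaki_density (x : 'rV[R]_l) : R :=
  Num.sqrt (\det (hmetric (P (cinv c x)) (G (iota (cinv c x)))) * \det (G (iota (cinv c x)))).

(** The density does not involve the fibre coordinates, so it behaves as a constant under
    derivatives along the fibre. *)
Lemma riem_density_near (a : totspace AL) : cdom ck a ->
  \forall z \near ccoord ck a,
    riem_density (MA := totL) (sasaki LA g D (iota := iota)) ck z = sasaki_density (lsubmx z).
Proof.
move=> Ha; apply: filterS (ch_near cAL Ha) => z [dz _].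
by rewrite /riem_density /sasaki_density (det_sasaki dz).
Qed.

Variable y : L.
Hypotheses (cy : cdom c y) (ky : tdom k (iota y)).
Let x0 := ccoord c y.
Notation Ph := (fun x => P (cinv c x)).
Notation Gh := (fun x => G (iota (cinv c x))).

Lemma chart_near : \forall x \near x0, [/\ cdom c (cinv c x), ccoord c (cinv c x) = x & tdom k (iota (cinv c x))].
Proof. exact: (mnear_coord cL cy (sm_mnear cL cM (@si y) (tdom_near cM bA ky))). Qed.

(** The entries of the anchor matrix are leaf coordinates of [XL] along a smooth local section, so
    smoothness comes from that of the field [XL]. *)
Lemma sn_Pmx : smooth_near Ph x0.
Proof.
apply: sn_mx => i j; under eq_fun do rewrite mxE.
pose f (b : totspace AL) := ccoord c (bproj b) 0 j.
pose S (z : L) : totspace AL := @elt R L AL z (tfib k (iota z) (delta_mx 0 i)).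
have sf : smooth_fun_at totL f (S y).
  exact: (sf_comp (f := fun z => ccoord c z 0 j) cAL cL (sm_bproj cL bL (S y)) (sf_coord cL cy)).
have [[_ sX] _] := hXL.
have sS : smooth_map_at (matlas L) totL S y.
  exact: (sect_fib cL bL (k := k : tidx (restr_trivs A iota)) (delta_mx 0 i) ky).
have H := sf_comp (f := fun b => XL b f) cL cAL sS (sX f (S y) sf).
have := sfE cy H; rewrite (_ : (fun z => _) = fun x => Pvec c (tfib k (iota (cinv c x)) (delta_mx 0 i)) 0 j) //.
by apply/funext => x; rewrite mxE.
Qed.

Section WithFrame.
Variable e : 'I_r -> sect.
Hypothesis se : forall j, smooth_sect (e j).
Hypothesis fe : mnear (matlas M) (iota y)
  (fun x => tdom k x /\ forall j, e j x = tfib k x (delta_mx 0 j)).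

Lemma Gmx_frame i j : \forall x \near x0,
  Gh x i j = g (iota (cinv c x)) (e i (iota (cinv c x))) (e j (iota (cinv c x))).
Proof.
have := mnear_coord cL cy (sm_mnear cL cM (@si y) fe).
by apply: filterS => x [_ _ [_ ex]]; rewrite mxE !ex.
Qed.

Lemma sn_Gmx : smooth_near Gh x0.
Proof.
apply: sn_mx => i j.
have H := sfE cy (sf_iota si (sf_sp g (iota y) (@se i) (@se j))).
have E : \forall x \near x0, g (iota (cinv c x)) (e i (iota (cinv c x))) (e j (iota (cinv c x))) = Gh x i j.
  by apply: filterS (Gmx_frame i j) => x ->.
exact: (sn_congr E H).
Qed.

Lemma derive_Gmx (u : A (iota y)) i j :
  'D_(Pvec c u) (fun x => Gh x i j) x0 = anchor LA u (fun x => g x (e i x) (e j x)).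
Proof.
rewrite (leaf_anchor u cy (sf_sp g (iota y) (@se i) (@se j))).
exact: near_eq_derive (Gmx_frame i j).
Qed.

(* The anchor intertwines the brackets; iota being an immersion, this reads
   off in the chart of the leaf. *)
Lemma derive_Pmx m i :
  'D_(row m (P y)) (fun x => row i (Ph x)) x0 - 'D_(row i (P y)) (fun x => row m (Ph x)) x0 =
  tcoord k (bracket LA (e m) (e i) (iota y)) *m P y.
Proof.
have [_ ey] := mnear_self cM fe.
have Pe z j : cdom c z -> tdom k (iota z) -> e j (iota z) = tfib k (iota z) (delta_mx 0 j) ->
    Pvec c (e j (iota z)) = row j (P z).
  by move=> cz kz ->; rewrite (Pvec_mx cz kz) (bdl_fibK bA kz) rowE.
rewrite -(Pvec_mx cy ky); apply: (imm_eq cy) => f sf.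
rewrite -(leaf_anchor _ cy sf) (@anchor_bracket R n r M A LA (e m) (e i) (@se m) (@se i) (iota y) f sf).
pose F x := f (iota (cinv c x)).
have sF : smooth_near F x0 by exact: (sfE cy (sf_iota si sf)).
(* A first-order term in the derivatives of the anchor matrix, plus a second derivative with frozen
   coefficients. The latter is symmetric by [sn_schwarz] and cancels in the commutator. *)
have an j1 j2 : anchor LA (e j1 (iota y)) (fun x => anchor LA (e j2 x) f) =
   \sum_q 'D_(row j1 (P y)) (fun x => Ph x j2 q) x0 * 'D_(delta_mx 0 q) F x0 +
   'D_(row j1 (P y)) ('D_(row j2 (P y)) F) x0.
  have [_ sa] := anchor_smooth LA (@se j2).
  rewrite (leaf_anchor _ cy (sa f _ sf)) Pe //.
  have sFq q : smooth_near (fun x => 'D_(delta_mx 0 q) F x) x0 by exact: sn_derive.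
  transitivity ('D_(row j1 (P y)) (fun x => \sum_q Ph x j2 q * 'D_(delta_mx 0 q) F x) x0).
    apply: near_eq_derive.
    have sfM := sm_mnear cL cM (@si y) (@sf_near R _ _ _ cM f _ sf).
    have sfl := @sf_near R _ _ _ cL _ _ (sf_iota si sf).
    apply: filterS (mnear_coord cL cy (mnearI (mnearI (sm_mnear cL cM (@si y) fe) sfM) sfl)).
    move=> x [cx ex [[[kx ex2] sfMx] sfx]].
    rewrite (leaf_anchor _ cx) // Pe // /tvec_of ex.
    rewrite sn_derive_rV; last by rewrite -ex; exact: (sfE cx sfx).
    by apply: eq_bigr => q _; rewrite [in LHS]mxE.
  have sP q : smooth_near (fun x => Ph x j2 q) x0 by apply: sn_entry; exact: sn_Pmx.
  rewrite derive_sn_sum; last by move=> q; exact: snM.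
  under eq_bigr do rewrite derive_snM //.
  rewrite big_split /=; congr (_ + _).
  transitivity ('D_(row j1 (P y)) (fun x => \sum_q P y j2 q * 'D_(delta_mx 0 q) F x) x0).
    rewrite derive_sn_sum; last by move=> q; apply: snM => //; exact: sn_cst.
    apply: eq_bigr => q _; rewrite derive_snM ?derive_cst ?mul0r ?add0r //; last exact: sn_cst.
    by rewrite /x0 (ch_coordK cL cy).
  apply: near_eq_derive; apply: filterS (sn_near sF) => x sFx.
  by rewrite [RHS](sn_derive_rV _ sFx); apply: eq_bigr => q _; rewrite [in RHS]mxE.
rewrite !an (sn_schwarz (row m (P y)) (row i (P y)) sF) opprD addrACA subrr addr0.
rewrite /tvec_of sn_derive_rV // -sumrB; apply: eq_bigr => q _; rewrite mxE mulrDl [X in _ + X * _]mxE mulNr.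
have sr j : smooth_near (fun x => row j (Ph x)) x0.
  by apply: sn_mx => i1 j1; under eq_fun do rewrite mxE; apply: sn_entry; exact: sn_Pmx.
have re v j : ('D_v (fun x => row j (Ph x)) x0) 0 q = 'D_v (fun x => Ph x j q) x0.
  by rewrite (sn_derive_mx v 0 q (sr j)); congr (derive _ x0 v); apply/funext => x; rewrite [LHS]mxE.
by rewrite !re.
Qed.

Notation x := (iota y).
Notation P := (Pmx c k y).
Notation G := (Gmx k (iota y)).
Notation iso := (isotropy LA x).

Definition const_sect (u : A x) : sect := fun z => \sum_i tcoord k u 0 i *: e i z.

Lemma frame_at j : e j x = tfib k x (delta_mx 0 j).
Proof. by have [_ ->] := mnear_self cM fe. Qed.

Lemma const_sect_at u : const_sect u x = u.
Proof. by rewrite [RHS](fib_expand bA u ky); apply: eq_bigr => i _; rewrite frame_at. Qed.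

Lemma smooth_const_sect u : smooth_sect (const_sect u).
Proof. by apply: smooth_sum => i; apply: smooth_scale => // z; exact: sf_cst. Qed.

Let Gs := Gmx_sym k x.
Let Gp (u : 'rV[R]_r) : u != 0 -> 0 < (u *m G *m u^T) 0 0.
Proof. exact: Gmx_pos. Qed.
Let QP : exists Q : 'M[R]_(l, r), Q *m P = 1%:M := Pmx_full cy ky.

(** * The divergence as a sum of half Lie derivatives *)

Section DivergenceFormula.
Variable u0 : A x.
Let a : totspace AL := @elt R L AL y u0.
Let Ha : cdom ck a := conj cy ky.
Let w := tcoord k u0.
Notation rho := sasaki_density.
Notation v := (fun x => w *m Ph x).

Lemma cinv_x0 : cinv c x0 = y. Proof. exact: (ch_coordK cL cy). Qed.

Let sn_Gh : smooth_near Gh x0. Proof. exact: sn_Gmx. Qed.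
Let sP : smooth_near Ph x0. Proof. exact: sn_Pmx. Qed.

Notation co x := (cometric (Ph x) (Gh x)).
Notation dPv u := ('D_u Ph x0).
Notation dGv u := ('D_u Gh x0).

Lemma sn_cometric : smooth_near (fun x => co x) x0.
Proof.
apply: sn_mulmx sP; apply: sn_mulmx; first exact: sn_trmx.
by apply: sn_invmx sn_Gh; rewrite cinv_x0; exact: Gunit.
Qed.

Lemma cometric_x0_unit : co x0 \in unitmx.
Proof. by have [Q /(cometric_unit Gs Gp)] := QP; rewrite cinv_x0. Qed.

Lemma derive_cometric u : 'D_u (fun x => co x) x0 =
  (dPv u)^T *m invmx G *m P + P^T *m invmx G *m dPv u -
  P^T *m invmx G *m dGv u *m invmx G *m P.
Proof.
have GU : Gh x0 \in unitmx by rewrite cinv_x0; exact: Gunit.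
have sI := sn_invmx GU sn_Gh; have sT := sn_trmx sP.
rewrite /cometric derive_mulmx //; last exact: sn_mulmx.
rewrite derive_mulmx // derive_trmx // derive_invmx //.
rewrite cinv_x0 mulmxDl mulmxN mulNmx !mulmxA.
by rewrite -!addrA; congr (_ + _); rewrite addrC.
Qed.

Let sn_h : smooth_near (fun x => hmetric (Ph x) (Gh x)) x0.
Proof. exact: (@sn_invmx R _ _ (fun x => co x) x0 cometric_x0_unit sn_cometric). Qed.

Let sn_dens : smooth_near (fun x => \det (hmetric (Ph x) (Gh x)) * \det (Gh x)) x0.
Proof. by apply: snM; apply: sn_det; [exact: sn_h|exact: sn_Gh]. Qed.

Let dens_gt0 : 0 < \det (hmetric (Ph x0) (Gh x0)) * \det (Gh x0).
Proof.
have [Q Q1] := QP; apply: mulr_gt0.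
  rewrite /hmetric det_inv invr_gt0 cinv_x0; apply: posdef_det => t t0.
  exact: (cometric_pos Gs Gp Q1 t0).
by rewrite cinv_x0; exact: posdef_det.
Qed.

Lemma rho_neq0 : rho x0 != 0.
Proof. by rewrite gt_eqF // sqrtr_gt0. Qed.

(** [rho] is a square root, for which directional derivatives have been computed; their linearity in
    the direction is inherited from the smooth radicand. *)
Lemma derive_rho_rV u : 'D_u rho x0 = \sum_q 'D_(delta_mx 0 q) rho x0 * u 0 q.
Proof.
have E v := proj2 (derive_sqrt_comp v sn_dens dens_gt0).
rewrite [LHS]E (sn_derive_rV u sn_dens) mulr_suml; apply: eq_bigr => q _.
by rewrite [X in _ = X * _]E; ring.
Qed.

(** Logarithmic derivative of the density: one half, from the square root, of those of the two
    determinants. The metric of the leaf enters with a minus sign, as the inverse of the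
    cometric. *)
Lemma derive_rho u : derivable rho x0 u /\
  'D_u rho x0 = rho x0 * (2^-1 * (\tr (invmx G *m dGv u) -
    \tr (hmetric P G *m ((dPv u)^T *m invmx G *m P + P^T *m invmx G *m dPv u -
    P^T *m invmx G *m dGv u *m invmx G *m P)))).
Proof.
have [H1 H2] := derive_sqrt_comp u sn_dens dens_gt0; split; first exact: H1.
rewrite [LHS]H2 derive_snM; [|by apply: sn_det; exact: sn_h|by apply: sn_det; exact: sn_Gh].
have hU : hmetric (Ph x0) (Gh x0) \in unitmx by rewrite unitmx_inv; exact: cometric_x0_unit.
have GU : Gh x0 \in unitmx by rewrite cinv_x0; exact: Gunit.
rewrite (derive_det u sn_h hU) (derive_det u sn_Gh GU).
rewrite (@derive_invmx R _ _ (fun x => co x) x0 u sn_cometric cometric_x0_unit) derive_cometric.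
rewrite /rho; set d := \det _; set d' := \det _.
have s0 : Num.sqrt (d * d') != 0 by rewrite gt_eqF // sqrtr_gt0; exact: dens_gt0.
have sE : d * d' = Num.sqrt (d * d') * Num.sqrt (d * d').
  by rewrite -expr2 sqr_sqrtr // ltW //; exact: dens_gt0.
have -> : \tr (invmx (hmetric (Ph x0) (Gh x0)) *m - (invmx (co x0) *m
     ((dPv u)^T *m invmx G *m P + P^T *m invmx G *m dPv u -
      P^T *m invmx G *m dGv u *m invmx G *m P) *m invmx (co x0))) =
   - \tr (hmetric P G *m ((dPv u)^T *m invmx G *m P + P^T *m invmx G *m dPv u -
      P^T *m invmx G *m dGv u *m invmx G *m P)).
  rewrite mulmxN raddfN /= -/(hmetric (Ph x0) (Gh x0)) -!mulmxA mulKmx //.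
  by rewrite [in LHS]mxtrace_mulC cinv_x0.
rewrite cinv_x0.
set t1 := \tr _; set t2 := \tr _.
have -> : d * (- t1) * d' + d * (d' * t2) = (d * d') * (t2 - t1) by ring.
by rewrite {1}sE; field.
Qed.

Let v0 : 'rV[R]_l := Pvec c u0.
Let v0E : v0 = w *m P. Proof. exact: (Pvec_mx cy ky). Qed.

Definition spray (u : 'rV[R]_r) : 'rV[R]_r :=
  \row_j XL (@elt R L AL y (tfib k (iota y) u)) (fun b => tcoord k (fib_elt b : A (iota (bproj b))) 0 j).

Lemma XL_coord_near q : \forall z \near ccoord ck a,
  XL (cinv ck z) (fun b => ccoord ck b 0 (lshift r q)) = (rsubmx z *m Ph (lsubmx z)) 0 q.
Proof.
apply: filterS (ch_near cAL Ha) => z [[cz kz] _].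
have -> : (fun b : totspace AL => ccoord ck b 0 (lshift r q)) = fun b => ccoord c (bproj b) 0 q.
  by apply/funext => b; rewrite /= row_mxEl.
have := @Pvec_mx c k (cinv c (lsubmx z)) cz kz (tfib k (iota (cinv c (lsubmx z))) (rsubmx z)).
rewrite (bdl_fibK bA kz) => <-.
by rewrite mxE.
Qed.

Lemma sn_spray j : smooth_near (fun u => spray u 0 j) w.
Proof.
have [[_ sX] _] := hXL.
have sf : smooth_fun_at totL (fun b => tcoord k (fib_elt b : A (iota (bproj b))) 0 j) a.
  exact: (sf_fib cL bL (k := k : tidx (restr_trivs A iota)) (a := a) ky).
have H := sfE Ha (sX _ _ sf).
have sr : smooth_near (fun u : 'rV[R]_r => row_mx x0 u) w.
  by apply: sn_row_mx; [exact: sn_cst|exact: sn_id].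
have := sn_compW (fdim_rV R (l + r)) (fdim_real R) H sr.
congr smooth_near; apply/funext => u; rewrite [RHS]mxE /=.
congr (XL _ _); rewrite row_mxKl row_mxKr.
exact: (@elt_tfib R r L AL (restr_trivs A iota) k _ _ u cinv_x0).
Qed.

(** Along the leaf the density contributes its logarithmic derivative in the direction [v0]; along
    the fibre it is constant and cancels. *)
Lemma divergence_split :
  divergence (MA := totL) (sasaki LA g D (iota := iota)) XL ck a =
  2^-1 * (\tr (invmx G *m dGv v0) -
    \tr (hmetric P G *m ((dPv v0)^T *m invmx G *m P + P^T *m invmx G *m dPv v0 -
    P^T *m invmx G *m dGv v0 *m invmx G *m P))) +
  \sum_q 'D_(delta_mx 0 q) (fun x => v x 0 q) x0 +
  \sum_j 'D_(delta_mx 0 j) (fun u => spray u 0 j) w.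
Proof.
have z0E : ccoord ck a = row_mx x0 w by [].
have rz : \forall z \near ccoord ck a,
    riem_density (MA := totL) (sasaki LA g D (iota := iota)) ck z = rho (lsubmx z).
  exact: (riem_density_near Ha).
have r0 : riem_density (MA := totL) (sasaki LA g D (iota := iota)) ck (ccoord ck a) = rho x0.
  by rewrite (nbhs_singleton rz) z0E row_mxKl.
have rp := rho_neq0.
rewrite /divergence r0 big_split_ord /= mulrDr.
have sv q : smooth_near (fun x => v x 0 q) x0.
  by apply: sn_entry; apply: sn_mulmx sP; exact: sn_cst.
congr (_ + _).
  have -> : \sum_q 'D_(delta_mx 0 (lshift r q)) (fun z => riem_density (MA := totL) (sasaki LA g D (iota := iota)) ck z *
       XL (cinv ck z) (fun b => ccoord ck b 0 (lshift r q))) (ccoord ck a) =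
      \sum_q ('D_(delta_mx 0 q) rho x0 * v x0 0 q + rho x0 * 'D_(delta_mx 0 q) (fun x => v x 0 q) x0).
    apply: eq_bigr => q _.
    transitivity ('D_(delta_mx 0 (lshift r q)) (fun z : 'rV[R]_(l + r) => rho (lsubmx z) *
        (rsubmx z *m Ph (lsubmx z)) 0 q) (ccoord ck a)).
      by apply: near_eq_derive; apply: filterS2 rz (XL_coord_near q) => z -> ->.
    transitivity ('D_(delta_mx 0 q) (fun x => rho x * v x 0 q) x0).
      apply: derive_line; near=> t.
      have -> : lsubmx (t *: delta_mx 0 (lshift r q) + ccoord ck a) = t *: delta_mx 0 q + x0.
        rewrite z0E linearD /= row_mxKl; congr (_ + _).
        by apply/rowP => m; rewrite !mxE eq_lshift.
      have -> // : rsubmx (t *: delta_mx 0 (lshift r q) + ccoord ck a) = w.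
      rewrite z0E linearD /= row_mxKr -[RHS]add0r; congr (_ + _).
      by apply/rowP => m; rewrite !mxE eq_rlshift mulr0.
    have [dr _] := derive_rho (delta_mx 0 q).
    have dv : derivable (fun x => v x 0 q) x0 (delta_mx 0 q) by exact: sn_derivable.
    exact: (@derive_mul R _ _ (fun x => v x 0 q) x0 (delta_mx 0 q) dr dv).
  rewrite big_split /= mulrDr; congr (_ + _); last by rewrite -mulr_sumr mulKf.
  have -> : \sum_q 'D_(delta_mx 0 q) rho x0 * v x0 0 q = 'D_v0 rho x0.
    by rewrite derive_rho_rV v0E cinv_x0.
  by have [_ ->] := derive_rho v0; rewrite mulKf.
have -> : \sum_j 'D_(delta_mx 0 (rshift l j)) (fun z => riem_density (MA := totL) (sasaki LA g D (iota := iota)) ck z *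
       XL (cinv ck z) (fun b => ccoord ck b 0 (rshift l j))) (ccoord ck a) =
    \sum_j rho x0 * 'D_(delta_mx 0 j) (fun u => spray u 0 j) w.
  apply: eq_bigr => j _.
  transitivity ('D_(delta_mx 0 (rshift l j)) (fun z : 'rV[R]_(l + r) => rho (lsubmx z) *
      XL (cinv ck z) (fun b => ccoord ck b 0 (rshift l j))) (ccoord ck a)).
    by apply: near_eq_derive; apply: filterS rz => z ->.
  transitivity ('D_(delta_mx 0 j) (fun u => rho x0 * spray u 0 j) w).
    apply: derive_line; near=> t.
    have E1 : lsubmx (t *: delta_mx 0 (rshift l j) + ccoord ck a) = x0.
      rewrite z0E linearD /= row_mxKl -[RHS]add0r; congr (_ + _).
      by apply/rowP => m; rewrite !mxE eq_lrshift mulr0.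
    have E2 : rsubmx (t *: delta_mx 0 (rshift l j) + ccoord ck a) = t *: delta_mx 0 j + w.
      rewrite z0E linearD /= row_mxKr; congr (_ + _).
      by apply/rowP => m; rewrite !mxE eq_rshift.
    rewrite E1; congr (_ * _); rewrite [RHS]mxE.
    have -> : (fun b : totspace AL => ccoord ck b 0 (rshift l j)) =
        fun b => tcoord k (fib_elt b : A (iota (bproj b))) 0 j.
      by apply/funext => b; rewrite /= row_mxEr.
    congr (XL _ _); rewrite /= E1 E2.
    exact: (@elt_tfib R r L AL (restr_trivs A iota) k _ _ _ cinv_x0).
  rewrite derive_snM; [|exact: sn_cst|exact: sn_spray].
  by rewrite derive_cst mul0r add0r.
by rewrite -mulr_sumr mulKf.
Unshelve. all: by end_near. Qed.

Let dG : 'M[R]_r := \matrix_(i, j) anchor LA u0 (fun x => g x (e i x) (e j x)).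
Let C : 'M[R]_r := \matrix_i \sum_m w 0 m *: tcoord k (bracket LA (e i) (e m) (iota y)).

Let u0E : u0 = \sum_m w 0 m *: e m (iota y).
Proof. by rewrite [LHS](fib_expand bA u0 ky); apply: eq_bigr => m _; rewrite frame_at. Qed.

Let derive_Gv : dGv v0 = dG.
Proof.
apply/matrixP => i j; rewrite (sn_derive_mx v0 i j sn_Gh) [RHS]mxE.
exact: (derive_Gmx u0 i j).
Qed.

Let dGE : dG = \sum_m w 0 m *: \matrix_(i, j) anchor LA (e m (iota y)) (fun x => g x (e i x) (e j x)).
Proof.
apply/matrixP => i j; rewrite summxE mxE u0E.
rewrite (anchor_sum LA _ _ _ (sf_sp g (iota y) (@se i) (@se j))).
by apply: eq_bigr => m _; rewrite !mxE.
Qed.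

(** The combination of the relations [derive_Pmx] with the constant coefficients [w]; this is the
    hypothesis on the bracket in [trace_identity]. *)
Lemma jacobian_bracket :
  P *m (\matrix_(q, p) 'D_(delta_mx 0 q) (fun x => v x 0 p) x0) - dPv v0 = C *m P.
Proof.
have se_ j p : smooth_near (fun x => Ph x j p) x0 by apply: sn_entry; exact: sP.
have sv p : smooth_near (fun x => v x 0 p) x0.
  by apply: sn_entry; apply: sn_mulmx sP; exact: sn_cst.
have sr j : smooth_near (fun x => row j (Ph x)) x0.
  by apply: sn_mx => i1 j1; under eq_fun do rewrite mxE; exact: se_.
have dr u m p : ('D_u (fun x => row m (Ph x)) x0) 0 p = 'D_u (fun x => Ph x m p) x0.
  by rewrite (sn_derive_mx u 0 p (sr m)); congr (derive _ x0 u); apply/funext => x; rewrite [LHS]mxE.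
have dv u p : 'D_u (fun x => v x 0 p) x0 = \sum_m w 0 m * 'D_u (fun x => Ph x m p) x0.
  have -> : (fun x => v x 0 p) = fun x => \sum_m w 0 m * Ph x m p.
    by apply/funext => x; rewrite mxE.
  rewrite derive_sn_sum => [|m]; last by apply: snM => //; exact: sn_cst.
  by apply: eq_bigr => m _; rewrite derive_snM ?derive_cst ?mul0r ?add0r //; exact: sn_cst.
have lin (f : 'rV[R]_l -> R) (i : 'I_r) : smooth_near f x0 ->
    \sum_m w 0 m * 'D_(row m P) f x0 = 'D_v0 f x0.
  move=> sf; rewrite (sn_derive_rV v0 sf) v0E.
  under eq_bigr do rewrite (sn_derive_rV _ sf) mulr_sumr.
  rewrite exchange_big /=; apply: eq_bigr => q _.
  rewrite mxE mulr_suml; apply: eq_bigr => m _.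
  by rewrite (mulrA (w 0 m)); congr (_ * _ * _); rewrite [LHS]mxE.
apply/matrixP => i p; rewrite [LHS]mxE [X in X + _]mxE [X in _ + X]mxE.
rewrite (sn_derive_mx v0 i p sP) -(lin _ i (se_ i p)).
transitivity ('D_(row i P) (fun x => v x 0 p) x0 - \sum_m w 0 m * 'D_(row m P) (fun x => Ph x i p) x0).
  congr (_ - _); rewrite (sn_derive_rV _ (sv p)); apply: eq_bigr => q _.
  by rewrite [X in _ * X]mxE; congr (_ * _); rewrite [RHS]mxE.
rewrite dv -sumrB.
transitivity (\sum_m w 0 m * (tcoord k (bracket LA (e i) (e m) (iota y)) *m P) 0 p).
  apply: eq_bigr => m _; rewrite -mulrBr; congr (_ * _).
  by rewrite -(derive_Pmx) [RHS]mxE [X in _ = _ + X]mxE !dr.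
rewrite -[RHS](_ : (row i (C *m P)) 0 p = _); last by rewrite [LHS]mxE.
rewrite row_mul rowK mulmx_suml summxE.
by apply: eq_bigr => m _; rewrite -scalemxAl [RHS]mxE.
Qed.

(** [spray_trace] evaluates the fibre part, and [trace_identity] leaves only traces over the
    vertical basis; these are recognised term by term through [half_lieE]. *)
Lemma divergence_half_lie s (b : 'I_s -> A (iota y)) :
  is_basis (isotropy LA (iota y)) b ->
  (forall i j, g (iota y) (b i) (b j) = (i == j)%:R) ->
  divergence (MA := totL) (sasaki LA g D (iota := iota)) XL ck a =
  - \sum_j half_lie LA g (iota y) (const_sect u0) (const_sect (b j)).
Proof.
move=> [bi bs bf] bo; rewrite divergence_split.
pose Am m : 'M[R]_r := \matrix_(i, j) anchor LA (e m (iota y)) (fun x => g x (e i x) (e j x)).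
pose cm m : 'M[R]_r := \matrix_(j, p) g (iota y) (bracket LA (e m) (e j) (iota y)) (e p (iota y)).
have GE j m : G j m = g (iota y) (e j (iota y)) (e m (iota y)) by rewrite mxE !frame_at.
have S : \sum_j 'D_(delta_mx 0 j) (fun u => spray u 0 j) w =
    - \tr (invmx G *m dG) - \tr C.
  rewrite (@spray_trace R r G Am cm Gs (Gunit Gp) spray w).
  - rewrite -dGE; congr (_ - \tr _).
    rewrite -[RHS](mulmxK (Gunit Gp)); congr (_ *m _).
    apply/row_matrixP => m; rewrite row_mul rowK; apply/rowP => p.
    rewrite !mxE; under [RHS]eq_bigr do rewrite summxE mulr_suml.
    rewrite exchange_big /=; apply: eq_bigr => i _.
    rewrite mxE [in LHS](fib_expand bA (bracket LA (e m) (e i) (iota y)) ky) sp_sum mulr_sumr.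
    by apply: eq_bigr => q _; rewrite GE sp_scale !frame_at [in RHS]mxE mulrA.
  - by move=> m; apply/matrixP => i j; rewrite !mxE; congr (anchor LA _ _); apply/funext => x; exact: sp_sym.
  - move=> m j; apply/rowP => p; rewrite !mxE (bracket_anti LA (@se m) (@se j)) sp_opp //.
  - move=> u m; have := geodesic_field_frame hD hX ky (@se) fe (tfib k (iota y) u) m.
    rewrite /= (bdl_fibK bA ky) => H.
    rewrite mxE; transitivity (\sum_j X (elt (tfib k (iota y) u)) (fun b0 => tcoord k (fib_elt b0) 0 j) *
        g (iota y) (e j (iota y)) (e m (iota y))).
      apply: eq_bigr => j _; rewrite GE mxE; congr (_ * _).
      have sf : smooth_fun_at totA (fun b0 => tcoord k (fib_elt b0) 0 j) (elt (tfib k (iota y) u)).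
        exact: (sf_fib cM bA (a := elt (tfib k (iota y) u)) ky).
      by have [_ /(_ (@elt R L AL y (tfib k (iota y) u)) _ sf) <-] := hXL.
    rewrite H; congr (2^-1 * _ - _ - _).
    + by apply: eq_bigr => i _; apply: eq_bigr => j _; rewrite [in RHS]mxE.
    + apply: eq_bigr => j _; rewrite [in LHS](tfibE bA u ky) sp_sumr mulr_sumr.
      by apply: eq_bigr => p _; rewrite sp_scaler [in RHS]mxE !frame_at mulrA.
    + apply: eq_bigr => j _; rewrite [in LHS](tfibE bA u ky).
      rewrite (anchor_sum LA _ _ _ (sf_sp g (iota y) (@se j) (@se m))) mulr_sumr.
      by apply: eq_bigr => p _; rewrite [in RHS]mxE !frame_at mulrA.
rewrite S derive_Gv.
pose bm : 'M[R]_(s, r) := \matrix_j tcoord k (b j).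
have bmP : bm *m P = 0.
  apply/row_matrixP => j; rewrite row_mul rowK row0 -(Pvec_mx cy ky) //.
  by apply/(isotropyP _ cy); exact: bi.
have bmG : bm *m G *m bm^T = 1%:M.
  apply/matrixP => i j; rewrite [RHS]mxE -bo (sp_mx _ _ ky).
  by rewrite -[tcoord k (b i)](rowK (fun j => tcoord k (b j))) -/bm -row_mul !mxE;
    apply: eq_bigr => q _; rewrite !mxE.
have bmS (u : 'rV[R]_r) : u *m P = 0 -> exists p : 'rV[R]_s, u = p *m bm.
  move=> uP; have iu : isotropy LA (iota y) (tfib k (iota y) u).
    by apply/(isotropyP _ cy); rewrite (Pvec_mx cy ky) // (bdl_fibK bA ky).
  have [p pE] := bs _ iu; exists (\row_j p j).
  rewrite -(bdl_fibK bA ky u) pE (tcoord_sum bA) //; apply/rowP => q.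
  rewrite summxE mxE; apply: eq_bigr => j _; by rewrite (tcoordZ bA) // !mxE.
have [Q Q1] := QP.
have dGT : dG^T = dG.
  by apply/matrixP => i j; rewrite !mxE; congr (anchor LA _ _); apply/funext => x; exact: sp_sym.
have := trace_identity Gs Gp Q1 dGT jacobian_bracket (vproj_basis Gs Gp Q1 bmP bmG bmS).
have -> : \tr (\matrix_(q, p) 'D_(delta_mx 0 q) (fun x => v x 0 p) x0) =
    \sum_q 'D_(delta_mx 0 q) (fun x => v x 0 q) x0.
  by apply: eq_bigr => q _; rewrite mxE.
move=> H; rewrite addrA -/v0 H.
rewrite /mxtrace mulr_sumr -opprD -big_split /=; congr (- _); apply: eq_bigr => j _.
have cs u i : tcoord k (const_sect u (iota y)) 0 i = tcoord k u 0 i by rewrite const_sect_at.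
have fe' : mnear (matlas M) (iota y)
  (fun x => tdom k x /\ forall j, e j x = tfib k x (delta_mx 0 j)) := fe.
rewrite (half_lieE LA g ky (@se) fe' (@smooth_const_sect u0) (@smooth_const_sect (b j))).
(* The last sum of [half_lieE] vanishes because [b j] is vertical. *)
rewrite [X in _ = _ + X]big1 ?addr0 => [|i _]; last first.
  rewrite const_sect_at (bi j) ?mul0r //.
  exact: (sf_co ky _ i (@smooth_const_sect u0)).
congr (_ + _).
  congr (_ * _); rewrite mxE exchange_big /=; apply: eq_bigr => m _.
  rewrite !mxE mulr_suml; apply: eq_bigr => i _.
  by rewrite !cs !mxE const_sect_at; ring.
have bC : tcoord k (b j) *m C = tcoord k (\sum_m \sum_i (tcoord k (b j) 0 m * w 0 i) *: bracket LA (e m) (e i) (iota y)).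
  rewrite (tcoord_sum bA) //; apply/rowP => p; rewrite mxE summxE; apply: eq_bigr => m _.
  rewrite (tcoord_sum bA) // mxE !summxE mulr_sumr; apply: eq_bigr => i _.
  by rewrite (tcoordZ bA) // !mxE mulrA.
transitivity ((row j (bm *m C *m G *m bm^T)) 0 j); first by rewrite [RHS]mxE.
rewrite !row_mul rowK bC.
transitivity (g (iota y) (\sum_m \sum_i (tcoord k (b j) 0 m * w 0 i) *: bracket LA (e m) (e i) (iota y)) (b j)).
  by rewrite (sp_mx _ _ ky) mxE [RHS]mxE; apply: eq_bigr => q _; rewrite !mxE.
rewrite sp_sum; under eq_bigr do rewrite sp_sum.
rewrite [LHS]exchange_big /= -sumrN; apply: eq_bigr => i _; rewrite -sumrN; apply: eq_bigr => m _.
rewrite sp_scale !cs const_sect_at (bracket_anti LA (@se m) (@se i)) sp_opp.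
by rewrite -/w; ring.
Qed.

End DivergenceFormula.

(** * The isotropy algebra, the tensor T and the two contributions *)

Section Isotropy.
Notation t u := (tcoord k (u : A (iota y))).

Let isoP (u : A x) : iso u <-> t u *m P = 0.
Proof. by rewrite -(Pvec_mx cy ky); exact: (isotropyP u cy). Qed.

Lemma vpart_isotropy (u : A x) : iso (vpart LA g u).
Proof.
have [Q Q1] := QP; apply/isoP; rewrite (vpart_coord cy ky).
by rewrite -mulmxA mulmxBl mul1mx (hprojP Gs Gp Q1) subrr mulmx0.
Qed.

Lemma hpart_horizontal (u : A x) : horizontal LA g (hpart LA g u).
Proof.
move=> w /isoP wP; rewrite (sp_mx _ _ ky) (hpart_coord cy ky).
by rewrite -[X in X *m _]mulmxA (hprojG _ Gp) !mulmxA -mulmxA -trmx_mul wP trmx0 mulmx0 mxE.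
Qed.

Lemma vpart_id (u : A x) : iso u -> vpart LA g u = u.
Proof.
move=> /isoP uP; apply: (tcoord_inj bA ky); rewrite (vpart_coord cy ky).
by rewrite mulmxBr mulmx1 /hproj !mulmxA uP !mul0mx subr0.
Qed.

Lemma isotropy_sum (I : Type) (s : seq I) (p : I -> R) (b : I -> A x) :
  (forall i, iso (b i)) -> iso (\sum_(i <- s) p i *: b i).
Proof.
move=> bi f sf; rewrite (anchor_sum LA _ _ _ sf) big1 // => i _.
by rewrite (bi i f sf) mulr0.
Qed.

(* The bracket of isotropy elements and lieQ below are tensorial, so that they can
   be computed with sections with constant coefficients in the frame e. *)
Let br (u b : A x) : A x := \sum_i \sum_j (t u 0 i * t b 0 j) *: bracket LA (e i) (e j) x.

Let bracket_iso (u b : sect) : smooth_sect u -> smooth_sect b -> iso (u x) -> iso (b x) ->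
  bracket LA u b x = br (u x) (b x).
Proof.
move=> su sb iu ib; rewrite (bracket_coord LA ky (@se) fe su sb).
rewrite [X in _ + X - _]big1 ?addr0 => [|j _]; last first.
  by rewrite (iu _ (sf_co ky _ j sb)) scale0r.
by rewrite [X in _ - X]big1 ?subr0 // => j _; rewrite (ib _ (sf_co ky _ j su)) scale0r.
Qed.

Lemma isotropy_bracketE (u b : A x) : iso u -> iso b -> isotropy_bracket LA u b = br u b.
Proof.
move=> iu ib; apply: xget_unique.
  exists (const_sect u), (const_sect b); split; [exact: smooth_const_sect|exact: smooth_const_sect|exact: const_sect_at|exact: const_sect_at|].
  by rewrite bracket_iso ?const_sect_at //; exact: smooth_const_sect.
by move=> w [u' [b' [su sb ux bx ->]]]; rewrite bracket_iso ?ux ?bx.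
Qed.

Lemma isotropy_br (u b : A x) : iso u -> iso b -> iso (br u b).
Proof.
move=> iu ib f sf.
have <- : bracket LA (const_sect u) (const_sect b) x = br u b by rewrite bracket_iso ?const_sect_at //; exact: smooth_const_sect.
have sa s : smooth_sect s -> sfun (fun z => anchor LA (s z) f) x.
  by move=> ss; have [_ H] := anchor_smooth LA ss; exact: H.
rewrite (@anchor_bracket R n r M A LA _ _ (@smooth_const_sect u) (@smooth_const_sect b) x f sf) !const_sect_at.
by rewrite (iu _ (sa _ (@smooth_const_sect b))) (ib _ (sa _ (@smooth_const_sect u))) subrr.
Qed.

Lemma br_sum (u : A x) (I : Type) (s : seq I) (p : I -> R) (b : I -> A x) :
  br u (\sum_(i <- s) p i *: b i) = \sum_(i <- s) p i *: br u (b i).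
Proof.
rewrite /br (tcoord_sum bA) //.
under [RHS]eq_bigr do rewrite scaler_sumr.
rewrite [RHS]exchange_big /=; apply: eq_bigr => i _.
under [RHS]eq_bigr do rewrite scaler_sumr.
rewrite [RHS]exchange_big /=; apply: eq_bigr => j _.
under [RHS]eq_bigr do rewrite scalerA.
rewrite -scaler_suml summxE mulr_sumr; congr (_ *: _); apply: eq_bigr => m _.
by rewrite (tcoordZ bA) // mxE mulrCA.
Qed.

Let lieQ (u b : A x) : R :=
  2^-1 * (\sum_i \sum_j t b 0 i * t b 0 j * anchor LA u (fun z => g z (e i z) (e j z))) -
  g x (br u b) b.

Lemma half_lie_isotropy (u b : sect) : smooth_sect u -> smooth_sect b -> iso (b x) ->
  half_lie LA g x u b = lieQ (u x) (b x).
Proof.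
move=> su sb ib; rewrite (half_lieE LA g ky (@se) fe su sb).
rewrite [X in _ + X]big1 ?addr0 => [|i _]; last first.
  by rewrite (ib _ (sf_co ky _ i su)) mul0r.
congr (_ - _); rewrite /br sp_sum; apply: eq_bigr => i _.
by rewrite sp_sum; apply: eq_bigr => j _; rewrite sp_scale.
Qed.

Lemma lieQ_add (u u' b : A x) : lieQ (u + u') b = lieQ u b + lieQ u' b.
Proof.
have brD : br (u + u') b = br u b + br u' b.
  rewrite /br -big_split /=; apply: eq_bigr => i _; rewrite -big_split /=; apply: eq_bigr => j _.
  by rewrite (tcoordD bA) // mxE mulrDl scalerDl.
rewrite /lieQ brD sp_add.
have -> : \sum_i \sum_j t b 0 i * t b 0 j * anchor LA (u + u') (fun z => g z (e i z) (e j z)) =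
  \sum_i \sum_j t b 0 i * t b 0 j * anchor LA u (fun z => g z (e i z) (e j z)) +
  \sum_i \sum_j t b 0 i * t b 0 j * anchor LA u' (fun z => g z (e i z) (e j z)).
  rewrite -big_split /=; apply: eq_bigr => i _; rewrite -big_split /=; apply: eq_bigr => j _.
  have := @anchor_lin R n r M A LA x 1 u u' _ (sf_sp g x (@se i) (@se j)).
  by rewrite scale1r mul1r => ->; rewrite mulrDr.
by ring.
Qed.

Lemma lieQ_isotropy (u b : A x) : iso u -> lieQ u b = - g x (br u b) b.
Proof.
move=> iu; rewrite /lieQ big1 ?mulr0 ?add0r // => i _; apply: big1 => j _.
by rewrite (iu _ (sf_sp g x (@se i) (@se j))) mulr0.
Qed.

(* Any value of T_b b has the same product with a horizontal vector: since b is
   vertical, # b = 0 and D_b b only involves the values at x. *)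
Lemma drestr_vert (b h : A x) (B : forall z, AL z) v : iso b -> B y = b ->
  drestr LA D (b : AL y) (fun z => vpart LA g (B z : A (iota z))) v ->
  g x h v = - lieQ h b.
Proof.
move=> ib By [f [p [q [Z [[sf [U [opU Uy fB]]] pE [sq [W [opW Wy qE]]] [tZ aZ] ->]]]]].
(* The anchor of [b] is zero, so by immersion the tangent vector [Z] of the leaf is zero and the
   coefficients are not differentiated. *)
have Z0 : teq (matlas L) y Z (fun=> 0).
  by apply: (im_immersion hL tZ) => h' sh; rewrite (aZ _ sh); exact: ib.
have qp j : q j y = p j.
  have [_ _ fr] := fB _ Uy.
  apply/eqP; rewrite -subr_eq0; apply/eqP; move: j; apply: fr.
  under eq_bigr do rewrite scalerBl.
  by rewrite sumrB -(qE _ Wy) -pE By vpart_id // subrr.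
rewrite [X in X + _]big1 ?add0r => [|j _]; last by rewrite (Z0 _ (sq j)) scale0r.
(* The section [S] has constant coefficients and passes through [b]. As the anchor of [b] is zero,
   the Koszul formula leaves minus twice the half Lie derivative along [h]. *)
have := koszul_quad hD p x sf (@smooth_const_sect h); rewrite /= -pE const_sect_at.
set S := (fun z => \sum_i p i *: f i z) => K.
have sS : smooth_sect S.
  by apply: smooth_sum => i; apply: smooth_scale => // z; exact: sf_cst.
have Sx : S x = b by rewrite /S -pE.
have H : half_lie LA g x (const_sect h) S = lieQ h b.
  by rewrite (half_lie_isotropy (@smooth_const_sect h) sS) ?Sx ?const_sect_at.
move: H; rewrite /half_lie const_sect_at Sx.
rewrite (ib _ (sf_sp g x sS (@smooth_const_sect h))) mulr0 add0r in K.
have -> : g x h (\sum_i \sum_j (p i * q j y) *: D (f i) (f j) x) =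
    \sum_i \sum_j p i * p j * g x (D (f i) (f j) x) h.
  rewrite sp_sumr; apply: eq_bigr => i _; rewrite sp_sumr; apply: eq_bigr => j _.
  by rewrite sp_scaler qp sp_sym.
by move: K; set a1 := \sum_i _; set a2 := anchor _ _ _; set a3 := g x _ _ => K <-; lra.
Qed.

Lemma drestr_ex (u : A x) (B : forall z, AL z) : iso u ->
  (forall j, sfL (fun z => tcoord k (B z : A (iota z)) 0 j) y) ->
  exists v, drestr LA D (u : AL y) B v.
Proof.
move=> iu sB.
have t0 := tangent_of cL (0 : 'rV[R]_l) cy.
(* The zero tangent vector lifts the anchor of [u], which is vertical. *)
eexists; exists e, (fun i => tcoord k u 0 i), (fun j z => tcoord k (B z : A (iota z)) 0 j), (tvec_of c y 0).
split; [exact: local_frame_of (@se) fe| | | |reflexivity].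
- by rewrite -[LHS]const_sect_at.
- split=> //; exists [set z | mnear (matlas L) z (fun z' => tdom k (iota z') /\
    forall j, e j (iota z') = tfib k (iota z') (delta_mx 0 j))]; split.
  + by apply: (mnear_mopen cL) => z; exact: mnear_mnear.
  + exact: (sm_mnear cL cM (@si y) fe).
  + move=> z /(mnear_self cL) [kz ez].
    by rewrite [LHS](fib_expand bA (B z : A (iota z)) kz); apply: eq_bigr => j _; rewrite ez.
- split=> //; apply/(anchor_lift u cy t0).
  by rewrite (tvec_of_coord cL) // (Pvec_mx cy ky); exact/isoP.
Qed.

(** In coordinates the vertical part is multiplication by [1%:M - hproj], whose entries are smooth
    because the matrices inverted in it are invertible at [y]. *)
Lemma sf_vpart (B : forall z, AL z) :
  (forall j, sfL (fun z => tcoord k (B z : A (iota z)) 0 j) y) ->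
  forall j, sfL (fun z => tcoord k (vpart LA g (B z : A (iota z))) 0 j) y.
Proof.
move=> sB j; apply: (sf1 cL cy).
have sP := sn_Pmx.
have sG : smooth_near (fun z => Gmx k (iota (cinv c z))) (ccoord c y).
  exact: sn_Gmx.
have x0E : cinv c (ccoord c y) = y by exact: (ch_coordK cL cy).
have [Q' Q1] := QP.
have cu : cometric (Pmx c k (cinv c (ccoord c y))) (Gmx k (iota (cinv c (ccoord c y)))) \in unitmx.
  by rewrite x0E; exact: (cometric_unit Gs Gp Q1).
have sI : smooth_near (fun z => invmx (Gmx k (iota (cinv c z)))) (ccoord c y).
  by apply: sn_invmx sG; rewrite x0E; exact: (Gunit Gp).
have sT := sn_trmx sP.
have sh : smooth_near (fun z => hmetric (Pmx c k (cinv c z)) (Gmx k (iota (cinv c z)))) (ccoord c y).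
  apply: (@sn_invmx R _ _ (fun z => cometric (Pmx c k (cinv c z)) (Gmx k (iota (cinv c z)))) _ cu).
  by apply: sn_mulmx sP; exact: sn_mulmx.
have sH : smooth_near (fun z => hproj (Pmx c k (cinv c z)) (Gmx k (iota (cinv c z)))) (ccoord c y).
  by apply: sn_mulmx sI; apply: sn_mulmx sT; exact: sn_mulmx.
have sp : smooth_near (fun z => 1%:M - hproj (Pmx c k (cinv c z)) (Gmx k (iota (cinv c z)))) (ccoord c y).
  apply: sn_mx => i m.
  have -> : (fun z => (1%:M - hproj (Pmx c k (cinv c z)) (Gmx k (iota (cinv c z)))) i m) =
      fun z => 1%:M i m + (-1) * hproj (Pmx c k (cinv c z)) (Gmx k (iota (cinv c z))) i m.
    by apply/funext => z; rewrite mulN1r [LHS]mxE [X in _ + X = _]mxE.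
  apply: snD; first exact: sn_cst.
  by apply: snM; [exact: sn_cst|exact: sn_entry].
have sb : smooth_near (fun z => tcoord k (B (cinv c z) : A (iota (cinv c z)))) (ccoord c y).
  by apply: sn_mx => i m; rewrite ord1; exact: (sfE cy (sB m)).
have near : \forall z \near ccoord c y,
  (tcoord k (B (cinv c z) : A (iota (cinv c z))) *m
    (1%:M - hproj (Pmx c k (cinv c z)) (Gmx k (iota (cinv c z))))) 0 j =
  tcoord k (vpart LA g (B (cinv c z) : A (iota (cinv c z)))) 0 j.
  apply: filterS chart_near => z [cz _ kz].
  by rewrite (vpart_coord cz kz).
apply: (sn_congr near); apply: sn_entry; exact: sn_mulmx.
Qed.

(** Every admissible value has this product with [h], the second half of T being vertical. An
    admissible value must also be exhibited, since otherwise [xget] would return 0. *)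
Lemma tensorT_horizontal (b h : A x) : iso b -> horizontal LA g h ->
  g x h (tensorT LA g D (b : AL y) (b : AL y)) = - lieQ h b.
Proof.
move=> ib hh; rewrite /tensorT.
case: xgetP => [_ -> [B [v1 [v2 [sB By d1 d2 ->]]]]|none].
  rewrite sp_addr (hh _ (vpart_isotropy v2)) addr0.
  have -> : g x h (hpart LA g v1) = g x h v1.
    by rewrite /hpart sp_addr -scaleN1r sp_scaler (hh _ (vpart_isotropy v1)) mulr0 addr0.
  rewrite vpart_id // in d1.
  exact: (@drestr_vert b h B v1 ib By d1).
(* The constant-coefficient extension of [b] provides a value, contradicting [none]. *)
exfalso.
pose B z : AL z := const_sect b (iota z).
have sBz z j (k' : tidx (btrivs A)) : tdom k' (iota z) -> sfL (fun z' => tcoord k' (B z' : A (iota z')) 0 j) z.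
  move=> kz; have H := sect_coord cM bA j (@smooth_const_sect b (iota z)) kz.
  exact: (sf_iota (f := fun z' => tcoord k' (const_sect b z') 0 j) si H).
have iv : iso (vpart LA g b) by rewrite vpart_id.
have sv := sf_vpart (fun j => sBz y j k ky).
have [v1 d1] := drestr_ex (B := fun z => vpart LA g (B z : A (iota z))) iv sv.
have [|v2 d2] := drestr_ex (B := fun z => hpart LA g (B z : A (iota z))) iv.
  move=> j; have H := sfD cL (sBz y j k ky) (sfM cL (sf_cst cL (-1) y) (sv j)).
  apply: (sf_congr cL _ H).
  apply: mnearS (sm_mnear cL cM (@si y) (tdom_near cM bA ky)) => z kz.
  by rewrite mulN1r /hpart (tcoordB bA) // [RHS]mxE [X in _ = _ + X]mxE.
apply: (none (hpart LA g v1 + vpart LA g v2)); exists B, v1, v2; split=> //.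
- move=> z; have [k' kz] := bdl_cover bA (iota z).
  by apply: (sect1 cL bL (k := k' : tidx (restr_trivs A iota)) kz) => j; exact: sBz.
- exact: const_sect_at.
Qed.

(** The isotropy is closed under the bracket, so each [u, b_j] expands in the orthonormal basis with
    the products as coefficients; the diagonal ones are - [lieQ u (b j)]. *)
Lemma trace_ad (s : nat) (b : 'I_s -> A x) (u : A x) : iso u -> is_basis iso b ->
  (forall i j, g x (b i) (b j) = (i == j)%:R) ->
  trace_on iso (isotropy_bracket LA u) = - \sum_j lieQ u (b j).
Proof.
move=> iu bb bo; have [bi bs bf] := bb.
rewrite (@trace_on_basis R (A x) iso _ s b (\matrix_(i, j) g x (isotropy_bracket LA u (b j)) (b i))) //.
- by rewrite -sumrN; apply: eq_bigr => j _; rewrite mxE lieQ_isotropy // opprK isotropy_bracketE.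
- move=> p; rewrite isotropy_bracketE //; last exact: isotropy_sum.
  by rewrite br_sum; apply: eq_bigr => i _; rewrite isotropy_bracketE.
- move=> j; have [p pE] := bs _ (isotropy_br iu (bi j)).
  rewrite isotropy_bracketE // pE; apply: eq_bigr => i _; congr (_ *: _).
  rewrite mxE isotropy_bracketE // pE sp_sum (bigD1 i) //= sp_scale bo eqxx mulr1.
  by rewrite big1 ?addr0 // => m mi; rewrite sp_scale bo (negbTE mi) mulr0.
Qed.

Lemma half_lie_sum (s : nat) (b : 'I_s -> A x) (u : A x) : is_basis iso b ->
  (forall i j, g x (b i) (b j) = (i == j)%:R) ->
  - \sum_j half_lie LA g x (const_sect u) (const_sect (b j)) =
  trace_on iso (isotropy_bracket LA (vpart LA g u)) +
  g x (hpart LA g u) (\sum_j tensorT LA g D (b j : AL y) (b j)).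
Proof.
move=> bb bo; have [bi _ _] := bb.
rewrite (trace_ad (vpart_isotropy u) bb bo) sp_sumr.
have -> : \sum_j g x (hpart LA g u) (tensorT LA g D (b j : AL y) (b j)) =
    - \sum_j lieQ (hpart LA g u) (b j).
  by rewrite -sumrN; apply: eq_bigr => j _; rewrite tensorT_horizontal //; exact: hpart_horizontal.
rewrite -opprD -big_split /=; congr (- _); apply: eq_bigr => j _.
have ibj : iso (const_sect (b j) x) by rewrite const_sect_at.
by rewrite (half_lie_isotropy (@smooth_const_sect u) (@smooth_const_sect (b j)) ibj) !const_sect_at -lieQ_add /hpart addrC subrK.
Qed.

End Isotropy.
End WithFrame.
End SasakiVolume.
End LeafFrame.

Theorem theorem3p2 (R : realType) (n r : nat) (M : manifold R n)
    (A : vbundle M r) (LA : lie_algebroid A) (g : riem_metric A)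
    (D : (forall x : M, A x) -> (forall x : M, A x) -> (forall x : M, A x))
    (hD : is_levi_civita LA g D)
    (l : nat) (L : manifold R l) (iota : L -> M) (hL : is_leaf LA iota)
    (X : totspace A -> tvec R (totspace A)) (hX : is_geodesic_field LA D X)
    (XL : totspace (restr_fib A iota) -> tvec R (totspace (restr_fib A iota)))
    (hXL : restricts_to X XL)
    (a : totspace (restr_fib A iota))
    (i : cidx (restr_atlas A iota)) (hi : cdom i a)
    (s : nat) (b : 'I_s -> A (iota (bproj a)))
    (hb : is_basis (isotropy LA (iota (bproj a))) b)
    (hbo : forall j k : 'I_s, g (iota (bproj a)) (b j) (b k) = (j == k)%:R) :
  let av := vpart LA g (fib_elt a : A (iota (bproj a))) in
  let ah := hpart LA g (fib_elt a : A (iota (bproj a))) in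
  let N := \sum_(j < s)
    tensorT LA g D (b j : restr_fib A iota (bproj a)) (b j) in
  divergence (sasaki LA g D (iota := iota)) XL i a =
    trace_on (isotropy LA (iota (bproj a))) (isotropy_bracket LA av)
    + g (iota (bproj a)) ah N.
Proof.
have hI := leaf_integral hL.
case: a i hi b hb hbo => y u [c k] [cy ky] b hb hbo av ah N.
have [e [se fe]] := ext_frame (mfdP M) (bundleP A) (ky : @tdom R M A r (btrivs A) k (iota y)).
apply: etrans (divergence_half_lie hD hI hX hXL cy ky se fe u hb hbo) _.
exact: (half_lie_sum hD hI hX hXL cy ky se fe u hb hbo).
Qed.
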